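(* Let $\eta\in(0,1)$ and $t\in[2,\infty)$. There exist constants $c,C,C'>0$ depending only on $\eta$ and $t$ such that for every $d\ge 1$, every $\sigma_1\ge\dots\ge\sigma_d>0$ with $\Sigma=\operatorname{diag}(\sigma_1^2,\dots,\sigma_d^2)$, and every $s\in\{1,\dots,d\}$, with $\lambda$, $\nu$ and the test $\psi$ (whose thresholds use the constant $C$) defined in the context, the following hold. (i) [Lower bound] $\epsilon^*(s,t,\Sigma)^t\ \ge\ c\,(\lambda^t s+\nu^t)$. (ii) [Upper bound] The test $\psi$ satisfies $$\mathbb P_0(\psi=1)\le \eta/2,\qquad\text{and}\qquad \mathbb P_\theta(\psi=0)\le\eta/2\ \text{ for every }\theta\in\mathbb R^d\text{ with }\|\theta\|_0\le s\text{ and }\|\theta\|_t^t\ge C'(\lambda^t s+\nu^t).$$ Therefore $\epsilon^*(s,t,\Sigma)^t\le C'(\lambda^t s+\nu^t)$.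
   Context: Testing problem. Let $d\ge1$, $[d]=\{1,\dots,d\}$, $\sigma_1\ge\dots\ge\sigma_d>0$ known, $\Sigma=\operatorname{diag}(\sigma_1^2,\dots,\sigma_d^2)$. For $\theta\in\mathbb R^d$, $\mathbb P_\theta$ denotes the law of $X\sim\mathcal N(\theta,\Sigma)$. For $u\in\mathbb R^d$: $\|u\|_t=(\sum_j|u_j|^t)^{1/t}$ and $\|u\|_0=\operatorname{Card}\{j: u_j\ne0\}$. For $\epsilon>0$, $s\in[d]$: $\Theta(\epsilon,s,t)=\{\theta\in\mathbb R^d: \|\theta\|_t\ge\epsilon,\ \|\theta\|_0\le s\}$. One tests $H_0:\theta=0$ against $H_1:\theta\in\Theta(\epsilon,s,t)$. A test is a measurable function $\psi:\mathbb R^d\to\{0,1\}$ of $X$; its risk is $R(\psi,\epsilon,s,t,\Sigma)=\mathbb P_0(\psi=1)+\sup_{\theta\in\Theta(\epsilon,s,t)}\mathbb P_\theta(\psi=0)$; the minimax risk is $R^*(\epsilon,s,t,\Sigma)=\inf_\psi R(\psi,\epsilon,s,t,\Sigma)$ over all tests. For the fixed $\eta\in(0,1)$, the minimax separation radius is $\epsilon^*(s,t,\Sigma)=\inf\{\epsilon>0: R^*(\epsilon,s,t,\Sigma)\le\eta\}$. Parameters for $t\ge2$. Let $\beta\in\mathbb R$ be the unique solution of $$\frac{\sum_{j=1}^d\sigma_j^t e^{-\beta/\sigma_j^2}}{\sqrt{\sum_{j=1}^d\sigma_j^{2t}e^{-\beta/\sigma_j^2}}}=\frac s2,$$ and let $\lambda=\sqrt{\max(\beta,0)}$,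 $\nu=\big[\sum_{j=1}^d\sigma_j^{2t}e^{-\lambda^2/\sigma_j^2}\big]^{1/(2t)}$, $j_*=\max\{j\in[d]:\sigma_j\ge\lambda\}$ (with $j_*=0$ if no such $j$ exists), $\rho=\lambda^t s+\nu^t$. Test. Let $\tau=(4t)^t\lambda^t+\nu^t/s$ and, for $j>j_*$, $\alpha_j=\mathbb E\big[|Z_j|^t\,\big|\,|Z_j|^t>\tau\big]$ with $Z_j\sim\mathcal N(0,\sigma_j^2)$. Define $$T_{dense}=\sum_{j\le j_*}\big(|X_j|^t-\mathbb E_{0}|X_j|^t\big),\qquad T_{sparse}=\sum_{j>j_*}\big(|X_j|^t-\alpha_j\big)\mathbf 1\{|X_j|^t>\tau\},$$ where $\mathbb E_0$ is expectation under $\theta=0$ and empty sums are $0$. For a constant $C>0$ let $$\psi_{dense}=\mathbf 1\Big\{T_{dense}>C\Big(\sum_{j\le j_*}\sigma_j^{2t}\Big)^{1/2}\Big\},\quad \psi_{sparse}=\mathbf 1\{T_{sparse}>C\rho\},\quad \psi=\max(\psi_{dense},\psi_{sparse}).$$ *)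

(* Defs.v *)
From HB Require Import structures.
From mathcomp Require Import all_boot all_order all_algebra.
From mathcomp Require Import all_classical all_reals all_analysis.
From mathcomp Require Import measurable_realfun.
Set Implicit Arguments.
Unset Strict Implicit.
Unset Printing Implicit Defensive.
Import Order.TTheory GRing.Theory Num.Theory.
Import numFieldNormedType.Exports.
Local Open Scope classical_set_scope.
Local Open Scope ring_scope.

Section product_probability.
Context (dsp : measure_display) (T : measurableType dsp) (R : realType).

Definition tuple_cons n (x : T * n.-tuple T) : n.+1.-tuple T :=
  [tuple of x.1 :: x.2].

Lemma measurable_tuple_cons n : measurable_fun setT (@tuple_cons n).
Proof. exact: measurable_cons. Qed.

HB.instance Definition _ n :=
  isMeasurableFun.Build _ _ _ _ (@tuple_cons n) (@measurable_tuple_cons n).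

(* The product of n probability measures, on the sigma-algebra of n.-tuple T
   generated by the coordinates; prod_prob_rect below characterizes it. *)
Fixpoint prod_prob n : ('I_n -> probability T R) -> probability (n.-tuple T) R :=
  match n with
  | 0 => fun _ => dirac ([tuple] : 0.-tuple T)
  | n'.+1 => fun P =>
      distribution (P ord0 \x prod_prob (fun i => P (lift ord0 i)))%E
                   (@tuple_cons n' : {mfun _ >-> _})
  end.

Lemma prod_prob_rect n (P : 'I_n -> probability T R) (A : 'I_n -> set T) :
  (forall i, measurable (A i)) ->
  prod_prob P [set x | forall i, A i (tnth x i)] = (\prod_(i < n) P i (A i))%E.
Proof.
elim: n P A => [|n IH] P A mA.
  rewrite big_ord0 /= diracE mem_set//.
  by case.
rewrite big_ord_recl -IH // -product_measure1E //=; last first.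
  rewrite [X in measurable X](_ : _ = \bigcap_(i in [set: 'I_n])
     ((fun x : n.-tuple T => tnth x i) @^-1` (A (lift ord0 i)))); last first.
    by apply/seteqP; split=> x /= h i; [move=> _|]; exact: h.
  apply: fin_bigcap_measurable => // i _.
  by rewrite -[X in measurable X]setTI; exact: measurable_tnth.
rewrite /distribution /pushforward /=; congr (_ _).
apply/seteqP; split=> -[x y] /= h.
  split; first exact: (h ord0).
  by move=> i; have := h (lift ord0 i); rewrite tnthS.
move=> i; case: (unliftP ord0 i) => [j ->|->]; last exact: h.1.
by rewrite tnthS; exact: h.2.
Qed.

End product_probability.

Section testing.
Context (R : realType).

Notation Rd d := (d.-tuple (measurableTypeR R)).
Implicit Types (d s : nat) (t : R).

(* N(theta, diag(sigma_1^2, ..., sigma_d^2)); the second argument of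
   normal_prob is the standard deviation. *)
Definition gaussian d (theta sigma : Rd d) : probability (Rd d) R :=
  prod_prob (fun j => normal_prob (tnth theta j) (tnth sigma j)).

Definition vec0 d : Rd d := [tuple 0 | _ < d].

Definition norm t d (u : Rd d) : R :=
  (\sum_(j < d) `|tnth u j| `^ t) `^ t^-1.

Definition norm0 d (u : Rd d) : nat := #|[set j : 'I_d | tnth u j != 0]%SET|.

Definition alternatives (eps : R) s t d : set (Rd d) :=
  [set theta | eps <= norm t theta /\ (norm0 theta <= s)%N].

Definition risk d (psi : {mfun Rd d >-> bool}) (eps : R) s t (sigma : Rd d)
    : \bar R :=
  (gaussian (vec0 d) sigma [set x | psi x = true] +
   ereal_sup [set gaussian theta sigma [set x | psi x = false]
             | theta in @alternatives eps s t d])%E.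

Definition minimax_risk d (eps : R) s t (sigma : Rd d) : \bar R :=
  ereal_inf [set risk psi eps s t sigma | psi in [set: {mfun Rd d >-> bool}]].

(* Valued in \bar R, so that the infimum of the empty set would be +oo. *)
Definition separation_radius (eta : R) d s t (sigma : Rd d) : \bar R :=
  ereal_inf [set eps%:E | eps in
    [set eps : R | 0 < eps /\ (minimax_risk eps s t sigma <= eta%:E)%E]].

(* For d, s >= 1 and positive sigma the left-hand side decreases strictly in b
   from +oo to 0, so there is exactly one solution and the default value of
   get in beta plays no role. *)
Definition is_beta d s t (sigma : Rd d) (b : R) : Prop :=
  (\sum_(j < d) tnth sigma j `^ t * expR (- b / tnth sigma j ^+ 2)) /
  Num.sqrt (\sum_(j < d) tnth sigma j `^ (2 * t) *
                         expR (- b / tnth sigma j ^+ 2))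
  = s%:R / 2.

Definition beta d s t (sigma : Rd d) : R := get (is_beta s t sigma).

Definition lambda d s t (sigma : Rd d) : R :=
  Num.sqrt (Num.max (beta s t sigma) 0).

Definition nu d s t (sigma : Rd d) : R :=
  (\sum_(j < d) tnth sigma j `^ (2 * t) *
     expR (- lambda s t sigma ^+ 2 / tnth sigma j ^+ 2)) `^ (2 * t)^-1.

(* Coordinates are indexed from 0 by 'I_d, hence the j.+1 here, and the
   1-based condition j <= j_* reads (j < jstar)%N below. *)
Definition jstar d s t (sigma : Rd d) : nat :=
  \max_(j < d | lambda s t sigma <= tnth sigma j) j.+1.

Definition rho d s t (sigma : Rd d) : R :=
  lambda s t sigma `^ t * s%:R + nu s t sigma `^ t.

Definition tau d s t (sigma : Rd d) : R :=
  (4 * t) `^ t * lambda s t sigma `^ t + nu s t sigma `^ t / s%:R.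

(* E[X | A], conditioning on an event of positive probability *)
Definition event_cond_expectation dsp (T : measurableType dsp)
    (P : probability T R) (X : T -> R) (A : set T) : R :=
  fine 'E_P[X \* \1_A] / fine (P A).

Definition alpha d s t (sigma : Rd d) (j : 'I_d) : R :=
  event_cond_expectation (normal_prob 0 (tnth sigma j))
    (fun z : R => `|z| `^ t) [set z : R | tau s t sigma < `|z| `^ t].

Definition T_dense d s t (sigma x : Rd d) : R :=
  \sum_(j < d | (j < jstar s t sigma)%N)
    (`|tnth x j| `^ t -
     fine 'E_(gaussian (vec0 d) sigma)[fun y : Rd d => `|tnth y j| `^ t]).

Definition T_sparse d s t (sigma x : Rd d) : R :=
  \sum_(j < d | (jstar s t sigma <= j)%N)
    (`|tnth x j| `^ t - alpha s t sigma j) *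
    \1_[set y : R | tau s t sigma < `|y| `^ t] (tnth x j).

Definition psi_dense (C : R) d s t (sigma x : Rd d) : bool :=
  C * Num.sqrt (\sum_(j < d | (j < jstar s t sigma)%N)
                  tnth sigma j `^ (2 * t))
  < T_dense s t sigma x.

Definition psi_sparse (C : R) d s t (sigma x : Rd d) : bool :=
  C * rho s t sigma < T_sparse s t sigma x.

Definition psi_test (C : R) d s t (sigma x : Rd d) : bool :=
  psi_dense C s t sigma x || psi_sparse C s t sigma x.

Lemma measurable_coord_powR d (j : 'I_d) t :
  measurable_fun [set: Rd d] (fun x : Rd d => `|tnth x j| `^ t).
Proof.
apply: (@measurableT_comp _ _ _ _ _ _ (fun y : R => `|y| `^ t)).
  apply: (@measurableT_comp _ _ _ _ _ _ (@powR R ^~ t)) => //.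
exact: measurable_tnth.
Qed.

Lemma measurable_psi_test (C : R) d s t (sigma : Rd d) :
  measurable_fun setT (psi_test C s t sigma).
Proof.
have mI (A : set R) (j : 'I_d) : measurable A ->
    measurable_fun [set: Rd d] (fun x : Rd d => \1_A (tnth x j) : R).
  move=> mA; apply: (@measurableT_comp _ _ _ _ _ _ (\1_A : R -> R)).
    exact: measurable_indic.
  exact: measurable_tnth.
have mS (P : pred 'I_d) (h : 'I_d -> Rd d -> R) :
    (forall j, measurable_fun [set: Rd d] (h j)) ->
    measurable_fun [set: Rd d] (fun x => \sum_(j < d | P j) h j x).
  move=> mh; rewrite (_ : (fun x => _) = fun x =>
    \sum_(j <- seq.filter P (index_enum 'I_d)) h j x); first exact: measurable_sum.
  by apply/funext => x; rewrite big_filter.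
apply: measurable_or; apply: measurable_fun_ltr => //; apply: mS => j.
  by apply: measurable_funB => //; exact: measurable_coord_powR.
apply: measurable_funM.
  by apply: measurable_funB => //; exact: measurable_coord_powR.
apply: mI.
rewrite -[X in measurable X]setTI.
have mp : measurable_fun [set: R] (fun y : R => `|y| `^ t).
  exact: (@measurableT_comp _ _ _ _ _ _ (@powR R ^~ t)).
rewrite (_ : [set y | _] = (fun y : R => `|y| `^ t) @^-1` `]tau s t sigma, +oo[).
  exact: mp.
by apply/seteqP; split => y /=; rewrite in_itv/= andbT.
Qed.

HB.instance Definition _ C d s t (sigma : Rd d) :=
  isMeasurableFun.Build _ _ _ _ (psi_test C s t sigma)
    (measurable_psi_test C s t sigma).

End testing.

(* Main.v *)
(** Upper bound.  Both statistics are sums of independent terms, so it is enough to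
    bound means and variances and to apply Chebyshev's inequality.  In the dense
    part, Clarkson's inequality gives [E|theta + Z|^t - E|Z|^t >= |theta|^t].  In the
    sparse part, a coordinate with [theta_j = 0] has variance at most a constant
    times [sigma_j^2t exp (- lambda^2 / sigma_j^2)], which sums to [nu^2t], while at
    most [s] coordinates contribute a bias or a variance of order [tau].

    Lower bound.  The weights [pi_j = sigma_j^t exp (- lambda^2 / sigma_j^2) / nu^t]
    have total mass at most [s / 2].  The coordinates, in decreasing order of
    [sigma_j], are cut into at most [s] consecutive groups of mass between 1/2 and
    3/2, and the prior picks in each group one coordinate, with probability
    proportional to [pi_j], and gives it the value [+/- k max (lambda, sigma_j)].
    This prior is [s]-sparse with certainty, its norm is bounded below with
    certainty, and the second moment of its likelihood ratio is at most
    [exp (8 e k^4)]. *)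
Require Import Defs.
From mathcomp Require Import all_boot all_order all_algebra.
From mathcomp Require Import all_classical all_reals all_analysis.
From mathcomp Require Import measurable_realfun ring lra.
Set Implicit Arguments.
Unset Strict Implicit.
Unset Printing Implicit Defensive.
Import Order.TTheory GRing.Theory Num.Theory.
Import numFieldNormedType.Exports.
Local Open Scope classical_set_scope.
Local Open Scope ring_scope.

(** * Gaussian integrals on the line *)

(** Every constant must be free of [d], [sigma] and [s], and this shapes both halves. One-coordinate
    estimates are reduced to N(0, 1) by scaling, so that their constants depend on [t] and a
    tolerance only. Under an alternative the fluctuations of [|X_j|^t] grow with the signal itself;
    Chebyshev's inequality at half the signal tolerates this only if the second moments carry an
    arbitrarily small multiple of [|theta_j|^2t], which becomes [eta / 16]. The factor
    [exp (- lambda^2 / sigma_j^2)] is met from both sides: beyond [2 lambda] the Gaussian tail pays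
    it for the sparse statistic, while in the prior [pi_j^2] contains it twice, and one copy is
    spent on the amplitude [max (lambda, sigma_j)]. A prior with independent coordinates would be
    sparse only with high probability and would have to be conditioned; drawing one coordinate per
    group avoids this, and since the groups are independent with disjoint supports the second moment
    still factorizes. The price is that a group only guarantees its smallest amplitude, whence the
    decreasing order. *)

Lemma ge0_integral_density d (T : measurableType d) (R : realType)
    (mu : {sigma_finite_measure set T -> \bar R})
    (nu : {finite_measure set T -> \bar R}) (g : T -> R) (f : T -> \bar R) :
  measurable_fun setT g -> (forall x, 0 <= g x) ->
  (forall A, measurable A -> nu A = (\int[mu]_(x in A) (g x)%:E)%E) ->
  measurable_fun setT f -> (forall x, 0 <= f x)%E ->
  (\int[nu]_x f x = \int[mu]_x (f x * (g x)%:E))%E.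
Proof.
move=> mg g0 nug mf f0.
have mEg : measurable_fun setT (EFin \o g) by exact/measurable_EFinP.
have dom : nu `<< mu.
  apply/null_content_dominatesP => A mA muA0; rewrite nug//.
  by rewrite null_set_integral//; exact: measurable_funTS.
rewrite -(Radon_Nikodym_SigmaFinite.change_of_variables dom)//.
have fi := Radon_Nikodym_SigmaFinite.f_integrable dom.
apply: ae_eq_integral => //.
- by apply: emeasurable_funM => //; exact: measurable_int fi.
- exact: emeasurable_funM.
(* [g] and the Radon-Nikodym derivative have the same integral over every measurable set, hence
   agree almost everywhere. *)
- apply: ae_eqe_mul2l; apply: integral_ae_eq => // A _ mA.
  by rewrite -Radon_Nikodym_SigmaFinite.f_integral// nug.
Qed.

Section affine.
Context (R : realType).
Notation mu := (@lebesgue_measure R).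
Notation RR := (measurableTypeR R).

Lemma measurable_affine (a b : R) :
  measurable_fun setT (fun x : RR => (a * (x : R) + b)%R : RR).
Proof. by apply: measurable_funD => //; exact: measurable_funM. Qed.

(** The image of Lebesgue measure under the affine map, multiplied by [a], gives every half-open
    interval its length, so it is Lebesgue measure by uniqueness. *)
Lemma ge0_integral_lebesgue_affine (a b : R) (f : RR -> \bar R) : 0 < a ->
  measurable_fun setT f -> (forall x, 0 <= f x)%E ->
  (\int[mu]_x f x = a%:E * \int[mu]_x f (a * (x : R) + b)%R)%E.
Proof.
move=> a0 mf f0.
pose g : RR -> RR := fun x => a * (x : R) + b.
have mg : measurable_fun setT g := measurable_affine a b.
pose m : {measure set RR -> \bar R} := mscale (NngNum (ltW a0)) (pushforward mu g).
rewrite (@eq_measure_integral _ _ _ _ (m mg)).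
  rewrite ge0_integral_mscale//; congr (_ * _)%E.
  by rewrite ge0_integral_pushforward.
move=> A mA _; apply: lebesgue_measure_unique => //= _ [[u v]] _ <-.
rewrite /m /mscale /= /pushforward.
have -> : g @^-1` `]u, v] = `](u - b) / a, (v - b) / a]%classic.
  apply/seteqP; split => x /=; rewrite !in_itv/= /g ltr_pdivrMr// ler_pdivlMr// mulrC => /andP[? ?].
    by rewrite ltrBlDr lerBrDr; apply/andP.
  by rewrite -ltrBlDr -lerBrDr; apply/andP.
rewrite !lebesgue_measure_itv /= !lte_fin ltr_pM2r ?invr_gt0// ltrD2r.
case: ifP => _; last by rewrite mule0.
rewrite -!EFinD -EFinM; congr EFin; field; exact: lt0r_neq0.
Qed.

Lemma ge0_integral_lebesgueN (f : RR -> \bar R) :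
  measurable_fun setT f -> (forall x, 0 <= f x)%E ->
  (\int[mu]_x f x = \int[mu]_x f (- (x : R))%R)%E.
Proof.
move=> mf f0.
have mN : measurable_fun setT (fun x : RR => (- (x : R))%R : RR).
  exact: oppr_measurable.
transitivity (\int[pushforward mu (fun x : RR => (- (x : R))%R : RR)]_x f x)%E.
  by apply: eq_measure_integral => //= A mA _; exact/esym/lebesgue_measureN.
by rewrite ge0_integral_pushforward.
Qed.

Lemma ge0_integral_normal (m s : R) (f : RR -> \bar R) :
  measurable_fun setT f -> (forall x, 0 <= f x)%E ->
  (\int[normal_prob m s]_x f x = \int[mu]_x (f x * (normal_pdf m s x)%:E))%E.
Proof.
move=> mf f0; apply: ge0_integral_density => //.
- exact: measurable_normal_pdf.
- by move=> x; exact: normal_pdf_ge0.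
Qed.

Lemma measurable_fun_mul_normal_pdf (m s : R) (f : RR -> \bar R) :
  measurable_fun setT f ->
  measurable_fun setT (fun x : RR => f x * (normal_pdf m s x)%:E)%E.
Proof.
move=> mf; apply: emeasurable_funM => //; apply/measurable_EFinP.
exact: measurable_normal_pdf.
Qed.

Lemma mul_normal_pdf_ge0 (m s : R) (f : RR -> \bar R) :
  (forall x, 0 <= f x)%E -> forall x : RR, (0 <= f x * (normal_pdf m s x)%:E)%E.
Proof. by move=> f0 x; rewrite mule_ge0// lee_fin normal_pdf_ge0. Qed.

Lemma normal_peak_scale (s : R) : 0 < s -> normal_peak s * s = normal_peak 1.
Proof.
move=> s0; rewrite /normal_peak expr1n mul1r -mulrnAr sqrtrM ?sqr_ge0//.
rewrite sqrtr_sqr gtr0_norm// invfM mulrC mulrA divff ?mul1r//; exact: lt0r_neq0.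
Qed.

Lemma ge0_integral_normal_std (m s : R) (f : RR -> \bar R) : 0 < s ->
  measurable_fun setT f -> (forall x, 0 <= f x)%E ->
  (\int[normal_prob m s]_x f x =
   \int[normal_prob 0 1]_x f (s * (x : R) + m)%R)%E.
Proof.
move=> s0 mf f0.
have mfa : measurable_fun setT (fun x : RR => f (s * (x : R) + m)%R).
  exact: (measurableT_comp mf (measurable_affine s m)).
have fa0 (x : RR) : (0 <= f (s * (x : R) + m)%R)%E by [].
have mp := measurable_fun_mul_normal_pdf m s mf.
have p0 := mul_normal_pdf_ge0 m s f0.
rewrite (ge0_integral_normal m s mf f0) (ge0_integral_normal 0 1 mfa fa0).
rewrite (ge0_integral_lebesgue_affine m s0 mp p0).
rewrite -ge0_integralZl.
- apply: eq_integral => x _; rewrite muleCA -EFinM; congr (_ * _%:E)%E.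
  rewrite !normal_pdfE ?oner_neq0 ?gt_eqF//.
  rewrite mulrA (mulrC s (normal_peak s)) normal_peak_scale//.
  congr (_ * _); rewrite /normal_fun addrK subr0; congr expR.
  field; exact: lt0r_neq0.
- exact: measurableT.
- exact: (measurableT_comp mp (measurable_affine s m)).
- by move=> x _; exact: p0.
- by rewrite lee_fin ltW.
Qed.

Lemma ge0_integral_normalN (f : RR -> \bar R) :
  measurable_fun setT f -> (forall x, 0 <= f x)%E ->
  (\int[normal_prob 0 1]_x f (- (x : R))%R = \int[normal_prob 0 1]_x f x)%E.
Proof.
move=> mf f0.
have mN : measurable_fun setT (fun x : RR => f (- (x : R))%R).
  by apply: (measurableT_comp mf); exact: oppr_measurable.
have fN0 (x : RR) : (0 <= f (- (x : R))%R)%E by [].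
rewrite (ge0_integral_normal 0 1 mf f0) (ge0_integral_normal 0 1 mN fN0).
rewrite [RHS](ge0_integral_lebesgueN (measurable_fun_mul_normal_pdf 0 1 mf)
  (mul_normal_pdf_ge0 0 1 f0)).
apply: eq_integral => x _; congr (_ * _%:E)%E.
by rewrite !normal_pdfE ?oner_neq0// /normal_fun !subr0 sqrrN.
Qed.

(** Density of N(m, s^2) with respect to N(0, s^2). *)
Definition gauss_lr (s m x : R) : R :=
  expR (m * x / s ^+ 2 - m ^+ 2 / (2 * s ^+ 2)).

Lemma measurable_gauss_lr s m : measurable_fun [set: RR] (gauss_lr s m).
Proof.
apply: measurableT_comp => //; apply: measurable_funB => //.
by apply: measurable_funM => //; exact: measurable_funM.
Qed.

Lemma ge0_integral_normal_shift (m s : R) (f : RR -> \bar R) : 0 < s ->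
  measurable_fun setT f -> (forall x, 0 <= f x)%E ->
  (\int[normal_prob m s]_x f x =
   \int[normal_prob 0 s]_x (f x * (gauss_lr s m x)%:E))%E.
Proof.
move=> s0 mf f0.
have mg : measurable_fun setT (fun x : RR => f x * (gauss_lr s m x)%:E)%E.
  by apply: emeasurable_funM => //; apply/measurable_EFinP; exact: measurable_gauss_lr.
have g0 (x : RR) : (0 <= f x * (gauss_lr s m x)%:E)%E.
  by rewrite mule_ge0// lee_fin expR_ge0.
rewrite (ge0_integral_normal m s mf f0) (ge0_integral_normal 0 s mg g0).
apply: eq_integral => x _; rewrite -muleA -EFinM; congr (_ * _%:E)%E.
rewrite !normal_pdfE ?gt_eqF// mulrCA; congr (_ * _).
rewrite /normal_fun /gauss_lr -expRD; congr expR; field; exact: lt0r_neq0.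
Qed.

(* The bounded density of N(0, 1) with respect to N(0, 4) turns exponential
   moments into suprema, and, after standardization, doubles a tail threshold. *)
Lemma ge0_integral_normal_rescale (f : RR -> \bar R) :
  measurable_fun setT f -> (forall x, 0 <= f x)%E ->
  (\int[normal_prob 0 1]_x f x =
   \int[normal_prob 0 2]_x (f x * (2 * expR (- (3 / 8) * (x : R) ^+ 2))%:E))%E.
Proof.
move=> mf f0.
have mg : measurable_fun setT
    (fun x : RR => f x * (2 * expR (- (3 / 8) * (x : R) ^+ 2))%:E)%E.
  apply: emeasurable_funM => //; apply/measurable_EFinP.
  apply: measurable_funM => //; apply: measurableT_comp => //.
  by apply: measurable_funM => //; exact: measurable_funX.
have g0 (x : RR) : (0 <= f x * (2 * expR (- (3 / 8) * (x : R) ^+ 2))%:E)%E.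
  by rewrite mule_ge0// lee_fin mulr_ge0// expR_ge0.
rewrite (ge0_integral_normal 0 1 mf f0) (ge0_integral_normal 0 2 mg g0).
apply: eq_integral => x _; rewrite -muleA -EFinM; congr (_ * _%:E)%E.
rewrite !normal_pdfE ?oner_neq0 ?pnatr_eq0// -(@normal_peak_scale 2)//.
have -> : normal_fun 0 1 x = expR (- (3 / 8) * (x : R) ^+ 2) * normal_fun 0 2 x.
  rewrite /normal_fun !subr0 -expRD; congr expR; field; by [].
by ring.
Qed.

End affine.

Lemma ge0_le_integralT d (T : measurableType d) (R : realType)
    (mu : {measure set T -> \bar R}) (f g : T -> \bar R) :
  measurable_fun setT f -> measurable_fun setT g ->
  (forall x, 0 <= f x)%E -> (forall x, f x <= g x)%E ->
  (\int[mu]_x f x <= \int[mu]_x g x)%E.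
Proof. by move=> mf mg f0 fg; apply: ge0_le_integral. Qed.

Lemma integral_cst_prob d (T : measurableType d) (R : realType)
    (P : probability T R) (c : R) : (\int[P]_x c%:E = c%:E)%E.
Proof. by rewrite integral_cst//= probability_setT mule1. Qed.

Section gaussian_moments.
Context (R : realType).
Notation RR := (measurableTypeR R).
Notation N01 := (normal_prob (0 : R) 1).

Definition tail_set (p tau : R) : set RR := [set x : RR | tau < `|x : R| `^ p].

Lemma measurable_normr_powR (p a b : R) :
  measurable_fun [set: RR] (fun x : RR => `|a * (x : R) + b| `^ p).
Proof.
apply: (@measurableT_comp _ _ _ _ _ _ (@powR R ^~ p)) => //.
apply: measurableT_comp => //; exact: measurable_affine.
Qed.

Lemma measurable_normr_powR0 (p : R) :
  measurable_fun [set: RR] (fun x : RR => `|x : R| `^ p).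
Proof. exact: (@measurableT_comp _ _ _ _ _ _ (@powR R ^~ p)). Qed.

Lemma measurable_tail_set (p tau : R) : measurable (tail_set p tau).
Proof.
rewrite -[X in measurable X]setTI.
rewrite (_ : tail_set p tau = (fun y : RR => `|y : R| `^ p) @^-1` `]tau, +oo[).
  exact: measurable_normr_powR0.
by apply/seteqP; split => y /=; rewrite in_itv/= andbT.
Qed.

(** From [1 + u <= exp u], [x^2 <= 4p exp (x^2 / 4p)]; raise this to the power [p / 2]. The exponent
    1/8 is what remains of the 3/8 in the N(0, 4) density once the moment below has used 1/4. *)
Lemma normr_powR_le_expR (p : R) : 0 < p ->
  exists2 B : R, 0 <= B & forall x, `|x| `^ p <= B * expR (x ^+ 2 / 8).
Proof.
move=> p0; exists ((4 * p) `^ (p / 2)); first exact: powR_ge0.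
move=> x.
have -> : `|x| `^ p = (x ^+ 2) `^ (p / 2).
  by rewrite -real_normK ?num_real// -powR_mulrn// -powRrM; congr (_ `^ _); field.
have le_x : x ^+ 2 <= 4 * p * expR (x ^+ 2 / (4 * p)).
  rewrite -ler_pdivrMl ?mulr_gt0// mulrC; apply: le_trans (expR_ge1Dx _).
  by rewrite lerDr.
have e0 : 0 <= 4 * p by rewrite mulr_ge0// ltW.
apply: (le_trans (ge0_ler_powR _ _ _ le_x)); rewrite ?nnegrE ?sqr_ge0//.
- by rewrite divr_ge0// ltW.
- by rewrite mulr_ge0// expR_ge0.
rewrite powRM ?expR_ge0// -expRM ler_wpM2l ?powR_ge0// ler_expR.
rewrite (_ : _ * (p / 2) = x ^+ 2 / 8)//; field; exact: lt0r_neq0.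
Qed.

Lemma measurable_expR_sqr (c : R) :
  measurable_fun [set: RR] (fun x : RR => expR (c * (x : R) ^+ 2)).
Proof.
by apply: measurableT_comp => //; apply: measurable_funM => //; exact: measurable_funX.
Qed.

Lemma normal_exp_moment (p : R) : 0 < p -> exists2 K : R, 0 <= K &
  (\int[N01]_x (`|x : R| `^ p * expR (1 / 4 * (x : R) ^+ 2))%:E <= K%:E)%E.
Proof.
move=> p0; have [B B0 leB] := normr_powR_le_expR p0.
exists (2 * B); first by rewrite mulr_ge0.
have mf : measurable_fun setT
    (fun x : RR => (`|x : R| `^ p * expR (1 / 4 * (x : R) ^+ 2))%:E).
  apply/measurable_EFinP; apply: measurable_funM; first exact: measurable_normr_powR0.
  exact: measurable_expR_sqr.
have f0 (x : RR) : (0 <= (`|x : R| `^ p * expR (1 / 4 * (x : R) ^+ 2))%:E)%E.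
  by rewrite lee_fin mulr_ge0 ?powR_ge0 ?expR_ge0.
rewrite (ge0_integral_normal_rescale mf f0).
rewrite -(integral_cst_prob (normal_prob 0 2) (2 * B)).
apply: ge0_le_integralT.
- apply: emeasurable_funM => //; apply/measurable_EFinP.
  by apply: measurable_funM => //; exact: measurable_expR_sqr.
- exact: measurable_cst.
- by move=> x; rewrite mule_ge0// lee_fin mulr_ge0// expR_ge0.
- move=> x; rewrite -EFinM lee_fin.
  rewrite mulrCA ler_pM2l//. rewrite -(mulrA (_ `^ _)) -expRD.
  rewrite (_ : _ + _ = - ((x : R) ^+ 2 / 8)); last by field.
  by rewrite expRN ler_pdivrMr ?expR_gt0.
Qed.

(** The centering [alpha_j] is a conditional expectation, so its bound has to be proportional to the
    tail probability itself. Passing from N(0, 4) back to N(0, 1) turns the tail at [2^p tau] into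
    the tail at [tau], and the Gaussian factor left over absorbs [|x|^p]. *)
Lemma normal_tail_moment (p : R) : 0 < p -> exists2 K : R, 0 <= K &
  forall tau : R,
  (\int[N01]_x (`|x : R| `^ p * \1_(tail_set p (2 `^ p * tau)) x)%:E
   <= K%:E * N01 (tail_set p tau))%E.
Proof.
move=> p0; have [B B0 leB] := normr_powR_le_expR p0.
have K0 : 0 <= 2 `^ p * (2 * B) by rewrite !mulr_ge0// powR_ge0.
exists (2 `^ p * (2 * B)) => // tau.
set f : RR -> \bar R := fun x => (_)%:E.
have mf : measurable_fun setT f.
  apply/measurable_EFinP; apply: measurable_funM; first exact: measurable_normr_powR0.
  by apply: measurable_indic; exact: measurable_tail_set.
have f0 (x : RR) : (0 <= f x)%E by rewrite lee_fin mulr_ge0 ?powR_ge0.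
pose g x := (f x * (2 * expR (- (3 / 8) * (x : R) ^+ 2))%:E)%E.
have mg : measurable_fun setT g.
  apply: emeasurable_funM => //; apply/measurable_EFinP.
  by apply: measurable_funM => //; exact: measurable_expR_sqr.
have g0 x : (0 <= g x)%E by rewrite mule_ge0// lee_fin mulr_ge0// expR_ge0.
have two0 : 0 < 2 :> R by [].
rewrite (ge0_integral_normal_rescale mf f0) (ge0_integral_normal_std 0 two0 mg g0).
have -> : N01 (tail_set p tau) = (\int[N01]_x (\1_(tail_set p tau) x)%:E)%E.
  by rewrite integral_indic ?setIT//; exact: measurable_tail_set.
have mI : measurable_fun [set: RR] (fun x : RR => (\1_(tail_set p tau) x : R)%:E).
  by apply/measurable_EFinP/measurable_indic; exact: measurable_tail_set.
rewrite -ge0_integralZl; [|exact: measurableT|exact: mI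
  |by move=> x _; rewrite lee_fin|by rewrite lee_fin].
apply: ge0_le_integralT.
- exact: (measurableT_comp mg (measurable_affine 2 0)).
- exact: emeasurable_funM.
- by move=> x.
move=> x; rewrite /g /f -!EFinM lee_fin addr0 /=.
have -> : \1_(tail_set p (2 `^ p * tau)) (2 * x : RR) = \1_(tail_set p tau) x :> R.
  rewrite !indicE; congr (nat_of_bool _)%:R; apply/idP/idP => /set_mem h;
    apply/mem_set; move: h; rewrite /tail_set/=.
  - by rewrite normrM powRM// ger0_norm// ltr_pM2l// powR_gt0.
  - by rewrite normrM powRM// ger0_norm// ltr_pM2l// powR_gt0.
rewrite [leLHS]mulrAC ler_wpM2r//.
rewrite normrM powRM// ger0_norm// -mulrA ler_wpM2l ?powR_ge0//.
rewrite mulrCA ler_pM2l//.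
apply: (@le_trans _ _ (`|x : R| `^ p / expR ((x : R) ^+ 2 / 8))).
  rewrite ler_wpM2l ?powR_ge0// -expRN ler_expR exprMn.
  by have := sqr_ge0 (x : R); lra.
by rewrite ler_pdivrMr ?expR_gt0.
Qed.

End gaussian_moments.

(** * Elementary inequalities *)

Section elementary.
Context (R : realType).
Implicit Types a b x y t p : R.

Lemma powR_double x p : x `^ (2 * p) = (x `^ p) ^+ 2.
Proof. by rewrite mulrC powRrM powR_mulrn// powR_ge0. Qed.

Lemma ler_powRl p x y : 0 <= p -> 0 <= x -> x <= y -> x `^ p <= y `^ p.
Proof.
by move=> p0 x0 xy; apply: ge0_ler_powR; rewrite ?nnegrE// (le_trans x0).
Qed.

Lemma ltr_powRl p x y : 0 < p -> 0 <= y -> (x `^ p < y `^ p) -> x < y.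
Proof.
move=> p0 y0; apply: contraTT; rewrite -!leNgt => yx.
by apply: ler_powRl => //; exact: ltW.
Qed.

Lemma powR_superadditive p x y : 1 <= p -> 0 <= x -> 0 <= y ->
  x `^ p + y `^ p <= (x + y) `^ p.
Proof.
move=> p1 x0 y0; have p0 : 0 < p by apply: lt_le_trans p1.
rewrite -(mulr_powRB1 x0 p0) -(mulr_powRB1 y0 p0) -(mulr_powRB1 (addr_ge0 x0 y0) p0).
rewrite mulrDl lerD// ler_wpM2l// ler_powRl ?subr_ge0//.
- by rewrite lerDl.
- by rewrite lerDr.
Qed.

Lemma powR_midpoint p x y : 1 <= p -> 0 <= x -> 0 <= y ->
  2 * ((x + y) / 2) `^ p <= x `^ p + y `^ p.
Proof.
move=> p1 x0 y0.
have h01 : 0 <= (2^-1 : R) <= 1 by apply/andP; split; lra.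
have h := @convex_powR R p p1 (Itv01 (andP h01).1 (andP h01).2) x y.
rewrite !inE/= !in_itv/= !andbT in h.
have := h x0 y0; rewrite [X in X `^ _]convRE [X in _ <= X]convRE/= /unstable.onem.
rewrite (_ : 1 - 2^-1 = 2^-1 :> R); last by lra.
rewrite -mulrDr [2^-1 * (x + y)]mulrC; lra.
Qed.

(** Since [t / 2 >= 1], the map [u -> u^(t/2)] is convex and superadditive on squares, and the
    midpoint of [(a + b)^2] and [(a - b)^2] is [a^2 + b^2]. *)
Lemma powR_clarkson t a b : 2 <= t ->
  2 * (`|a| `^ t + `|b| `^ t) <= `|a + b| `^ t + `|a - b| `^ t.
Proof.
move=> t2.
have E x : `|x| `^ t = (x ^+ 2) `^ (t / 2).
  by rewrite -real_normK ?num_real// -powR_mulrn// -powRrM; congr (_ `^ _); field.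
have h1 : 1 <= t / 2 by rewrite ler_pdivlMr// mul1r.
rewrite !E.
apply: le_trans (powR_midpoint h1 (sqr_ge0 _) (sqr_ge0 _)).
rewrite (_ : (_ + _) / 2 = a ^+ 2 + b ^+ 2); last by field.
by rewrite ler_pM2l//; exact: powR_superadditive (sqr_ge0 _) (sqr_ge0 _).
Qed.

(* By homogeneity only [b / a] matters: near [0] this is continuity of the power,
   away from [0] the term [K |b|^2t] dominates everything. *)
Lemma powR_increment_sqr t (delta : R) : 0 < t -> 0 < delta ->
  exists2 K : R, 0 <= K & forall a b,
    (`|a + b| `^ t - `|a| `^ t) ^+ 2
    <= delta * (`|a| `^ t) ^+ 2 + K * (`|b| `^ t) ^+ 2.
Proof.
move=> t0 d0; pose e := Num.min 1 delta.
have e0 : 0 < e by rewrite lt_min d0 ltr01.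
have e1 : e <= 1 by rewrite ge_min lexx.
have ed : e <= delta by rewrite ge_min lexx orbT.
(* If [|b| <= k |a|] with [k = 1 - 1/w], then [|a + b|] lies between [|a| / w] and [w |a|], the
   upper bound because [2 - 1/w <= w]. The powers then differ by at most [e |a|^t], and
   [e^2 <= delta]. Otherwise [|a|] and [|a + b|] are both at most [c |b|]. *)
pose w := (1 + e) `^ t^-1.
have w1 : 1 < w.
  rewrite -[ltLHS](@powRr0 _ (1 + e)) /w /powR gt_eqF ?addr_gt0// ltr_expR mul0r.
  by rewrite mulr_gt0 ?invr_gt0// ln_gt0// ltrDl.
have w0 : 0 < w by apply: lt_trans w1.
have wt : w `^ t = 1 + e.
  by rewrite -powRrM mulVf ?gt_eqF// powRr1// addr_ge0// ltW.
pose k := 1 - w^-1.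
have k0 : 0 < k by rewrite subr_gt0 invf_lt1.
pose c := 1 + k^-1.
have c0 : 0 <= c by rewrite addr_ge0// invr_ge0 ltW.
exists ((c `^ t) ^+ 2); first exact: sqr_ge0.
move=> a b.
have A0 : 0 <= `|a| `^ t by exact: powR_ge0.
have B0 : 0 <= `|b| `^ t by exact: powR_ge0.
have C0 : 0 <= `|a + b| `^ t by exact: powR_ge0.
have T0 := ltW t0.
have [bk|bk] := leP `|b| (k * `|a|).
- have up : `|a + b| `^ t <= (1 + e) * `|a| `^ t.
    rewrite -wt -powRM// ?(ltW w0)//; apply: ler_powRl => //.
    apply: le_trans (ler_normD _ _) _; apply: le_trans (lerD (lexx _) bk) _.
    rewrite -[X in X + _]mul1r -mulrDl ler_wpM2r//.
    rewrite /k addrA lerBlDr -lerBlDl.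
    have : 0 <= (w - 1) ^+ 2 / w by rewrite divr_ge0 ?sqr_ge0// ltW.
    rewrite (_ : (w - 1) ^+ 2 / w = w - 2 + w^-1); first by lra.
    by field; exact: lt0r_neq0.
  have lo : (1 - e) * `|a| `^ t <= `|a + b| `^ t.
    apply: (@le_trans _ _ (`|a| `^ t / (1 + e))).
      rewrite ler_pdivlMr ?addr_gt0// mulrAC ler_piMl//.
      by have := sqr_ge0 e; lra.
    rewrite ler_pdivrMr ?addr_gt0// -wt -powRM// ?(ltW w0)//; apply: ler_powRl => //.
    rewrite -ler_pdivrMr//.
    have : `|a| <= `|a + b| + `|b|.
      by rewrite -[X in `|X| <= _](addrK b) (le_trans (ler_normB _ _)).
    rewrite /k mulrBl mul1r in bk; rewrite mulrC in bk; lra.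
  apply: (@le_trans _ _ ((e * `|a| `^ t) ^+ 2)).
    rewrite -[leLHS]real_normK ?num_real// lerXn2r ?nnegrE ?mulr_ge0// ?(ltW e0)//.
    by rewrite ler_norml; apply/andP; split; lra.
  rewrite exprMn; apply: (@le_trans _ _ (delta * (`|a| `^ t) ^+ 2)).
    rewrite ler_wpM2r ?sqr_ge0// expr2; apply: le_trans ed.
    by rewrite ler_piMl// ltW.
  by rewrite lerDl mulr_ge0 ?sqr_ge0.
- have ak : `|a| <= k^-1 * `|b| by rewrite ler_pdivlMl// ltW.
  have h1 : `|a| `^ t <= c `^ t * `|b| `^ t.
    rewrite -powRM//; apply: ler_powRl => //; rewrite mulrDl mul1r.
    by apply: le_trans ak _; rewrite lerDr.
  have h2 : `|a + b| `^ t <= c `^ t * `|b| `^ t.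
    rewrite -powRM//; apply: ler_powRl => //; apply: le_trans (ler_normD _ _) _.
    by rewrite mulrDl mul1r addrC lerD.
  apply: (@le_trans _ _ ((c `^ t * `|b| `^ t) ^+ 2)).
    rewrite -[leLHS]real_normK ?num_real// lerXn2r ?nnegrE ?mulr_ge0// ?powR_ge0//.
    by rewrite ler_norml; apply/andP; split; lra.
  by rewrite exprMn lerDr mulr_ge0 ?sqr_ge0// ltW.
Qed.

Lemma sqr_sum_le n (x : 'I_n -> R) :
  (\sum_(i < n) x i) ^+ 2 <= n%:R * \sum_(i < n) x i ^+ 2.
Proof.
rewrite expr2 mulr_suml; under eq_bigr do rewrite mulr_sumr.
apply: (@le_trans _ _ (\sum_(i < n) \sum_(j < n) (x i ^+ 2 + x j ^+ 2) / 2)).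
  apply: ler_sum => i _; apply: ler_sum => j _.
  by have := sqr_ge0 (x i - x j); rewrite sqrrB; lra.
under eq_bigr do rewrite -mulr_suml big_split/= sumr_const card_ord.
rewrite -mulr_suml big_split/= sumr_const card_ord sumrMnl.
by rewrite -[X in (X + X) / _]mulr_natl; lra.
Qed.

Lemma ler_sum_sqr n (x : 'I_n -> R) : (forall i, 0 <= x i) ->
  \sum_(i < n) x i ^+ 2 <= (\sum_(i < n) x i) ^+ 2.
Proof.
move=> x0; rewrite expr2 mulr_suml; apply: ler_sum => i _.
rewrite expr2 ler_wpM2l// (bigD1 i)//= lerDl.
exact: sumr_ge0.
Qed.

(** A bound on [cosh (a x)] with the small factor outside the exponential: later [a = k^2] while [x]
    may be large. With [u = a x / 2], [cosh (2u) = 1 + (e^u - e^-u)^2 / 2], and the difference is at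
    most [2 a e^(x/2)]. The random sign of the prior removes the first-order term in [a]. *)
Lemma expR_sym_le (a x : R) : 0 <= a <= 1 -> 0 <= x ->
  (expR (a * x) + expR (- (a * x))) / 2 <= 1 + 2 * a ^+ 2 * expR x.
Proof.
move=> /andP[a0 a1] x0; set u := a * x / 2; set v := x / 2.
have uv : u = a * v by rewrite /u /v mulrA.
have u0 : 0 <= u by rewrite /u !mulr_ge0.
(* Convexity of [exp] on [[0, v]], from the tangent at [u = a v]: the weights [a] and [1 - a] cancel
   the linear terms. *)
have cvx : expR u <= a * expR v + (1 - a).
  have h1 : expR u * (1 + (v - u)) <= expR v.
    have -> : expR v = expR u * expR (v - u) by rewrite -expRD; congr expR; ring.
    rewrite ler_wpM2l ?expR_ge0//.
    exact: expR_ge1Dx.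
  have h2 : expR u * (1 - u) <= 1.
    rewrite -[leRHS](expRxMexpNx_1 u) ler_wpM2l ?expR_ge0//.
    exact: (expR_ge1Dx (- u)).
  have := ler_wpM2l a0 h1.
  have a1' : 0 <= 1 - a by rewrite subr_ge0.
  have := ler_wpM2l a1' h2.
  by rewrite uv; lra.
have lo := expR_ge1Dx (- u).
have lo' := expR_ge1Dx u.
have D : expR u - expR (- u) <= 2 * (a * expR v) by lra.
have D0 : 0 <= expR u - expR (- u) by rewrite subr_ge0 ler_expR; lra.
have sq : (expR u - expR (- u)) ^+ 2 <= (2 * (a * expR v)) ^+ 2.
  by rewrite lerXn2r ?nnegrE// !mulr_ge0// expR_ge0.
have e1 : expR (a * x) = expR u ^+ 2.
  by rewrite -expRM_natl; congr expR; rewrite /u; field.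
have e2 : expR (- (a * x)) = expR (- u) ^+ 2.
  by rewrite -expRM_natl; congr expR; rewrite /u; field.
have e3 : expR x = expR v ^+ 2.
  by rewrite -expRM_natl; congr expR; rewrite /v; field.
have e4 := expRxMexpNx_1 u.
rewrite e1 e2 e3; rewrite sqrrB !exprMn e4 in sq.
lra.
Qed.

End elementary.

(** * Moments and tails of one normal variable *)

Section normal_facts.
Context (R : realType).
Notation RR := (measurableTypeR R).
Notation N01 := (normal_prob (0 : R) 1).
Implicit Types t s m l tau : R.

Lemma measurable_mul_tail t tau (f : RR -> R) : measurable_fun setT f ->
  measurable_fun setT (fun x : RR => (f x * \1_(tail_set t tau) x)%:E).
Proof.
move=> mf; apply/measurable_EFinP; apply: measurable_funM => //.
by apply: measurable_indic; exact: measurable_tail_set.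
Qed.

Lemma indic_tail t tau (x : R) :
  \1_(tail_set t tau) x = (nat_of_bool (tau < `|x| `^ t)%R)%:R :> R.
Proof.
rewrite indicE; congr (nat_of_bool _)%:R.
by apply/idP/idP => [/set_mem|h]; last exact/mem_set.
Qed.

Lemma normal_central_moment p : 0 < p -> exists2 M : R, 0 <= M & forall m s, 0 < s ->
  (\int[normal_prob m s]_x (`|(x : R) - m| `^ p)%:E <= (M * s `^ p)%:E)%E.
Proof.
move=> p0; have [M M0 HM] := normal_exp_moment p0.
exists M => // m s s0.
have mf : measurable_fun [set: RR] (fun x : RR => (`|(x : R) - m| `^ p)%:E).
  apply/measurable_EFinP; have := measurable_normr_powR p 1 (- m).
  by apply: eq_measurable_fun => x _; rewrite mul1r.
have f0 (x : RR) : (0 <= (`|(x : R) - m| `^ p)%:E)%E by rewrite lee_fin powR_ge0.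
rewrite (ge0_integral_normal_std m s0 mf f0).
have sp0 : 0 <= s `^ p by exact: powR_ge0.
have mg : measurable_fun [set: RR]
    (fun x : RR => (`|x : R| `^ p * expR (1 / 4 * (x : R) ^+ 2))%:E).
  apply/measurable_EFinP; apply: measurable_funM.
    exact: measurable_normr_powR0.
  exact: measurable_expR_sqr.
apply: le_trans (_ : (s `^ p)%:E * M%:E <= _)%E; last by rewrite -EFinM mulrC.
apply: le_trans (lee_wpmul2l _ HM); last by rewrite lee_fin.
rewrite -ge0_integralZl; [|exact: measurableT|exact: mg| |by rewrite lee_fin]; last first.
  by move=> x _; rewrite lee_fin mulr_ge0 ?powR_ge0 ?expR_ge0.
apply: ge0_le_integralT.
- exact: (measurableT_comp mf (measurable_affine s m)).
- exact: emeasurable_funM.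
- by move=> x.
- move=> x; rewrite -EFinM lee_fin addrK normrM powRM// (gtr0_norm s0).
  rewrite ler_wpM2l// ler_peMr ?powR_ge0//.
  by rewrite -[leLHS]expR0 ler_expR mulr_ge0// ?sqr_ge0// divr_ge0.
Qed.

(** A Chernoff bound. After standardization the tail lies in [x^2 / 4 > l^2 / s^2], so inserting
    [exp (x^2 / 4)] gains exactly the factor [exp (- l^2 / s^2)] that appears in [nu]. *)
Lemma normal_tail_sqr t : 0 < t -> exists2 K : R, 0 <= K & forall s l tau,
  0 < s -> 0 <= l -> (2 * l) `^ t <= tau ->
  (\int[normal_prob 0 s]_x ((`|x : R| `^ t) ^+ 2 * \1_(tail_set t tau) x)%:E
    <= (K * ((s `^ t) ^+ 2 * expR (- l ^+ 2 / s ^+ 2)))%:E)%E.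
Proof.
move=> t0; have t20 : 0 < 2 * t by rewrite mulr_gt0.
have [M M0 HM] := normal_exp_moment t20.
exists M => // s l tau s0 l0 ltau.
set f := fun x : RR => _.
have mf : measurable_fun [set: RR] f.
  apply: measurable_mul_tail; apply: measurable_funX; exact: measurable_normr_powR0.
have f0 (x : RR) : (0 <= f x)%E by rewrite lee_fin mulr_ge0 ?sqr_ge0.
rewrite (ge0_integral_normal_std 0 s0 mf f0).
have c0 : 0 <= (s `^ t) ^+ 2 * expR (- l ^+ 2 / s ^+ 2).
  by rewrite mulr_ge0 ?sqr_ge0 ?expR_ge0.
have mg : measurable_fun [set: RR]
    (fun x : RR => (`|x : R| `^ (2 * t) * expR (1 / 4 * (x : R) ^+ 2))%:E).
  apply/measurable_EFinP; apply: measurable_funM.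
    exact: measurable_normr_powR0.
  exact: measurable_expR_sqr.
rewrite mulrC EFinM; apply: le_trans (lee_wpmul2l _ HM); last by rewrite lee_fin.
rewrite -ge0_integralZl; [|exact: measurableT|exact: mg| |by rewrite lee_fin]; last first.
  by move=> x _; rewrite lee_fin mulr_ge0 ?powR_ge0 ?expR_ge0.
apply: ge0_le_integralT.
- exact: (measurableT_comp mf (measurable_affine s 0)).
- exact: emeasurable_funM.
- by move=> x.
- move=> x; rewrite /f -EFinM lee_fin addr0 indic_tail.
  have [tx|] := ltP tau; last first.
    by move=> _; rewrite mulr0 !mulr_ge0 ?expR_ge0 ?powR_ge0.
  rewrite mulr1 normrM powRM// (gtr0_norm s0) exprMn -(powR_double `|(x : R)|).
  rewrite -[leRHS]mulrA.
  rewrite ler_wpM2l ?sqr_ge0// [leRHS]mulrCA ler_peMr ?powR_ge0//.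
  rewrite -expRD -[leLHS]expR0 ler_expR.
  have : 2 * l < s * `|x : R|.
    rewrite -(gtr0_norm s0) -normrM; apply: (@ltr_powRl _ t) => //.
    by apply: le_lt_trans tx.
  rewrite -ltr_pdivrMl// => h.
  have : (s^-1 * (2 * l)) ^+ 2 <= (x : R) ^+ 2.
    rewrite -[leRHS]real_normK ?num_real// lerXn2r ?nnegrE//; last exact: ltW.
    by rewrite mulr_ge0 ?invr_ge0 ?mulr_ge0// ltW.
  have -> : (s^-1 * (2 * l)) ^+ 2 = 4 * (l ^+ 2 / s ^+ 2).
    by field; exact: lt0r_neq0.
  by rewrite mulNr; lra.
Qed.

Lemma normal_std_set s (A : set RR) : 0 < s -> measurable A ->
  normal_prob 0 s A = N01 [set x : RR | A (s * (x : R) : RR)].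
Proof.
move=> s0 mA.
have mA' : measurable [set x : RR | A (s * (x : R) : RR)].
  have := measurable_affine s 0 measurableT mA; rewrite setTI.
  by congr measurable; apply/seteqP; split => x; rewrite /preimage/= addr0.
have -> : normal_prob 0 s A = (\int[normal_prob 0 s]_x (\1_A x)%:E)%E.
  by rewrite integral_indic ?setIT.
have -> : N01 [set x : RR | A (s * (x : R) : RR)] =
   (\int[N01]_x (\1_[set x : RR | A (s * (x : R) : RR)] x)%:E)%E.
  by rewrite integral_indic ?setIT.
have mf : measurable_fun setT (fun x : RR => (\1_A x : R)%:E).
  by apply/measurable_EFinP; exact: measurable_indic.
have f0 (x : RR) : (0 <= (\1_A x : R)%:E)%E by rewrite lee_fin.
rewrite (ge0_integral_normal_std 0 s0 mf f0).
by apply: eq_integral => x _; rewrite addr0.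
Qed.

(** After scaling, split the tail at [2^t tau']: below it the integrand is at most [2^t tau'], above
    it [normal_tail_moment] applies. Both parts are proportional to the tail probability. *)
Lemma normal_tail_mean t : 0 < t -> exists2 K : R, 0 <= K & forall s tau,
  0 < s -> 0 <= tau ->
  (\int[normal_prob 0 s]_x (`|x : R| `^ t * \1_(tail_set t tau) x)%:E
    <= (2 `^ t * tau + K * s `^ t)%:E * normal_prob 0 s (tail_set t tau))%E.
Proof.
move=> t0; have [K K0 HK] := normal_tail_moment t0.
exists K; [exact: K0|move=> s tau s0 tau0].
have st0 : 0 < s `^ t by exact: powR_gt0.
set f := fun x : RR => _.
have mf : measurable_fun [set: RR] f.
  by apply: measurable_mul_tail; exact: measurable_normr_powR0.
have f0 (x : RR) : (0 <= f x)%E by rewrite lee_fin mulr_ge0 ?powR_ge0.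
rewrite (ge0_integral_normal_std 0 s0 mf f0).
rewrite (normal_std_set s0 (measurable_tail_set t tau)).
pose tau' := tau / s `^ t.
have tailE (x : RR) : (tau < `|s * (x : R)| `^ t) = (tau' < `|x : R| `^ t).
  by rewrite normrM powRM// (gtr0_norm s0) /tau' ltr_pdivrMr// mulrC.
rewrite (_ : [set x | _] = tail_set t tau'); last first.
  by apply/seteqP; split => x; rewrite /tail_set/= tailE.
rewrite (_ : (2 `^ t * tau + _)%:E = (s `^ t)%:E * (2 `^ t * tau' + K)%:E)%E; last first.
  by rewrite -EFinM; congr EFin; rewrite /tau'; field; exact: lt0r_neq0.
have tau'0 : 0 <= tau' by rewrite divr_ge0// ltW.
pose g1 x := (2 `^ t * tau' * \1_(tail_set t tau') x)%:E : \bar R.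
pose g2 x := (`|x : R| `^ t * \1_(tail_set t (2 `^ t * tau')) x)%:E.
have mg1 : measurable_fun [set: RR] g1.
  exact: measurable_mul_tail.
have mg2 : measurable_fun [set: RR] g2.
  by apply: measurable_mul_tail; exact: measurable_normr_powR0.
have g10 (x : RR) : (0 <= g1 x)%E.
  by rewrite lee_fin; apply: mulr_ge0 => //; apply: mulr_ge0 => //; exact: powR_ge0.
have g20 (x : RR) : (0 <= g2 x)%E.
  by rewrite lee_fin; apply: mulr_ge0 => //; exact: powR_ge0.
apply: (@le_trans _ _ ((s `^ t)%:E * \int[N01]_x (g1 x + g2 x))%E).
  rewrite -ge0_integralZl; [|exact: measurableT|by apply: emeasurable_funD
    |by move=> x _; exact: adde_ge0|by rewrite lee_fin ltW].
  apply: ge0_le_integralT.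
  - exact: (measurableT_comp mf (measurable_affine s 0)).
  - by apply: emeasurable_funM => //; exact: emeasurable_funD.
  - by move=> x.
  - move=> x; rewrite /f /g1 /g2 -EFinD -EFinM lee_fin addr0 !indic_tail tailE.
    rewrite normrM powRM// (gtr0_norm s0) -mulrA ler_pM2l//.
    have [h1|h1] := ltP tau'; last first.
      by rewrite !mulr0 add0r mulr_ge0 ?powR_ge0.
    have [h2|h2] := ltP (2 `^ t * tau'); rewrite !mulr1.
      by rewrite lerDr mulr_ge0 ?powR_ge0.
    by rewrite mulr0 addr0.
rewrite -muleA; apply: lee_wpmul2l; first by rewrite lee_fin ltW.
rewrite ge0_integralD//.
have c0 : 0 <= 2 `^ t * tau' by apply: mulr_ge0 => //; exact: powR_ge0.
rewrite EFinD ge0_muleDl; [|by rewrite lee_fin|by rewrite lee_fin].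
apply: leeD; last exact: HK.
rewrite /g1; under eq_integral do rewrite EFinM.
have mI : measurable_fun [set: RR] (fun x : RR => (\1_(tail_set t tau') x : R)%:E).
  by apply/measurable_EFinP; apply: measurable_indic; exact: measurable_tail_set.
rewrite ge0_integralZl; [|exact: measurableT|exact: mI|by move=> x _; rewrite lee_fin|
  by rewrite lee_fin].
by rewrite integral_indic ?setIT//; exact: measurable_tail_set.
Qed.

(** By symmetry of the noise, twice the shifted moment is the mean of [|m + s x|^t + |m - s x|^t],
    to which [powR_clarkson] applies pointwise. *)
Lemma normal_powR_mean_ge t m s : 2 <= t -> 0 < s ->
  ((`|m| `^ t)%:E + \int[normal_prob 0 s]_x (`|x : R| `^ t)%:E
   <= \int[normal_prob m s]_x (`|x : R| `^ t)%:E)%E.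
Proof.
move=> t2 s0.
have mf : measurable_fun [set: RR] (fun x : RR => (`|x : R| `^ t)%:E).
  by apply/measurable_EFinP; exact: measurable_normr_powR0.
have f0 (x : RR) : (0 <= (`|x : R| `^ t)%:E)%E by rewrite lee_fin powR_ge0.
rewrite (ge0_integral_normal_std m s0 mf f0) (ge0_integral_normal_std 0 s0 mf f0).
pose g (b : R) (x : RR) := (`|s * (x : R) + b| `^ t)%:E : \bar R.
have mg b : measurable_fun [set: RR] (g b).
  by apply/measurable_EFinP; exact: measurable_normr_powR.
have g0 b (x : RR) : (0 <= g b x)%E by rewrite lee_fin powR_ge0.
have EN := ge0_integral_normalN (mg m) (g0 m).
have mgN : measurable_fun [set: RR] (fun x : RR => g m (- (x : R))).
  by apply: (measurableT_comp (mg m)); exact: oppr_measurable.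
have key : ((2%:E * ((`|m| `^ t)%:E + \int[N01]_x g 0%R x)) <= 2%:E * \int[N01]_x g m x)%E.
  rewrite [leRHS](_ : _ = \int[N01]_x (g m x + g m (- (x : R))%R))%E; last first.
    rewrite ge0_integralD; [|exact: measurableT|by []|exact: mg|by []|exact: mgN].
    by rewrite EN -[in RHS](mul1e (\int[_]_x _))%E -ge0_muleDl.
  have m0 : (0 <= (`|m| `^ t)%:E)%E by rewrite lee_fin powR_ge0.
  rewrite [X in (_ * X)%E](_ : _ = \int[N01]_x ((`|m| `^ t)%:E + g 0%R x))%E; last first.
    rewrite ge0_integralD; [by rewrite integral_cst_prob|exact: measurableT|by []
      |exact: measurable_cst|by []|exact: mg].
  rewrite -ge0_integralZl; [|exact: measurableT|by apply: emeasurable_funD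
    |by move=> x _; exact: adde_ge0|by rewrite lee_fin].
  apply: ge0_le_integralT.
  - by apply: emeasurable_funM => //; exact: emeasurable_funD.
  - exact: emeasurable_funD.
  - by move=> x; rewrite mule_ge0// adde_ge0.
  - move=> x; rewrite /g -!EFinD -EFinM lee_fin addr0.
    have := powR_clarkson m (s * (x : R)) t2.
    by rewrite (addrC m) mulrN [- _ + m]addrC.
by rewrite lee_pmul2l// in key.
Qed.

End normal_facts.

(** * Products of probability measures *)

Section product_integrals.
Context dsp (T : measurableType dsp) (R : realType).
Local Open Scope ereal_scope.

Lemma ge0_integral_prod_prob0 (P : 'I_0 -> probability T R)
    (f : 0.-tuple T -> \bar R) : measurable_fun setT f -> (forall x, 0 <= f x) ->
  \int[prod_prob P]_x f x = f [tuple].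
Proof. by move=> mf f0; rewrite /= integral_dirac// diracT mul1e. Qed.

Lemma ge0_integral_prod_probS n (P : 'I_n.+1 -> probability T R)
    (f : n.+1.-tuple T -> \bar R) : measurable_fun setT f -> (forall x, 0 <= f x) ->
  \int[prod_prob P]_x f x =
  \int[P ord0]_x \int[prod_prob (fun i => P (lift ord0 i))]_y f (tuple_cons (x, y)).
Proof.
move=> mf f0.
have mg : measurable_fun setT (fun z : T * n.-tuple T => f (tuple_cons z)).
  exact: (measurableT_comp mf (@measurable_tuple_cons _ _ n)).
transitivity (\int[pushforward (P ord0 \x prod_prob (fun i => P (lift ord0 i)))
    (@tuple_cons _ T n)]_x f x); first by [].
rewrite (ge0_integral_pushforward (@measurable_tuple_cons _ T n))//.
by rewrite preimage_setT (fubini_tonelli1 _ mg).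
Qed.

Lemma measurable_prod_prob_inner n (P : 'I_n -> probability T R)
    (f : n.+1.-tuple T -> \bar R) : measurable_fun setT f -> (forall x, 0 <= f x) ->
  measurable_fun setT (fun x => \int[prod_prob P]_y f (tuple_cons (x, y))).
Proof.
move=> mf f0.
have mg : measurable_fun setT (fun z : T * n.-tuple T => f (tuple_cons z)).
  exact: (measurableT_comp mf (@measurable_tuple_cons _ _ n)).
exact: (@measurable_fun_fubini_tonelli_F _ _ _ _ R (prod_prob P) _ mg).
Qed.

Lemma measurable_tuple_cons2 n (x : T) (f : n.+1.-tuple T -> \bar R) :
  measurable_fun setT f ->
  measurable_fun setT (fun y : n.-tuple T => f (tuple_cons (x, y))).
Proof.
move=> mf.
have mg : measurable_fun setT (fun z : T * n.-tuple T => f (tuple_cons z)).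
  exact: (measurableT_comp mf (@measurable_tuple_cons _ _ n)).
exact: (measurableT_comp mg (pair1_measurable x)).
Qed.

Lemma measurable_prod_tnth n (L : 'I_n -> T -> R) :
  (forall i, measurable_fun setT (L i)) ->
  measurable_fun setT (fun x : n.-tuple T => (\prod_(i < n) L i (tnth x i))%R).
Proof.
move=> mL; apply: measurable_prod => i _.
exact: (measurableT_comp (mL i) (measurable_tnth i)).
Qed.

Lemma measurable_sum_tnth n (L : 'I_n -> T -> R) :
  (forall i, measurable_fun setT (L i)) ->
  measurable_fun setT (fun x : n.-tuple T => (\sum_(i < n) L i (tnth x i))%R).
Proof.
move=> mL; apply: measurable_sum => i.
exact: (measurableT_comp (mL i) (measurable_tnth i)).
Qed.

Lemma ge0_integral_prod_prob_density n (P Q : 'I_n -> probability T R)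
    (L : 'I_n -> T -> R) (f : n.-tuple T -> \bar R) :
  (forall i, measurable_fun setT (L i)) -> (forall i x, (0 <= L i x)%R) ->
  (forall i (g : T -> \bar R), measurable_fun setT g -> (forall x, 0 <= g x) ->
    \int[P i]_x g x = \int[Q i]_x (g x * (L i x)%:E)) ->
  measurable_fun setT f -> (forall x, 0 <= f x) ->
  \int[prod_prob P]_x f x =
  \int[prod_prob Q]_x (f x * (\prod_(i < n) L i (tnth x i))%:E).
Proof.
elim: n P Q L f => [|n IH] P Q L f mL L0 PQ mf f0.
  have m1 : measurable_fun setT
      (fun x : 0.-tuple T => f x * (\prod_(i < 0) L i (tnth x i))%:E).
    by apply: emeasurable_funM => //; apply/measurable_EFinP; exact: measurable_prod_tnth.
  rewrite (ge0_integral_prod_prob0 P mf f0) (ge0_integral_prod_prob0 Q m1).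
    by rewrite big_ord0 mule1.
  by move=> x; rewrite mule_ge0// lee_fin prodr_ge0.
have mp : measurable_fun setT
    (fun x : n.+1.-tuple T => f x * (\prod_(i < n.+1) L i (tnth x i))%:E).
  by apply: emeasurable_funM => //; apply/measurable_EFinP; exact: measurable_prod_tnth.
have p0 (x : n.+1.-tuple T) : 0 <= f x * (\prod_(i < n.+1) L i (tnth x i))%:E.
  by rewrite mule_ge0// lee_fin prodr_ge0.
rewrite (ge0_integral_prod_probS P mf f0) (ge0_integral_prod_probS Q mp p0).
rewrite PQ; last 2 first.
- exact: measurable_prod_prob_inner.
- by move=> x; exact: integral_ge0.
apply: eq_integral => x _; rewrite muleC.
have mfx : measurable_fun setT (fun y : n.-tuple T => f (tuple_cons (x, y))).
  exact: measurable_tuple_cons2.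
rewrite (IH _ (fun i => Q (lift ord0 i)) (fun i => L (lift ord0 i)))//; last first.
  by move=> i g mg g0; exact: PQ.
rewrite -ge0_integralZl//.
- apply: eq_integral => y _; rewrite big_ord_recl EFinM muleCA.
  congr (_ * (_ * (_)%:E)); apply: eq_bigr => i _; congr (L _ _).
  by rewrite tnthS.
- apply: emeasurable_funM => //; apply/measurable_EFinP.
  by apply: (@measurable_prod_tnth n (fun i => L (lift ord0 i))) => i.
- by move=> y _; rewrite mule_ge0// lee_fin prodr_ge0.
- by rewrite lee_fin.
Qed.

Lemma integrable_of_sqr (P : probability T R) (g : T -> R) (v : R) :
  measurable_fun setT g -> \int[P]_x (g x ^+ 2)%:E <= v%:E ->
  P.-integrable setT (fun x => (g x ^+ 2)%:E) /\ P.-integrable setT (EFin \o g).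
Proof.
move=> mg iv.
have i2 : P.-integrable setT (fun x => (g x ^+ 2)%:E).
  apply/integrableP; split.
    by apply/measurable_EFinP; exact: measurable_funX.
  rewrite (_ : \int[P]_x _ = \int[P]_x (g x ^+ 2)%:E).
    exact: le_lt_trans iv (ltry _).
  by apply: eq_integral => x _; rewrite gee0_abs// lee_fin sqr_ge0.
split => //.
have i1 : P.-integrable setT (cst (1%R)%:E : T -> \bar R).
  exact: finite_measure_integrable_cst.
apply: (le_integrable _ _ _ (integrableD measurableT i1 i2)) => //.
  exact/measurable_EFinP.
move=> x _ /=; rewrite lee_fin [leRHS]ger0_norm ?addr_ge0 ?sqr_ge0//.
rewrite -[X in (_ <= 1 + X)%R]real_normK ?num_real//.
have := sqr_ge0 (`|g x| - 1)%R; have := normr_ge0 (g x).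
rewrite sqrrB1; lra.
Qed.

(** Used twice: with [del = 0] and [w] the variances of the remaining coordinates in the induction
    on the number of coordinates, and with [del] nonzero to recenter a second moment. *)
Lemma integral_sqrDl (P : probability T R) (g : T -> R) (del v k w : R) :
  measurable_fun setT g -> \int[P]_x (g x)%:E = del%:E ->
  \int[P]_x (g x ^+ 2)%:E <= v%:E ->
  \int[P]_x ((k + g x) ^+ 2 + w)%:E <= (k ^+ 2 + 2 * k * del + v + w)%:E.
Proof.
move=> mg idel iv.
have [i2 i1] := integrable_of_sqr mg iv.
have ic : P.-integrable setT (cst (k ^+ 2 + w)%:E : T -> \bar R).
  exact: finite_measure_integrable_cst.
have iZ : P.-integrable setT (fun x => (2 * k)%:E * (g x)%:E).
  exact: integrableZl.
rewrite (_ : \int[P]_x _ =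
    \int[P]_x ((cst (k ^+ 2 + w)%:E x + (2 * k)%:E * (g x)%:E) + (g x ^+ 2)%:E)).
  rewrite integralD//; last exact: integrableD.
  rewrite integralD// integral_cst_prob integralZl// idel.
  rewrite [leRHS](_ : _ = ((k ^+ 2 + w)%:E + (2 * k)%:E * del%:E) + v%:E).
    exact: leeD.
  by rewrite -EFinM -!EFinD; congr EFin; ring.
by apply: eq_integral => x _; rewrite -EFinM -!EFinD; congr EFin; ring.
Qed.

(** The constant [k] makes the induction work: with the first coordinate fixed at [x], the inner
    integral is an instance with constant [k + h ord0 x]. Integrands stay nonnegative, so Tonelli
    suffices and no cross product has to be shown integrable. *)
Lemma integral_sqr_sum n (P : 'I_n -> probability T R) (h : 'I_n -> T -> R)
    (v : 'I_n -> R) (k : R) :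
  (forall i, measurable_fun setT (h i)) ->
  (forall i, \int[P i]_x (h i x)%:E = 0) ->
  (forall i, \int[P i]_x (h i x ^+ 2)%:E <= (v i)%:E) ->
  \int[prod_prob P]_x ((k + \sum_(i < n) h i (tnth x i)) ^+ 2)%:E
  <= (k ^+ 2 + \sum_(i < n) v i)%:E.
Proof.
elim: n P h v k => [|n IH] P h v k mh h0 hv.
  have m1 : measurable_fun setT
      (fun x : 0.-tuple T => ((k + \sum_(i < 0) h i (tnth x i)) ^+ 2)%:E).
    apply/measurable_EFinP; apply: measurable_funX; apply: measurable_funD => //.
    exact: measurable_sum_tnth.
  rewrite (ge0_integral_prod_prob0 P m1); last by move=> x; rewrite lee_fin sqr_ge0.
  by rewrite !big_ord0 !addr0.
have m1 : measurable_fun setT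
    (fun x : n.+1.-tuple T => ((k + \sum_(i < n.+1) h i (tnth x i)) ^+ 2)%:E).
  apply/measurable_EFinP; apply: measurable_funX; apply: measurable_funD => //.
  exact: measurable_sum_tnth.
rewrite (ge0_integral_prod_probS P m1); last by move=> x; rewrite lee_fin sqr_ge0.
rewrite !big_ord_recl.
pose V := (\sum_(i < n) v (lift ord0 i))%R.
have := @integral_sqrDl (P ord0) (h ord0) 0 (v ord0) k V (mh ord0) (h0 ord0) (hv ord0).
rewrite mulr0 addr0 -addrA; apply: le_trans.
apply: ge0_le_integralT.
- apply: (measurable_prod_prob_inner _ m1) => x; by rewrite lee_fin sqr_ge0.
- apply/measurable_EFinP; apply: measurable_funD => //; apply: measurable_funX.
  exact: measurable_funD.
- by move=> x; apply: integral_ge0 => y _; rewrite lee_fin sqr_ge0.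
- move=> x.
  rewrite [leLHS](_ : _ = \int[prod_prob (fun i => P (lift ord0 i))]_y
     ((k + h ord0 x + \sum_(i < n) h (lift ord0 i) (tnth y i)) ^+ 2)%:E); last first.
    apply: eq_integral => y _; congr (_ ^+ 2)%:E.
    rewrite big_ord_recl addrA; congr (_ + _)%R; apply: eq_bigr => i _.
    by rewrite tnthS.
  exact: (IH (fun i => P (lift ord0 i)) (fun i => h (lift ord0 i))
    (fun i => v (lift ord0 i)) (k + h ord0 x)%R (fun i => mh (lift ord0 i))
    (fun i => h0 (lift ord0 i)) (fun i => hv (lift ord0 i))).
Qed.

(** The second moments may be taken about arbitrary points [c i], since the mean minimizes them.
    This permits centering at [|theta_j|^t], where the exact mean is known only through a lower
    bound. *)
Lemma prod_prob_chebyshev n (P : 'I_n -> probability T R) (h : 'I_n -> T -> R)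
    (m c v : 'I_n -> R) (A : set (n.-tuple T)) (a : R) :
  (forall i, measurable_fun setT (h i)) ->
  (forall i, \int[P i]_x (h i x)%:E = (m i)%:E) ->
  (forall i, \int[P i]_x ((h i x - c i) ^+ 2)%:E <= (v i)%:E) ->
  measurable A -> (0 < a)%R ->
  (forall x, A x -> a <= `|\sum_(i < n) h i (tnth x i) - \sum_(i < n) m i|)%R ->
  prod_prob P A <= ((\sum_(i < n) v i) / a ^+ 2)%:E.
Proof.
move=> mh hm hv mA a0 hA.
pose g i x := (h i x - m i)%R.
have mg i : measurable_fun setT (g i) by exact: measurable_funB.
have mhc i : measurable_fun setT (fun x => h i x - c i)%R by exact: measurable_funB.
have ihc := fun i => (integrable_of_sqr (mhc i) (hv i)).2.
have ih i : (P i).-integrable setT (fun x => (h i x)%:E).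
  have ic : (P i).-integrable setT (cst (c i)%:E : T -> \bar R).
    exact: finite_measure_integrable_cst.
  apply: eq_integrable (integrableD measurableT (ihc i) ic) => // x _ /=.
  by rewrite -EFinD subrK.
have sub i (k : R) : \int[P i]_x (h i x - k)%:E = (m i - k)%:E.
  under eq_integral do rewrite EFinB.
  rewrite integralB; first by rewrite hm integral_cst_prob.
  - exact: measurableT.
  - exact: ih.
  - exact: finite_measure_integrable_cst.
have g0 : forall i, \int[P i]_x (g i x)%:E = 0.
  by move=> i; rewrite (sub i (m i)) subrr.
have gv : forall i, \int[P i]_x (g i x ^+ 2)%:E <= (v i)%:E.
  move=> i.
  have := @integral_sqrDl (P i) (fun x => h i x - c i)%R (m i - c i) (v i)
    (c i - m i) 0 (mhc i) (sub i (c i)) (hv i).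
  rewrite (_ : \int[P i]_x _ = \int[P i]_x (g i x ^+ 2)%:E); last first.
    by apply: eq_integral => x _; congr EFin; rewrite /g; ring.
  move=> /le_trans; apply; rewrite lee_fin.
  by have := sqr_ge0 (m i - c i)%R; lra.
have := @integral_sqr_sum n P g v 0 mg g0 gv.
rewrite expr0n add0r => Q.
have mS : measurable_fun setT
    (fun x : n.-tuple T => ((0 + \sum_(i < n) g i (tnth x i)) ^+ 2)%:E).
  apply/measurable_EFinP; apply: measurable_funX; apply: measurable_funD => //.
  exact: measurable_sum_tnth.
have a2 : (0 < a ^+ 2)%R by rewrite exprn_gt0.
rewrite mulrC EFinM -lee_pdivrMl ?invr_gt0// invrK.
apply: le_trans Q.
have mI : measurable_fun setT (fun x : n.-tuple T => (\1_A x : R)%:E).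
  by apply/measurable_EFinP; exact: measurable_indic.
have -> : prod_prob P A = \int[prod_prob P]_x (\1_A x)%:E.
  by rewrite integral_indic// setIT.
rewrite -ge0_integralZl; [|exact: measurableT|exact: mI|
  by move=> x _; rewrite lee_fin|by rewrite lee_fin ltW].
apply: ge0_le_integralT => //.
- exact: emeasurable_funM.
- by move=> x; rewrite mule_ge0// lee_fin// ltW.
move=> x; rewrite -EFinM lee_fin indicE add0r.
have [/set_mem Ax|_] := boolP (x \in A); last by rewrite mulr0 sqr_ge0.
rewrite mulr1 /g big_split/= sumrN -[leRHS]real_normK ?num_real//.
by rewrite lerXn2r ?nnegrE ?(ltW a0)//; exact: hA.
Qed.

Lemma ge0_integral_prod_prob_coord n (P : 'I_n -> probability T R) (j : 'I_n)
    (f : T -> \bar R) : measurable_fun setT f -> (forall x, 0 <= f x) ->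
  \int[prod_prob P]_x f (tnth x j) = \int[P j]_x f x.
Proof.
move=> mf f0; have mt := @measurable_tnth _ T n j.
transitivity (\int[pushforward (prod_prob P) (fun x => tnth x j)]_x f x).
  by rewrite ge0_integral_pushforward.
apply: eq_measure_integral => A mA _; rewrite /pushforward.
pose B i := if i == j then A else setT.
transitivity (prod_prob P [set x | forall i, B i (tnth x i)]).
  congr (prod_prob P _).
  apply/seteqP; split => x /=.
    by move=> h i; rewrite /B; case: eqP => [->|].
  by move=> /(_ j); rewrite /B eqxx.
rewrite prod_prob_rect; last by move=> i; rewrite /B; case: ifP.
rewrite (bigD1 j)//= big1 ?mule1; first by rewrite /B eqxx.
by move=> i /negbTE ij; rewrite /B ij probability_setT.
Qed.

End product_integrals.

(** * The parameters beta, lambda and nu *)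

Section parameters.
Context (R : realType) (d s : nat) (t : R) (sigma : d.-tuple (measurableTypeR R)).
Hypothesis t0 : 0 < t.
Hypothesis sorted_sigma :
  forall i j : 'I_d, (i <= j)%N -> tnth sigma j <= tnth sigma i.
Hypothesis sigma0 : forall j : 'I_d, 0 < tnth sigma j.
Hypothesis s_range : (1 <= s <= d)%N.

Local Notation sg j := (tnth sigma j : R).
Local Notation wS b := (\sum_(j < d) sg j `^ t * expR (- b / sg j ^+ 2)).
Local Notation wD b := (\sum_(j < d) sg j `^ (2 * t) * expR (- b / sg j ^+ 2)).
Local Notation lam := (lambda s t sigma).
Local Notation N := (nu s t sigma `^ t).

Let d0 : (0 < d)%N.
Proof. by case/andP: s_range => s1; exact: leq_trans. Qed.

Let j0 : 'I_d := Ordinal d0.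

Let sg_le j : sg j <= sg j0. Proof. exact: sorted_sigma. Qed.

Let xg0 j : 0 < sg j `^ t. Proof. exact: powR_gt0. Qed.

Lemma wD_gt0 b : 0 < wD b.
Proof.
rewrite (bigD1 j0)//= ltr_wpDr//.
  by apply: sumr_ge0 => j _; rewrite mulr_ge0 ?powR_ge0 ?expR_ge0.
by rewrite mulr_gt0 ?powR_gt0 ?expR_gt0.
Qed.

Lemma wS_gt0 b : 0 < wS b.
Proof.
rewrite (bigD1 j0)//= ltr_wpDr//.
  by apply: sumr_ge0 => j _; rewrite mulr_ge0 ?powR_ge0 ?expR_ge0.
by rewrite mulr_gt0 ?powR_gt0 ?expR_gt0.
Qed.

(** In squared form the equation compares two finite sums that are continuous in [b], ready for the
    intermediate value theorem. *)
Lemma is_betaE b : is_beta s t sigma b <-> wS b ^+ 2 = (s%:R / 2) ^+ 2 * wD b.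
Proof.
have D0 := wD_gt0 b; have S0 := wS_gt0 b.
have q0 : 0 < Num.sqrt (wD b) by rewrite sqrtr_gt0.
have s20 : 0 <= s%:R / 2 :> R by rewrite divr_ge0.
split.
  move/eqP; rewrite eqr_div ?pnatr_eq0 ?(gt_eqF q0)// => /eqP E.
  have -> : wS b = s%:R / 2 * Num.sqrt (wD b).
    by rewrite mulrAC -E mulfK// pnatr_eq0.
  by rewrite exprMn sqr_sqrtr// ltW.
move=> E; rewrite /is_beta.
have -> : wS b = s%:R / 2 * Num.sqrt (wD b).
  apply/eqP; rewrite -(@eqrXn2 _ 2)// ?mulr_ge0 ?sqrtr_ge0// ?(ltW S0)//.
  by rewrite exprMn sqr_sqrtr ?(ltW D0)// E.
by rewrite mulfK// gt_eqF.
Qed.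

Lemma is_beta_exists : exists b, is_beta s t sigma b.
Proof.
pose G b := wS b ^+ 2 - (s%:R / 2) ^+ 2 * wD b.
have cont_exp (c : 'I_d -> R) :
    continuous (fun b : R => \sum_(j < d) c j * expR (- b / sg j ^+ 2)).
  apply: (@continuous_big _ _ _ _ _ _ _ _
    (fun j (b : R) => c j * expR (- b / sg j ^+ 2))) => [|j _ b].
    exact: add_continuous.
  apply: cvgM; first exact: cvg_cst.
  apply: (cvg_comp (fun b => - b / sg j ^+ 2) expR); last exact: continuous_expR.
  by apply: cvgM; [apply: cvgN; exact: cvg_id|exact: cvg_cst].
have cG : continuous G.
  move=> b; apply: cvgB; last first.
    by apply: cvgM; [exact: cvg_cst|exact: cont_exp].
  by rewrite expr2; under eq_fun do rewrite expr2; apply: cvgM; exact: cont_exp.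
pose M := sg j0; have M0 : 0 < M by exact: sigma0.
have M20 : 0 < M ^+ 2 by rewrite exprn_gt0.
(* [c] serves both ends of [[-B, B]]. At [B], Cauchy-Schwarz costs a factor [d], and
   [d <= c / 4 <= (s/2)^2 c]. At [-B], dropping the cross terms leaves [wS^2 >= c wD], and
   [c >= (s/2)^2]. The largest [sigma] gives the slowest exponential, hence [M] in [B]. *)
pose c := 4 * d%:R + (s%:R / 2) ^+ 2 : R.
have c0 : 0 <= c by rewrite addr_ge0 ?sqr_ge0// mulr_ge0.
pose B := M ^+ 2 * c.
have B0 : 0 <= B by rewrite mulr_ge0// ltW.
have eB : c <= expR (B / M ^+ 2).
  rewrite /B mulrAC divff ?gt_eqF// mul1r; apply: le_trans (expR_ge1Dx _).
  by rewrite lerDr.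
have xE j : sg j `^ (2 * t) = (sg j `^ t) ^+ 2 by exact: powR_double.
have sgM j : (M ^+ 2)^-1 <= (sg j ^+ 2)^-1.
  rewrite lef_pV2 ?posrE ?exprn_gt0// lerXn2r ?nnegrE ?(ltW (sigma0 _))// ltW//.
have e2 (b : R) j : (expR (- b / sg j ^+ 2)) ^+ 2 = expR (- b / sg j ^+ 2) * expR (- b / sg j ^+ 2).
  by rewrite expr2.
have GB : G B <= 0.
  rewrite subr_le0; apply: le_trans (sqr_sum_le _) _.
  apply: (@le_trans _ _ (d%:R * (expR (- (B / M ^+ 2)) * wD B))).
    rewrite ler_wpM2l// mulr_sumr; apply: ler_sum => j _.
    rewrite exprMn e2 xE [leRHS]mulrCA ler_wpM2l ?sqr_ge0//.
    rewrite ler_wpM2r ?expR_ge0// ler_expR mulNr lerN2.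
    exact: ler_wpM2l.
  rewrite mulrA ler_wpM2r ?(ltW (wD_gt0 _))//.
  rewrite expRN ler_pdivrMr ?expR_gt0//.
  have s1 : 1 <= s%:R :> R by rewrite ler1n; case/andP: s_range.
  have q : 4^-1 <= (s%:R / 2) ^+ 2 :> R.
    rewrite expr_div_n ler_pdivlMr ?exprn_gt0// -natrX mulVf ?pnatr_eq0//.
    by rewrite expr_ge1// (le_trans ler01).
  apply: (@le_trans _ _ (4^-1 * c)).
    rewrite /c; have := sqr_ge0 (s%:R / 2 : R); lra.
  by apply: ler_pM => //; rewrite invr_ge0.
have GNB : 0 <= G (- B).
  rewrite subr_ge0; apply: le_trans _ (ler_sum_sqr _) ; last first.
    by move=> j; rewrite mulr_ge0 ?expR_ge0// ltW.
  apply: (@le_trans _ _ (expR (B / M ^+ 2) * wD (- B))).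
    rewrite ler_wpM2r ?(ltW (wD_gt0 _))//; apply: le_trans eB.
    by rewrite lerDr mulr_ge0.
  rewrite mulr_sumr; apply: ler_sum => j _.
  rewrite exprMn e2 xE mulrCA ler_wpM2l ?sqr_ge0//.
  rewrite ler_wpM2r ?expR_ge0// ler_expR opprK.
  exact: ler_wpM2l.
have BB : - B <= B by rewrite (le_trans _ B0)// oppr_le0.
have mm : Num.min (G (- B)) (G B) <= 0 <= Num.max (G (- B)) (G B).
  by rewrite ge_min le_max GB GNB orbT.
have [b _ Gb] := IVT BB (continuous_subspaceT cG) mm.
exists b; apply/is_betaE/eqP; rewrite -subr_eq0; exact/eqP.
Qed.

Lemma is_beta_beta : is_beta s t sigma (beta s t sigma).
Proof. exact: getPex is_beta_exists. Qed.

Lemma lambda_ge0 : 0 <= lam. Proof. exact: sqrtr_ge0. Qed.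

Lemma lambda_sqr : lam ^+ 2 = Num.max (beta s t sigma) 0.
Proof. by rewrite sqr_sqrtr// le_max lexx orbT. Qed.

Lemma nu_powR : N = Num.sqrt (wD (lam ^+ 2)).
Proof.
rewrite /nu -powRrM -powR12_sqrt ?(ltW (wD_gt0 _))//; congr (_ `^ _).
by field; exact: lt0r_neq0.
Qed.

Lemma nu_powR_gt0 : 0 < N.
Proof. by rewrite nu_powR sqrtr_gt0 wD_gt0. Qed.

Lemma nu_powR_sqr :
  N ^+ 2 = \sum_(j < d) (sg j `^ t) ^+ 2 * expR (- lam ^+ 2 / sg j ^+ 2).
Proof.
rewrite nu_powR (sqr_sqrtr (ltW (wD_gt0 _))).
by apply: eq_bigr => j _; rewrite powR_double.
Qed.

Lemma sum_weights_eq : 0 < lam -> wS (lam ^+ 2) = s%:R / 2 * N.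
Proof.
move=> l0; have bE : lam ^+ 2 = beta s t sigma.
  have : 0 < lam ^+ 2 by rewrite exprn_gt0.
  by rewrite lambda_sqr lt_max ltxx orbF => /ltW /max_idPl.
have /is_betaE := is_beta_beta; rewrite -bE => E.
have q0 : 0 <= s%:R / 2 * N by rewrite mulr_ge0 ?divr_ge0// ltW// nu_powR_gt0.
apply/eqP; rewrite -(@eqrXn2 _ 2)// ?(ltW (wS_gt0 _))//.
rewrite exprMn. rewrite nu_powR (sqr_sqrtr (ltW (wD_gt0 _))). by rewrite E.
Qed.

(* When [beta < 0] the defining ratio at [0] is still at most [s / 2]: it decreases
   in [b], by Chebyshev's sum inequality. *)
Lemma sum_weights_le : wS (lam ^+ 2) <= s%:R / 2 * N.
Proof.
have [l0|l0] := ltP 0 lam; first by rewrite sum_weights_eq.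
have {}l0 : lam = 0 by apply/eqP; rewrite eq_le l0 lambda_ge0.
have b0 : beta s t sigma <= 0.
  by have := lambda_sqr; rewrite l0 expr0n/= => /esym/max_idPr.
set b := beta s t sigma in b0.
have /is_betaE E := is_beta_beta; rewrite -/b in E.
have S2N : 0 <= s%:R / 2 * N by rewrite mulr_ge0 ?divr_ge0// ltW// nu_powR_gt0.
rewrite -(@ler_pXn2r _ 2) ?nnegrE ?(ltW (wS_gt0 _))//.
rewrite exprMn nu_powR (sqr_sqrtr (ltW (wD_gt0 _))) l0 expr0n/=.
rewrite -(ler_pM2r (wD_gt0 b)) [leRHS]mulrAC -E.
pose w j := expR (- b / sg j ^+ 2).
have w1 j : 1 <= w j.
  by rewrite -[leLHS]expR0 ler_expR divr_ge0 ?sqr_ge0// oppr_ge0.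
have S0E : wS 0 = \sum_(j < d) sg j `^ t.
  by apply: eq_bigr => j _; rewrite oppr0 mul0r expR0 mulr1.
have D0E : wD 0 = \sum_(j < d) (sg j `^ t) ^+ 2.
  by apply: eq_bigr => j _; rewrite oppr0 mul0r expR0 mulr1 powR_double.
have DbE : wD b = \sum_(j < d) (sg j `^ t) ^+ 2 * w j.
  by apply: eq_bigr => j _; rewrite powR_double.
have Sle : wS 0 <= wS b.
  by rewrite S0E; apply: ler_sum => j _; exact: (ler_peMr (ltW (xg0 j)) (w1 j)).
have cheb : wS 0 * wD b <= wS b * wD 0.
  rewrite S0E D0E DbE -subr_ge0 !mulr_suml -sumrB.
  under eq_bigr do rewrite !mulr_sumr -sumrB.
  set Q := (X in 0 <= X).
  have QE : Q = \sum_i \sum_j (sg i `^ t * (sg j `^ t) ^+ 2 * (w i - w j)).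
    by apply: eq_bigr => i _; apply: eq_bigr => j _; rewrite /w; ring.
  (* Symmetrizing in [i] and [j] produces the products [(sg j ^ t - sg i ^ t) (w i - w j)],
     nonnegative because [b <= 0] makes [w] decrease as [sg] increases. *)
  suff : 0 <= Q + Q by rewrite -mulr2n pmulrn_lge0.
  rewrite {2}QE exchange_big/= QE -big_split/=; apply: sumr_ge0 => i _.
  rewrite -big_split/=; apply: sumr_ge0 => j _.
  rewrite (_ : _ + _ = (sg i `^ t * sg j `^ t) *
    ((sg j `^ t - sg i `^ t) * (w i - w j))); last by ring.
  apply: mulr_ge0; first by rewrite mulr_ge0 ?powR_ge0.
  have mono (k l : 'I_d) : sg k <= sg l -> sg k `^ t <= sg l `^ t /\ w l <= w k.
    move=> kl; split; first by apply: ler_powRl => //; exact: ltW.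
    rewrite ler_expR ler_wpM2l ?oppr_ge0// lef_pV2 ?posrE ?exprn_gt0//.
    by rewrite lerXn2r ?nnegrE ?(ltW (sigma0 _)).
  have [/mono[? ?]|/ltW/mono[? ?]] := leP (sg i) (sg j).
    by rewrite mulr_ge0 ?subr_ge0.
  by rewrite mulr_le0 ?subr_le0.
rewrite !expr2 -mulrA; apply: le_trans (ler_wpM2l (ltW (wS_gt0 _)) cheb) _.
by rewrite mulrA ler_wpM2r ?(ltW (wD_gt0 _))// ler_wpM2r ?(ltW (wS_gt0 _)).
Qed.

(** As [sigma] is nonincreasing, the indices with [lam <= sg j] form an initial segment; [jstar] is
    its length, 0 when it is empty. *)
Lemma lt_jstar (j : 'I_d) : (j < jstar s t sigma)%N = (lam <= sg j).
Proof.
apply/idP/idP => [|lj]; last by rewrite /jstar (bigD1 j)//= leq_max ltnSn.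
apply: contraTT; rewrite -leqNgt -ltNge => jl.
apply/bigmax_leqP => i li; rewrite ltnNge; apply: contraL li => ji.
by rewrite -ltNge; apply: le_lt_trans jl; exact: sorted_sigma.
Qed.

End parameters.

(** * The statistics of one coordinate *)

Section coordinate_statistics.
Context (R : realType) (t : R).
Hypothesis t2 : 2 <= t.
Notation RR := (measurableTypeR R).
Implicit Types (m sg l tau a : R).

Let t0 : 0 < t. Proof. exact: lt_le_trans t2. Qed.

Definition powR_mean m sg : R := fine (\int[normal_prob m sg]_x (`|x : R| `^ t)%:E)%E.

(* One coordinate of T_sparse, with centering [a] in place of alpha_j. *)
Definition truncated tau a (x : R) : R := (`|x| `^ t - a) * \1_(tail_set t tau) x.

(** [alpha_j] as a function of the standard deviation and the threshold. *)
Definition tail_mean sg tau : R :=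
  fine (\int[normal_prob 0 sg]_x (`|x : R| `^ t * \1_(tail_set t tau) x)%:E)%E /
  fine (normal_prob 0 sg (tail_set t tau)).

Lemma measurable_truncated tau a :
  measurable_fun [set: RR] (truncated tau a : RR -> R).
Proof.
apply: measurable_funM.
  by apply: measurable_funB => //; exact: measurable_normr_powR0.
by apply: measurable_indic; exact: measurable_tail_set.
Qed.

Lemma measurable_powR_sub a :
  measurable_fun [set: RR] (fun x : RR => `|x : R| `^ t - a).
Proof. by apply: measurable_funB => //; exact: measurable_normr_powR0. Qed.

(** [powR_increment_sqr] at [a = m], [b = x - m], integrated. The moment is about [|m|^t], and
    [delta] is arbitrary so that the part growing with the signal stays a small fraction of its
    square. *)
Lemma powR_variance (delta : R) : 0 < delta -> exists2 K : R, 0 <= K &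
  forall m sg, 0 < sg ->
  (\int[normal_prob m sg]_x ((`|x : R| `^ t - `|m| `^ t) ^+ 2)%:E
   <= (delta * (`|m| `^ t) ^+ 2 + K * (sg `^ t) ^+ 2)%:E)%E.
Proof.
move=> d0; have [K K0 HK] := powR_increment_sqr t0 d0.
have t20 : 0 < 2 * t by rewrite mulr_gt0.
have [M M0 HM] := normal_central_moment t20.
exists (K * M) => [|m sg sg0]; first exact: mulr_ge0.
have mg : measurable_fun [set: RR] (fun x : RR => (`|(x : R) - m| `^ (2 * t))%:E).
  apply/measurable_EFinP; have := measurable_normr_powR (2 * t) 1 (- m).
  by apply: eq_measurable_fun => x _; rewrite mul1r.
pose c := delta * (`|m| `^ t) ^+ 2.
have c0 : 0 <= c by rewrite mulr_ge0 ?sqr_ge0// ltW.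
have g0 (x : RR) : (0 <= (`|(x : R) - m| `^ (2 * t))%:E)%E by rewrite lee_fin powR_ge0.
have mK : measurable_fun [set: RR] (fun x : RR => K%:E * (`|(x : R) - m| `^ (2 * t))%:E)%E.
  exact: emeasurable_funM.
apply: (@le_trans _ _
  (\int[normal_prob m sg]_x (c%:E + K%:E * (`|(x : R) - m| `^ (2 * t))%:E))%E).
  apply: ge0_le_integralT.
  - by apply/measurable_EFinP; apply: measurable_funX; exact: measurable_powR_sub.
  - by apply: emeasurable_funD.
  - by move=> x; rewrite lee_fin sqr_ge0.
  - move=> x; rewrite -EFinM -EFinD lee_fin powR_double.
    by have := HK m ((x : R) - m); rewrite subrKC.
rewrite ge0_integralD; [|exact: measurableT|by []|exact: measurable_cst|
  by move=> x _; rewrite mule_ge0|exact: mK].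
rewrite integral_cst_prob ge0_integralZl; [|exact: measurableT|exact: mg|by move=> x _|
  by rewrite lee_fin].
rewrite EFinD leeD2l// -mulrA EFinM lee_wpmul2l ?lee_fin//.
by rewrite -powR_double; exact: HM.
Qed.

Lemma integrable_powR m sg : 0 < sg ->
  (normal_prob m sg).-integrable [set: RR] (fun x : RR => (`|x : R| `^ t)%:E).
Proof.
move=> sg0; have [K K0 HK] := powR_variance (ltr01 : (0 : R) < 1).
have i1 := (integrable_of_sqr (measurable_powR_sub _) (HK m sg sg0)).2.
have ic : (normal_prob m sg).-integrable [set: RR] (cst (`|m| `^ t)%:E : RR -> \bar R).
  exact: finite_measure_integrable_cst.
apply: eq_integrable (integrableD measurableT i1 ic); first exact: measurableT.
by move=> x _ /=; rewrite -EFinD subrK.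
Qed.

Lemma powR_meanE m sg : 0 < sg ->
  (\int[normal_prob m sg]_x (`|x : R| `^ t)%:E = (powR_mean m sg)%:E)%E.
Proof.
move=> sg0; rewrite /powR_mean fineK//.
exact: (integrable_fin_num measurableT (integrable_powR m sg0)).
Qed.

Lemma powR_mean_ge m sg : 0 < sg -> `|m| `^ t + powR_mean 0 sg <= powR_mean m sg.
Proof.
move=> sg0; have := normal_powR_mean_ge m t2 sg0.
by rewrite !powR_meanE// -EFinD lee_fin.
Qed.

Lemma powR_mean_ge0 m sg : 0 <= powR_mean m sg.
Proof. by apply: fine_ge0; apply: integral_ge0 => x _; rewrite lee_fin powR_ge0. Qed.

Lemma tail_mean_ge0 sg tau : 0 <= tail_mean sg tau.
Proof.
apply: divr_ge0; last exact: fine_ge0.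
by apply: fine_ge0; apply: integral_ge0 => x _; rewrite lee_fin mulr_ge0 ?powR_ge0.
Qed.

Lemma integrable_powR_tail m sg tau : 0 < sg ->
  (normal_prob m sg).-integrable [set: RR]
    (fun x : RR => (`|x : R| `^ t * \1_(tail_set t tau) x)%:E).
Proof.
move=> sg0; apply: le_integrable (integrable_powR m sg0).
- exact: measurableT.
- by apply: measurable_mul_tail; exact: measurable_normr_powR0.
- move=> x _ /=; rewrite lee_fin normrM ler_piMr//.
  by rewrite indic_tail; case: (_ < _); rewrite ?normr1 ?normr0.
Qed.

Lemma tail_mean_le : exists2 K : R, 0 <= K & forall sg tau, 0 < sg -> 0 <= tau ->
  tail_mean sg tau <= 2 `^ t * tau + K * sg `^ t.
Proof.
have [K K0 HK] := normal_tail_mean t0; exists K; first exact: K0.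
move=> sg tau sg0 tau0.
have c0 : 0 <= 2 `^ t * tau + K * sg `^ t.
  by rewrite addr_ge0// mulr_ge0 ?powR_ge0.
have := HK sg tau sg0 tau0.
have I := integrable_fin_num measurableT (integrable_powR_tail 0 tau sg0).
have F : normal_prob 0 sg (tail_set t tau) \is a fin_num.
  by apply: fin_num_measure; exact: measurable_tail_set.
rewrite /tail_mean -[X in (X <= _)%E -> _]fineK//.
rewrite -[X in (_ * X)%E]fineK// -EFinM lee_fin.
set p := fine (normal_prob 0 sg _).
have p0 : 0 <= p by exact: fine_ge0.
have [p1|p1] := ltP 0 p; first by move=> h; rewrite ler_pdivrMr.
have -> : p = 0 by apply/eqP; rewrite eq_le p0 p1.
by move=> _; rewrite invr0 mulr0.
Qed.

Lemma tail_meanE sg tau : 0 < sg -> 0 <= tau ->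
  (\int[normal_prob 0 sg]_x (`|x : R| `^ t * \1_(tail_set t tau) x)%:E =
   (tail_mean sg tau)%:E * normal_prob 0 sg (tail_set t tau))%E.
Proof.
move=> sg0 tau0.
have I := integrable_fin_num measurableT (integrable_powR_tail 0 tau sg0).
have F : normal_prob 0 sg (tail_set t tau) \is a fin_num.
  by apply: fin_num_measure; exact: measurable_tail_set.
have [K K0 HK] := normal_tail_mean t0.
have := HK sg tau sg0 tau0.
rewrite -[X in (_ * X)%E]fineK// -[in X in _ -> X](fineK F) -[X in (X <= _)%E]fineK//.
rewrite -[LHS]fineK//.
rewrite -!EFinM lee_fin /tail_mean.
set p := fine (normal_prob 0 sg _); set q := fine (integral _ _ _).
(* If the tail had probability 0, the quotient would be 0 by convention, and the bound [qp] forces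
   the integral [q] to vanish as well. *)
move=> qp; congr EFin; have [p1|p1] := eqVneq p 0; last by rewrite divfK.
have q0 : 0 <= q.
  by apply: fine_ge0; apply: integral_ge0 => x _; rewrite lee_fin mulr_ge0 ?powR_ge0.
by rewrite p1 mulr0; apply/eqP; rewrite eq_le q0 andbT (le_trans qp)// p1 mulr0.
Qed.

Lemma integrable_indic_tail m sg tau a :
  (normal_prob m sg).-integrable [set: RR]
    (fun x : RR => (a * \1_(tail_set t tau) x)%:E).
Proof.
have i1 : (normal_prob m sg).-integrable [set: RR]
    (fun x : RR => (\1_(tail_set t tau) x : R)%:E).
  by apply: integrable_indic => //; exact: measurable_tail_set.
have := integrableZl measurableT a i1.
by apply: eq_integrable => // x _; rewrite EFinM.
Qed.

Lemma truncatedE tau a x : truncated tau a x =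
  `|x| `^ t * \1_(tail_set t tau) x - a * \1_(tail_set t tau) x.
Proof. by rewrite /truncated mulrBl. Qed.

Lemma integrable_truncated m sg tau a : 0 < sg ->
  (normal_prob m sg).-integrable [set: RR] (fun x : RR => (truncated tau a x)%:E).
Proof.
move=> sg0; have := integrableB measurableT (integrable_powR_tail m tau sg0)
  (integrable_indic_tail m sg tau a).
apply: eq_integrable => // x _ /=; rewrite truncatedE EFinB//.
Qed.

Lemma truncated_mean0 sg tau : 0 < sg -> 0 <= tau ->
  (\int[normal_prob 0 sg]_x (truncated tau (tail_mean sg tau) x)%:E = 0)%E.
Proof.
move=> sg0 tau0.
under eq_integral do rewrite truncatedE EFinB.
rewrite integralB; [|exact: measurableT|exact: integrable_powR_tail
  |exact: integrable_indic_tail].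
rewrite tail_meanE//.
under [X in (_ - X)%E]eq_integral do rewrite EFinM.
have i1 : (normal_prob 0 sg).-integrable [set: RR]
    (fun x : RR => (\1_(tail_set t tau) x : R)%:E).
  by apply: integrable_indic => //; exact: measurable_tail_set.
rewrite integralZl//= integral_indic//=; last exact: measurable_tail_set.
rewrite setIT subee// fin_numM//.
by apply: fin_num_measure; exact: measurable_tail_set.
Qed.

(* Pointwise, [truncated^2 <= |x|^2t 1 - 2 a truncated], and the last term is
   centered. *)
Lemma truncated_variance0 : exists2 K : R, 0 <= K & forall sg l tau,
  0 < sg -> 0 <= l -> 0 <= tau -> (2 * l) `^ t <= tau ->
  (\int[normal_prob 0 sg]_x ((truncated tau (tail_mean sg tau) x - 0) ^+ 2)%:E
   <= (K * ((sg `^ t) ^+ 2 * expR (- l ^+ 2 / sg ^+ 2)))%:E)%E.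
Proof.
have [K K0 HK] := normal_tail_sqr t0; exists K; first exact: K0.
move=> sg l tau sg0 l0 tau0 ltau.
apply: le_trans (HK sg l tau sg0 l0 ltau).
set a := tail_mean sg tau.
pose P := normal_prob 0 sg.
have mf := measurable_truncated tau a.
have mq : measurable_fun [set: RR]
    (fun x : RR => ((`|x : R| `^ t) ^+ 2 * \1_(tail_set t tau) x)%:E).
  apply: measurable_mul_tail; apply: measurable_funX; exact: measurable_normr_powR0.
have iq : P.-integrable [set: RR]
    (fun x : RR => ((`|x : R| `^ t) ^+ 2 * \1_(tail_set t tau) x)%:E).
  apply/integrableP; split; first exact: mq.
  rewrite (_ : (\int[P]_x _)%E =
    (\int[P]_x ((`|x : R| `^ t) ^+ 2 * \1_(tail_set t tau) x)%:E)%E).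
    exact: le_lt_trans (HK sg l tau sg0 l0 ltau) (ltry _).
  by apply: eq_integral => x _; rewrite gee0_abs// lee_fin mulr_ge0 ?sqr_ge0.
have it := integrable_truncated 0 tau a sg0.
have iZ : P.-integrable [set: RR] (fun x : RR => ((2 * a)%:E * (truncated tau a x)%:E)%E).
  exact: (integrableZl measurableT).
apply: (@le_trans _ _ (\int[P]_x (((`|x : R| `^ t) ^+ 2 * \1_(tail_set t tau) x)%:E
    - (2 * a)%:E * (truncated tau a x)%:E))%E).
  apply: ge0_le_integralT.
  - by apply/measurable_EFinP; apply: measurable_funX; exact: measurable_funB.
  - exact: measurable_int (integrableB measurableT iq iZ).
  - by move=> x; rewrite lee_fin sqr_ge0.
  - move=> x; rewrite -EFinM -EFinB lee_fin subr0 /truncated indic_tail.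
    have := sqr_ge0 a.
    by case: (_ < _); rewrite ?mulr1 ?mulr0 ?expr0n/= ?subrr// sqrrB; lra.
rewrite integralB; [|exact: measurableT|exact: iq|exact: iZ].
rewrite integralZl; [|exact: measurableT|exact: it].
by rewrite truncated_mean0// mule0 sube0.
Qed.

Definition truncated_mean m sg tau a : R :=
  fine (\int[normal_prob m sg]_x (truncated tau a x)%:E)%E.

Lemma truncated_meanE m sg tau a : 0 < sg ->
  (\int[normal_prob m sg]_x (truncated tau a x)%:E = (truncated_mean m sg tau a)%:E)%E.
Proof.
move=> sg0; rewrite /truncated_mean fineK//.
exact: (integrable_fin_num measurableT (integrable_truncated m tau a sg0)).
Qed.

(** Pointwise [truncated >= |x|^t - (tau + a)]: the tail loses only [a], and off the tail
    [|x|^t <= tau]. The mean of [|x|^t] is at least [|m|^t]. *)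
Lemma truncated_mean_ge m sg tau a : 0 < sg -> 0 <= tau -> 0 <= a ->
  `|m| `^ t - (tau + a) <= truncated_mean m sg tau a.
Proof.
move=> sg0 tau0 a0.
have ic : (normal_prob m sg).-integrable [set: RR] (cst (tau + a)%:E : RR -> \bar R).
  exact: finite_measure_integrable_cst.
have iB := integrableB measurableT (integrable_powR m sg0) ic.
have : (\int[normal_prob m sg]_x ((`|x : R| `^ t)%:E - cst (tau + a)%:E x) <=
  \int[normal_prob m sg]_x (truncated tau a x)%:E)%E.
  apply: (le_integral measurableT iB (integrable_truncated m tau a sg0)).
  move=> x _ /=; rewrite -EFinB lee_fin /truncated indic_tail.
  have [h|h] := ltP tau; rewrite ?mulr1 ?mulr0; first lra.
  by lra.
rewrite integralB; [|exact: measurableT|exact: integrable_powR|exact: ic].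
rewrite integral_cst_prob powR_meanE// truncated_meanE// -EFinB lee_fin.
move=> h; apply: le_trans h; rewrite lerD2r.
by apply: le_trans (powR_mean_ge m sg0); rewrite lerDl powR_mean_ge0.
Qed.

(** Truncating and centering moves [|x|^t] by at most [tau + a], so [(u + e)^2 <= 2 u^2 + 2 e^2]
    reduces the claim to [powR_variance] with [delta / 2]. *)
Lemma truncated_variance (delta : R) : 0 < delta -> exists2 K : R, 0 <= K &
  forall m sg tau a, 0 < sg -> 0 <= tau -> 0 <= a ->
  (\int[normal_prob m sg]_x ((truncated tau a x - `|m| `^ t) ^+ 2)%:E
   <= (delta * (`|m| `^ t) ^+ 2 + K * (sg `^ t) ^+ 2 + 2 * (tau + a) ^+ 2)%:E)%E.
Proof.
move=> d0; have d20 : 0 < delta / 2 by rewrite divr_gt0.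
have [K K0 HK] := powR_variance d20.
exists (2 * K) => [|m sg tau a sg0 tau0 a0]; first by rewrite mulr_ge0.
pose P := normal_prob m sg.
have msq : measurable_fun [set: RR]
    (fun x : RR => ((`|x : R| `^ t - `|m| `^ t) ^+ 2)%:E).
  by apply/measurable_EFinP; apply: measurable_funX; exact: measurable_powR_sub.
have c0 : 0 <= 2 * (tau + a) ^+ 2 by rewrite mulr_ge0// sqr_ge0.
have m2 : measurable_fun [set: RR]
    (fun x : RR => 2%:E * ((`|x : R| `^ t - `|m| `^ t) ^+ 2)%:E)%E.
  exact: emeasurable_funM.
apply: (@le_trans _ _ (\int[P]_x (2%:E * ((`|x : R| `^ t - `|m| `^ t) ^+ 2)%:E
    + (2 * (tau + a) ^+ 2)%:E))%E).
  apply: ge0_le_integralT.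
  - apply/measurable_EFinP; apply: measurable_funX; apply: measurable_funB => //.
    exact: measurable_truncated.
  - by apply: emeasurable_funD.
  - by move=> x; rewrite lee_fin sqr_ge0.
  - move=> x; rewrite -EFinM -EFinD lee_fin.
    set u := `|x : R| `^ t - `|m| `^ t; set w := truncated tau a x - `|m| `^ t.
    suff : exists2 e : R, `|e| <= tau + a & w = u + e.
      move=> [e e1 ->].
      have e2 : e ^+ 2 <= (tau + a) ^+ 2.
        by rewrite -[leLHS]real_normK ?num_real// lerXn2r ?nnegrE ?addr_ge0.
      have -> : (u + e) ^+ 2 = 2 * u ^+ 2 + 2 * e ^+ 2 - (u - e) ^+ 2 by ring.
      rewrite lerBlDr -addrA lerD2l (le_trans (y := 2 * (tau + a) ^+ 2))//.
        by rewrite ler_pM2l.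
      by rewrite lerDl sqr_ge0.
    exists (w - u); last by rewrite subrKC.
    rewrite /w /u /truncated indic_tail; have x0 := powR_ge0 `|x : R| t.
    have [h|h] := ltP tau; rewrite ?mulr1 ?mulr0 ler_norml; apply/andP; split; lra.
rewrite ge0_integralD; [|exact: measurableT| |exact: m2|by []|exact: measurable_cst]; last first.
  by move=> x _; rewrite -EFinM lee_fin mulr_ge0// sqr_ge0.
rewrite integral_cst_prob [leRHS]EFinD leeD2r//.
rewrite ge0_integralZl; [|exact: measurableT|exact: msq|
  by move=> x _; rewrite lee_fin sqr_ge0|by rewrite lee_fin].
rewrite [leRHS](_ : _ = 2%:E * (delta / 2 * (`|m| `^ t) ^+ 2 + K * (sg `^ t) ^+ 2)%:E)%E.
  by rewrite lee_pmul2l//; exact: HK.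
by rewrite -EFinM; congr EFin; field.
Qed.

End coordinate_statistics.

(** * Upper bound *)

Section upper_bound.
Context (R : realType) (t : R) (d s : nat) (sigma : d.-tuple (measurableTypeR R)).
Notation RR := (measurableTypeR R).
Hypothesis t2 : 2 <= t.
Hypothesis sorted_sigma :
  forall i j : 'I_d, (i <= j)%N -> tnth sigma j <= tnth sigma i.
Hypothesis sigma0 : forall j : 'I_d, 0 < tnth sigma j.
Hypothesis s_range : (1 <= s <= d)%N.

Local Notation sg j := (tnth sigma j : R).
Local Notation lam := (lambda s t sigma).
Local Notation N := (nu s t sigma `^ t).
Local Notation rh := (rho s t sigma).
Local Notation ta := (tau s t sigma).
Local Notation js := (jstar s t sigma).
Local Notation L := ((4 * t) `^ t).

Let t0 : 0 < t. Proof. exact: lt_le_trans t2. Qed.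
Let lam0 : 0 <= lam. Proof. exact: lambda_ge0. Qed.
Let N0 : 0 < N. Proof. exact: nu_powR_gt0. Qed.
Let s1 : 1 <= s%:R :> R. Proof. by rewrite ler1n; case/andP: s_range. Qed.
Let s0 : 0 < s%:R :> R. Proof. exact: lt_le_trans s1. Qed.

Let lamt0 : 0 <= lam `^ t. Proof. exact: powR_ge0. Qed.

Let L1 : 1 <= L.
Proof.
by rewrite -[leLHS](powRr0 (4 * t)); apply: ler_powR; have := t2; lra.
Qed.

Lemma rho_gt0 : 0 < rh.
Proof. by rewrite ltr_wpDl ?mulr_ge0. Qed.

Lemma nu_le_rho : N <= rh.
Proof. by rewrite lerDr mulr_ge0. Qed.

Lemma tau_ge0 : 0 <= ta.
Proof. by rewrite addr_ge0 ?mulr_ge0 ?powR_ge0 ?divr_ge0 ?powR_ge0. Qed.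

Lemma lambda_le_tau : lam `^ t <= ta.
Proof.
apply: (@le_trans _ _ (L * lam `^ t)); first by rewrite ler_peMl.
by rewrite lerDl divr_ge0 ?powR_ge0.
Qed.

(** The threshold condition of [truncated_variance0] at [l = lam]; the factor [4 t] in [tau] exceeds
    the required 2. *)
Lemma double_lambda_le_tau : (2 * lam) `^ t <= ta.
Proof.
apply: (@le_trans _ _ (L * lam `^ t)); last by rewrite lerDl divr_ge0 ?powR_ge0.
have t40 : 0 <= 4 * t by rewrite mulr_ge0// ltW.
rewrite -powRM//; apply: ler_powRl.
- exact: ltW.
- by rewrite mulr_ge0.
- by rewrite ler_wpM2r//; have := t2; lra.
Qed.

(** At most [s] coordinates are biased, each by the order of [tau]; their total bias is thus of the
    order of [rho]. *)
Lemma mul_tau_le : s%:R * ta <= L * rh.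
Proof.
rewrite /tau /rho mulrDr mulrCA mulrDr lerD//.
  by rewrite (mulrC s%:R).
by rewrite mulrCA divff ?gt_eqF// mulr1 ler_peMl// ltW.
Qed.

Lemma small_sigma (j : 'I_d) : (js <= j)%N -> sg j `^ t <= ta.
Proof.
rewrite leqNgt lt_jstar// -ltNge => h; apply: le_trans lambda_le_tau.
by apply: ler_powRl; [exact: ltW|exact: ltW|exact: ltW].
Qed.

Lemma tnth_vec0 (j : 'I_d) : tnth (vec0 R d) j = 0 :> R.
Proof. by rewrite tnth_mktuple. Qed.

(** Extended by 0 beyond [jstar], so that the statistic is a sum over all coordinates of the product
    space. *)
Definition dense_coord (j : 'I_d) (y : RR) : R :=
  if (j < js)%N then `|y : R| `^ t - powR_mean t 0 (sg j) else 0.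

Definition sparse_coord (j : 'I_d) (y : RR) : R :=
  if (js <= j)%N then truncated t ta (tail_mean t (sg j) ta) y else 0.

Lemma measurable_dense_coord j : measurable_fun setT (dense_coord j).
Proof.
rewrite /dense_coord; case: (_ < _)%N; last exact: measurable_cst.
exact: measurable_powR_sub.
Qed.

Lemma measurable_sparse_coord j : measurable_fun setT (sparse_coord j).
Proof.
rewrite /sparse_coord; case: (_ <= _)%N; last exact: measurable_cst.
exact: measurable_truncated.
Qed.

Lemma T_denseE x : T_dense s t sigma x = \sum_(j < d) dense_coord j (tnth x j).
Proof.
rewrite /T_dense big_mkcond/=; apply: eq_bigr => j _.
rewrite /dense_coord; case: ifP => // _; congr (_ - fine _).
rewrite unlock /gaussian.
have mf : measurable_fun [set: RR] (fun x : RR => (`|x : R| `^ t)%:E).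
  by apply/measurable_EFinP; exact: measurable_normr_powR0.
rewrite (ge0_integral_prod_prob_coord _ j mf); last first.
  by move=> y; rewrite lee_fin powR_ge0.
by rewrite tnth_vec0.
Qed.

Lemma alphaE j : alpha s t sigma j = tail_mean t (sg j) ta.
Proof. by rewrite /alpha /event_cond_expectation unlock. Qed.

Lemma T_sparseE x : T_sparse s t sigma x = \sum_(j < d) sparse_coord j (tnth x j).
Proof.
rewrite /T_sparse big_mkcond/=; apply: eq_bigr => j _.
by rewrite /sparse_coord; case: ifP => // _; rewrite alphaE.
Qed.

Lemma measurable_sum_coord_gt (h : 'I_d -> RR -> R) (a : R) :
  (forall j, measurable_fun setT (h j)) ->
  measurable [set x : d.-tuple RR | a < \sum_(j < d) h j (tnth x j)].
Proof.
move=> mh; have := measurable_sum_tnth mh measurableT (measurable_itv `]a, +oo[).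
rewrite setTI; congr measurable.
by apply/seteqP; split => x /=; rewrite in_itv/= andbT.
Qed.

Lemma integral_normal_cst0 (m r : R) : (\int[normal_prob m r]_x 0%:E = 0 :> \bar R)%E.
Proof. by rewrite integral0. Qed.

Let Dn : R := \sum_(j < d | (j < js)%N) sg j `^ (2 * t).

(** For a dense coordinate [lam <= sg j], so its factor [exp (- lam^2 / sg j^2)] in [N ^+ 2] is at
    least [1 / e]. *)
Lemma dense_power_le : Dn <= expR 1 * N ^+ 2.
Proof.
rewrite /Dn nu_powR_sqr// mulr_sumr [leLHS]big_mkcond/=; apply: ler_sum => j _.
case: ifP => [|_]; last first.
  by rewrite mulr_ge0 ?expR_ge0// mulr_ge0 ?expR_ge0 ?sqr_ge0.
rewrite lt_jstar// => lj; rewrite powR_double mulrCA ler_peMr ?sqr_ge0//.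
rewrite -expRD -[leLHS]expR0 ler_expR mulNr subr_ge0 ler_pdivrMr ?exprn_gt0//.
by rewrite mul1r lerXn2r ?nnegrE// ltW.
Qed.

Lemma dense_threshold_le : Num.sqrt Dn <= expR 1 * N.
Proof.
have e1 : 1 <= expR 1 :> R by rewrite -[leLHS]expR0 ler_expR.
have h0 : 0 <= expR 1 * N by rewrite mulr_ge0 ?expR_ge0// ltW.
rewrite -[leRHS]ger0_norm// -sqrtr_sqr ler_wsqrtr// exprMn.
apply: le_trans dense_power_le _; rewrite ler_wpM2r ?sqr_ge0// expr2.
by rewrite ler_peMr// expR_ge0.
Qed.

Section null_hypothesis.
Variables (M K1 eta C : R).
Hypothesis M0 : 0 <= M.
Hypothesis K10 : 0 <= K1.
Hypothesis C0 : 0 < C.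
Hypothesis HM : forall sg, 0 < sg ->
  (\int[normal_prob 0 sg]_x ((`|x : RR| `^ t) ^+ 2)%:E <= (M * (sg `^ t) ^+ 2)%:E)%E.
Hypothesis HK1 : forall sg l tau, 0 < sg -> 0 <= l -> 0 <= tau -> (2 * l) `^ t <= tau ->
  (\int[normal_prob 0 sg]_x ((truncated t tau (tail_mean t sg tau) x - 0) ^+ 2)%:E
   <= (K1 * ((sg `^ t) ^+ 2 * expR (- l ^+ 2 / sg ^+ 2)))%:E)%E.
Hypothesis CM : 4 * M <= C ^+ 2 * eta.
Hypothesis CK1 : 4 * K1 <= C ^+ 2 * eta.

Lemma null_dense :
  (gaussian (vec0 R d) sigma
    [set x | (C * Num.sqrt Dn < \sum_(j < d) dense_coord j (tnth x j))%R] <= (eta / 4)%:E)%E.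
Proof.
have C20 : 0 < C ^+ 2 by rewrite exprn_gt0.
have eta0 : 0 <= eta by rewrite -(pmulr_rge0 _ C20); apply: le_trans CM; rewrite mulr_ge0.
(* Without dense coordinates the threshold is 0 and Chebyshev's inequality does not apply, but then
   the statistic is 0 and never exceeds it. *)
have [/existsP[j jd]|] := boolP [exists j : 'I_d, (j < js)%N]; last first.
  rewrite negb_exists => /forallP none.
  rewrite (_ : [set x | _] = set0) ?measure0 ?lee_fin ?divr_ge0//.
  apply/seteqP; split => // x /=; rewrite big1 => [|j _].
    by rewrite ltNge mulr_ge0 ?sqrtr_ge0// ltW.
  by rewrite /dense_coord (negbTE (none j)).
have Dn0 : 0 < Dn.
  rewrite /Dn (bigD1 j)//= ltr_wpDr ?powR_gt0//.
  by apply: sumr_ge0 => i _; exact: powR_ge0.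
(* This choice of [c] cancels the centering and leaves the raw moment [|x|^2t], which [HM]
   bounds. *)
pose c (j : 'I_d) : R := if (j < js)%N then - powR_mean t 0 (sg j) else 0.
pose v (j : 'I_d) : R := if (j < js)%N then M * sg j `^ (2 * t) else 0.
have H := @prod_prob_chebyshev _ _ R d
  (fun j => normal_prob (tnth (vec0 R d) j) (tnth sigma j)) dense_coord
  (fun _ => 0) c v _ (C * Num.sqrt Dn) measurable_dense_coord.
apply: le_trans (H _ _ _ _ _ _) _.
- move=> i; rewrite tnth_vec0 /dense_coord; case: (ltnP i js) => _; last exact: integral_normal_cst0.
  under eq_integral do rewrite EFinB.
  rewrite integralB; [|exact: measurableT|exact: integrable_powR|
    exact: finite_measure_integrable_cst].
  by rewrite integral_cst_prob powR_meanE// subee.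
- move=> i; rewrite tnth_vec0 /dense_coord /c /v; case: (ltnP i js) => _.
    rewrite powR_double; apply: le_trans (HM (sigma0 i)).
    rewrite le_eqVlt; apply/orP; left; apply/eqP; apply: eq_integral => x _.
    by rewrite opprK subrK.
  under eq_integral do rewrite subr0 expr0n/=.
  by rewrite integral_normal_cst0 lee_fin.
- exact: (measurable_sum_coord_gt _ measurable_dense_coord).
- by apply: mulr_gt0 => //; rewrite sqrtr_gt0.
- move=> x /= /ltW h; rewrite [X in _ - X]big1// subr0; apply: le_trans h _; exact: ler_norm.
rewrite lee_fin exprMn sqr_sqrtr ?(ltW Dn0)//.
rewrite /v -big_mkcond/= -mulr_sumr -/Dn.
rewrite ler_pdivrMr ?mulr_gt0//.
have := ler_wpM2r (ltW Dn0) CM; lra.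
Qed.

Lemma null_sparse :
  (gaussian (vec0 R d) sigma
    [set x | (C * rh < \sum_(j < d) sparse_coord j (tnth x j))%R] <= (eta / 4)%:E)%E.
Proof.
have C20 : 0 < C ^+ 2 by rewrite exprn_gt0.
have r0 := rho_gt0.
pose v (j : 'I_d) : R := K1 * ((sg j `^ t) ^+ 2 * expR (- lam ^+ 2 / sg j ^+ 2)).
have v0 j : 0 <= v j.
  by rewrite /v mulr_ge0// mulr_ge0 ?sqr_ge0 ?expR_ge0.
have H := @prod_prob_chebyshev _ _ R d
  (fun j => normal_prob (tnth (vec0 R d) j) (tnth sigma j)) sparse_coord
  (fun _ => 0) (fun _ => 0) v _ (C * rh) measurable_sparse_coord.
apply: le_trans (H _ _ _ _ _ _) _.
- move=> i; rewrite tnth_vec0 /sparse_coord; case: (leqP js i) => _; last exact: integral_normal_cst0.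
  by rewrite truncated_mean0// tau_ge0.
- move=> i; rewrite tnth_vec0 /sparse_coord; case: (leqP js i) => _.
    exact: (HK1 (sigma0 i) lam0 tau_ge0 double_lambda_le_tau).
  by under eq_integral do rewrite subr0 expr0n/=; rewrite integral_normal_cst0 lee_fin.
- exact: (measurable_sum_coord_gt _ measurable_sparse_coord).
- exact: (mulr_gt0 C0 r0).
- move=> x /= /ltW h; rewrite [X in _ - X]big1// subr0; apply: le_trans h _; exact: ler_norm.
rewrite lee_fin exprMn -mulr_sumr -nu_powR_sqr//.
have h : N ^+ 2 <= rh ^+ 2.
  by rewrite lerXn2r ?nnegrE ?(ltW N0) ?(ltW r0)// nu_le_rho.
have r20 : 0 < rh ^+ 2 by rewrite exprn_gt0.
rewrite ler_pdivrMr ?mulr_gt0//.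
have := ler_wpM2l K10 h; have := ler_wpM2r (ltW r20) CK1; lra.
Qed.

Lemma null_bound :
  (gaussian (vec0 R d) sigma [set x | psi_test C s t sigma x = true] <= (eta / 2)%:E)%E.
Proof.
pose Ad := [set x : d.-tuple RR | C * Num.sqrt Dn < \sum_(j < d) dense_coord j (tnth x j)].
pose As := [set x : d.-tuple RR | C * rh < \sum_(j < d) sparse_coord j (tnth x j)].
have mAd : measurable Ad := measurable_sum_coord_gt _ measurable_dense_coord.
have mAs : measurable As := measurable_sum_coord_gt _ measurable_sparse_coord.
rewrite (_ : [set x | _] = Ad `|` As); last first.
  apply/seteqP; split => x /=; rewrite /psi_test /psi_dense /psi_sparse T_denseE T_sparseE.
    by move/orP.
  by move=> h; apply/orP.
apply: le_trans (measureU2 _ mAd mAs) _.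
rewrite (_ : (eta / 2)%:E = (eta / 4)%:E + (eta / 4)%:E)%E.
  by apply: leeD; [exact: null_dense|exact: null_sparse].
by rewrite -EFinD; congr EFin; field.
Qed.

End null_hypothesis.

Section alternative_hypothesis.
Variables (K1 K2 Kd Ks eta C C' : R) (theta : d.-tuple RR).
Hypothesis K10 : 0 <= K1.
Hypothesis K20 : 0 <= K2.
Hypothesis Kd0 : 0 <= Kd.
Hypothesis Ks0 : 0 <= Ks.
Hypothesis C0 : 0 < C.
Hypothesis C'0 : 0 < C'.
Hypothesis eta0 : 0 < eta.
Hypothesis HK1 : forall sg l tau, 0 < sg -> 0 <= l -> 0 <= tau -> (2 * l) `^ t <= tau ->
  (\int[normal_prob 0 sg]_x ((truncated t tau (tail_mean t sg tau) x - 0) ^+ 2)%:E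
   <= (K1 * ((sg `^ t) ^+ 2 * expR (- l ^+ 2 / sg ^+ 2)))%:E)%E.
Hypothesis HK2 : forall sg tau, 0 < sg -> 0 <= tau ->
  tail_mean t sg tau <= 2 `^ t * tau + K2 * sg `^ t.
Hypothesis HKd : forall m sg, 0 < sg ->
  (\int[normal_prob m sg]_x ((`|x : RR| `^ t - `|m| `^ t) ^+ 2)%:E
   <= (eta / 16 * (`|m| `^ t) ^+ 2 + Kd * (sg `^ t) ^+ 2)%:E)%E.
Hypothesis HKs : forall m sg tau a, 0 < sg -> 0 <= tau -> 0 <= a ->
  (\int[normal_prob m sg]_x ((truncated t tau a x - `|m| `^ t) ^+ 2)%:E
   <= (eta / 16 * (`|m| `^ t) ^+ 2 + Ks * (sg `^ t) ^+ 2 + 2 * (tau + a) ^+ 2)%:E)%E.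

Local Notation B := (1 + (2 `^ t + K2)).
Local Notation th j := (tnth theta j : R).
Hypothesis theta_sparse : (norm0 theta <= s)%N.

Hypothesis C'1 : 4 * (C * expR 1) <= C'.
Hypothesis C'2 : 4 * (C + B * L) <= C'.
Hypothesis C'3 : 64 * (Kd * expR 1) <= C' ^+ 2 * eta.
Hypothesis C'4 : 64 * (K1 + (Ks + 2 * B ^+ 2) * L ^+ 2) <= C' ^+ 2 * eta.

Let B0 : 0 <= B.
Proof. by rewrite addr_ge0// addr_ge0// powR_ge0. Qed.

Let eta16 : 0 <= eta / 16. Proof. by rewrite divr_ge0// ltW. Qed.

(** [A] is the signal of one half of the coordinates. Dividing by [A^2 / 4], the term [eta / 16 A^2]
    gives [eta / 4], and [rho <= 2 A / C'] turns [Q rho^2] into at most [16 Q / C'^2 <= eta / 4]. *)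
Lemma chebyshev_ratio (A V Q : R) : C' * rh <= 2 * A ->
  V <= eta / 16 * A ^+ 2 + Q * rh ^+ 2 -> 64 * Q <= C' ^+ 2 * eta ->
  V / (A / 2) ^+ 2 <= eta / 2.
Proof.
move=> CA VA Qe; have r0 := rho_gt0.
have Cr0 : 0 < C' * rh by rewrite mulr_gt0.
have A0 : 0 < A by rewrite -(pmulr_rgt0 _ (ltr0n R 2)); apply: lt_le_trans CA.
rewrite ler_pdivrMr ?exprn_gt0 ?divr_gt0//.
have h1 : (C' * rh) ^+ 2 <= (2 * A) ^+ 2.
  by rewrite lerXn2r ?nnegrE ?(ltW Cr0)// mulr_ge0// ltW.
have h2 := ler_wpM2l (ltW eta0) h1.
have h3 := ler_wpM2r (sqr_ge0 rh) Qe.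
rewrite !exprMn in h2; rewrite expr_div_n; lra.
Qed.

Lemma alternative_dense :
  C' * rh <= 2 * \sum_(j < d | (j < js)%N) `|th j| `^ t ->
  (gaussian theta sigma [set x | psi_test C s t sigma x = false] <= (eta / 2)%:E)%E.
Proof.
set A := \sum_(j < d | _) _ => CA.
have r0 := rho_gt0.
have A0 : 0 < A.
  rewrite -(pmulr_rgt0 _ (ltr0n R 2)); apply: lt_le_trans CA.
  by rewrite mulr_gt0.
pose m (j : 'I_d) : R :=
  if (j < js)%N then powR_mean t (th j) (sg j) - powR_mean t 0 (sg j) else 0.
pose c (j : 'I_d) : R := if (j < js)%N then `|th j| `^ t - powR_mean t 0 (sg j) else 0.
pose v (j : 'I_d) : R :=
  if (j < js)%N then eta / 16 * (`|th j| `^ t) ^+ 2 + Kd * (sg j `^ t) ^+ 2 else 0.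
have H := @prod_prob_chebyshev _ _ R d
  (fun j => normal_prob (tnth theta j) (tnth sigma j)) dense_coord
  m c v [set x | psi_test C s t sigma x = false] (A / 2) measurable_dense_coord.
apply: le_trans (H _ _ _ _ _) _.
- move=> i; rewrite /dense_coord /m; case: (ltnP i js) => _; last exact: integral_normal_cst0.
  under eq_integral do rewrite EFinB.
  rewrite integralB; [|exact: measurableT|exact: integrable_powR|
    exact: finite_measure_integrable_cst].
  by rewrite integral_cst_prob powR_meanE// EFinB.
- move=> i; rewrite /dense_coord /c /v; case: (ltnP i js) => _.
    apply: le_trans (HKd (th i) (sigma0 i)).
    rewrite le_eqVlt; apply/orP; left; apply/eqP; apply: eq_integral => x _.
    by congr (_ ^+ 2)%:E; ring.
  under eq_integral do rewrite subr0 expr0n/=.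
  by rewrite integral_normal_cst0 lee_fin.
- have := measurable_psi_test C s t sigma measurableT (_ : measurable [set false]).
  by rewrite setTI; apply.
- by rewrite divr_gt0.
- move=> x /=; rewrite /psi_test => /negbT; rewrite negb_or => /andP[+ _].
  rewrite /psi_dense -leNgt T_denseE => h.
  have mA : A <= \sum_(i < d) m i.
    rewrite /A big_mkcond/=; apply: ler_sum => j _; rewrite /m.
    by case: ifP => // _; rewrite lerBrDr; exact: powR_mean_ge.
  (* The mean exceeds [A] and the threshold is at most [A / 2], so acceptance requires a deviation
     of at least [A / 2]. *)
  have thr : C * Num.sqrt Dn <= A / 2.
    have h1 := ler_wpM2l (ltW C0) dense_threshold_le.
    have h2 := ler_wpM2l (mulr_ge0 (ltW C0) (expR_ge0 1)) nu_le_rho.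
    have h3 := ler_wpM2r (ltW r0) C'1.
    by rewrite ler_pdivlMr//; lra.
  rewrite distrC; apply: le_trans (ler_norm _).
  by rewrite -/Dn in h; lra.
rewrite lee_fin; apply: (chebyshev_ratio CA _ C'3).
rewrite /v -big_mkcond/= big_split/= -!mulr_sumr lerD//.
  rewrite ler_wpM2l// /A [leLHS]big_mkcond [X in X ^+ 2]big_mkcond/=.
  have := @ler_sum_sqr R d (fun j => if (j < js)%N then `|th j| `^ t else 0).
  move=> h; apply: le_trans (h _); last by move=> i; case: ifP => // _; exact: powR_ge0.
  by apply: ler_sum => j _; case: ifP => // _; rewrite expr0n.
rewrite -mulrA ler_wpM2l//.
apply: (@le_trans _ _ Dn).
  by rewrite /Dn; apply: ler_sum => j _; rewrite powR_double.
apply: le_trans dense_power_le _; rewrite ler_wpM2l ?expR_ge0//.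
by rewrite lerXn2r ?nnegrE ?(ltW N0) ?(ltW r0)// nu_le_rho.
Qed.

Lemma alternative_sparse :
  C' * rh <= 2 * \sum_(j < d | (js <= j)%N) `|th j| `^ t ->
  (gaussian theta sigma [set x | psi_test C s t sigma x = false] <= (eta / 2)%:E)%E.
Proof.
set A := \sum_(j < d | _) _ => CA.
have r0 := rho_gt0.
have A0 : 0 < A.
  rewrite -(pmulr_rgt0 _ (ltr0n R 2)); apply: lt_le_trans CA.
  by rewrite mulr_gt0.
have ta0 := tau_ge0.
pose al (j : 'I_d) : R := tail_mean t (sg j) ta.
have al0 j : 0 <= al j by exact: tail_mean_ge0.
have alB (j : 'I_d) : (js <= j)%N -> ta + al j <= B * ta.
  move=> jj; rewrite mulrDl mul1r lerD2l; apply: le_trans (HK2 (sigma0 j) ta0) _.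
  by rewrite mulrDl lerD2l ler_wpM2l//; exact: small_sigma.
pose m (j : 'I_d) : R :=
  if (js <= j)%N then truncated_mean t (th j) (sg j) ta (al j) else 0.
pose c (j : 'I_d) : R := if (js <= j)%N then `|th j| `^ t else 0.
(* [nz] marks the at most [s] coordinates that pay a bias of order [tau] and a variance of order
   [tau^2]. The others are exactly centered by [alpha_j] and pay only the [K1] term. In [v] the
   bounds for both kinds are added, so that one sum covers all coordinates. *)
pose nz (j : 'I_d) : R := if th j != 0 then 1 else 0.
pose v (j : 'I_d) : R :=
  eta / 16 * (if (js <= j)%N then `|th j| `^ t else 0) ^+ 2 +
  K1 * ((sg j `^ t) ^+ 2 * expR (- lam ^+ 2 / sg j ^+ 2)) +
  (Ks + 2 * B ^+ 2) * ta ^+ 2 * nz j.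
have Q0 : 0 <= Ks + 2 * B ^+ 2 by rewrite addr_ge0// mulr_ge0// sqr_ge0.
have nz0 j : 0 <= nz j by rewrite /nz; case: ifP.
have nzs : \sum_(j < d) nz j <= s%:R.
  have := theta_sparse; rewrite -(ler_nat R) /nz -big_mkcond/=.
  apply: le_trans; rewrite /norm0 -sumr_const.
  by rewrite le_eqVlt; apply/orP; left; apply/eqP; apply: eq_bigl => j; rewrite inE.
have K1pos (j : 'I_d) : 0 <= K1 * ((sg j `^ t) ^+ 2 * expR (- lam ^+ 2 / sg j ^+ 2)).
  by rewrite mulr_ge0// mulr_ge0 ?sqr_ge0 ?expR_ge0.
have Qpos (j : 'I_d) : 0 <= (Ks + 2 * B ^+ 2) * ta ^+ 2 * nz j.
  by rewrite mulr_ge0// mulr_ge0// sqr_ge0.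
have Epos (j : 'I_d) : 0 <= eta / 16 * (if (js <= j)%N then `|th j| `^ t else 0) ^+ 2.
  by rewrite mulr_ge0// sqr_ge0.
have H := @prod_prob_chebyshev _ _ R d
  (fun j => normal_prob (tnth theta j) (tnth sigma j)) sparse_coord
  m c v [set x | psi_test C s t sigma x = false] (A / 2) measurable_sparse_coord.
apply: le_trans (H _ _ _ _ _) _.
- move=> i; rewrite /sparse_coord /m; case: (leqP js i) => _; last exact: integral_normal_cst0.
  exact: truncated_meanE.
- move=> i; have := Epos i; have := Qpos i; have := K1pos i.
  rewrite /sparse_coord /c /v; case: (leqP js i) => ji; last first.
    move=> h1 h2 h3; under eq_integral do rewrite subr0 expr0n/=.
    by rewrite integral_normal_cst0 lee_fin addr_ge0// addr_ge0.
  rewrite /nz; have [thi|thi] := eqVneq (th i) 0.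
    move=> h1 _ h3; rewrite thi normr0 powR0 ?gt_eqF//.
    apply: le_trans (HK1 (sigma0 i) lam0 ta0 double_lambda_le_tau) _.
    by rewrite lee_fin expr0n/= !mulr0 addr0 add0r.
  move=> h1 _ _; apply: le_trans (HKs (th i) (sigma0 i) ta0 (al0 i)) _.
  rewrite lee_fin mulr1 -[leLHS]addrA -[leRHS]addrA lerD2l.
  apply: (@le_trans _ _ ((Ks + 2 * B ^+ 2) * ta ^+ 2)); last by rewrite lerDr.
  rewrite [leRHS]mulrDl; apply: lerD.
    rewrite ler_wpM2l// lerXn2r ?nnegrE ?powR_ge0//; exact: small_sigma.
  rewrite -mulrA ler_pM2l// -exprMn.
  by apply: lerXn2r; rewrite ?nnegrE; [exact: addr_ge0|exact: mulr_ge0|exact: alB].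
- have := measurable_psi_test C s t sigma measurableT (_ : measurable [set false]).
  by rewrite setTI; apply.
- by rewrite divr_gt0.
- move=> x /=; rewrite /psi_test => /negbT; rewrite negb_or => /andP[_].
  rewrite /psi_sparse -leNgt T_sparseE => h.
  have mA : A - B * ta * s%:R <= \sum_(i < d) m i.
    have Bt0 : 0 <= B * ta by rewrite mulr_ge0.
    apply: (@le_trans _ _ (A - B * ta * \sum_(j < d) nz j)).
      by rewrite lerD2l lerN2 ler_wpM2l.
    rewrite /A big_mkcond/= mulr_sumr -sumrB; apply: ler_sum => j _; rewrite /m.
    case: ifP => [jj|_]; last by rewrite sub0r oppr_le0 mulr_ge0.
    rewrite /nz; have [thj|thj] := eqVneq (th j) 0.
      rewrite mulr0 subr0 thj normr0 powR0 ?gt_eqF//.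
      by rewrite -lee_fin -truncated_meanE// truncated_mean0.
    rewrite mulr1; apply: le_trans (truncated_mean_ge t2 (th j) (sigma0 j) ta0 (al0 j)).
    by rewrite lerD2l lerN2; exact: alB.
  have thr : C * rh <= A / 2 - B * ta * s%:R.
    have h1 := ler_wpM2l B0 mul_tau_le.
    have h3 := ler_wpM2r (ltW r0) C'2.
    lra.
  rewrite distrC; apply: le_trans (ler_norm _).
  lra.
rewrite lee_fin; apply: (chebyshev_ratio CA _ C'4).
rewrite /v big_split/= big_split/= -!mulr_sumr -addrA; apply: lerD.
  rewrite ler_wpM2l// /A [X in X ^+ 2]big_mkcond/=.
  by apply: ler_sum_sqr => i; case: ifP => // _; exact: powR_ge0.
rewrite [leRHS]mulrDl; apply: lerD.
  rewrite ler_wpM2l// -nu_powR_sqr//.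
  by rewrite lerXn2r ?nnegrE ?(ltW N0) ?(ltW r0)// nu_le_rho.
rewrite -[leLHS]mulrA -[leRHS]mulrA ler_wpM2l// -[leRHS]exprMn.
(* [s tau^2 <= (s tau)^2] because [s >= 1]; the square is then controlled by [mul_tau_le]. *)
apply: (@le_trans _ _ ((s%:R * ta) ^+ 2)).
  rewrite exprMn mulrC ler_wpM2r ?sqr_ge0//; apply: le_trans nzs _.
  by rewrite expr2 ler_peMr// ltW.
have L0 : 0 <= L by exact: powR_ge0.
rewrite lerXn2r ?nnegrE ?mulr_ge0 ?(ltW s0) ?(ltW r0)//.
exact: mul_tau_le.
Qed.

Lemma norm_powR (u : d.-tuple RR) : norm t u `^ t = \sum_(j < d) `|tnth u j : R| `^ t.
Proof.
rewrite /norm -powRrM mulVf ?gt_eqF// powRr1//.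
by apply: sumr_ge0 => j _; exact: powR_ge0.
Qed.

(** The dense or the sparse coordinates carry at least half of the [t]-th power of the norm, and the
    corresponding statistic alone rejects; hence the factor 2 in both cases. *)
Lemma alternative_bound : C' * rh <= norm t theta `^ t ->
  (gaussian theta sigma [set x | psi_test C s t sigma x = false] <= (eta / 2)%:E)%E.
Proof.
rewrite norm_powR (bigID (fun j : 'I_d => (j < js)%N))/=.
rewrite [X in _ + X](eq_bigl (fun j : 'I_d => (js <= j)%N)); last first.
  by move=> j; rewrite -leqNgt.
set A1 := (X in X + _); set A2 := (X in _ + X) => h.
have [h1|h1] := leP (C' * rh) (2 * A1); first exact: alternative_dense.
apply: alternative_sparse; rewrite -/A2; lra.
Qed.

End alternative_hypothesis.

End upper_bound.

(** * Testing against a mixture *)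

Section mixtures.
Context dsp (T : measurableType dsp) (R : realType).
Local Open Scope ereal_scope.
Variables (I : finType) (w : I -> R) (P0 : probability T R) (P : I -> probability T R).
Variables (l : I -> T -> R) (M : I -> I -> R).
Hypothesis w0 : forall i, (0 <= w i)%R.
Hypothesis w1 : (\sum_i w i = 1)%R.
Hypothesis ml : forall i, measurable_fun setT (l i).
Hypothesis l0 : forall i x, (0 <= l i x)%R.
Hypothesis Pl : forall i (f : T -> \bar R), measurable_fun setT f -> (forall x, 0 <= f x) ->
  \int[P i]_x f x = \int[P0]_x (f x * (l i x)%:E).
Hypothesis M0 : forall i k, (0 <= M i k)%R.
Hypothesis PM : forall i k, \int[P i]_x (l k x)%:E = (M i k)%:E.

(** Second moment of [mixture_lr] under [P0]: one plus the chi-square divergence of the mixture from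
    [P0]. *)
Definition moment2 : R := (\sum_i \sum_k w i * w k * M i k)%R.

Definition mixture_lr (x : T) : R := (\sum_i w i * l i x)%R.

Lemma mixture_lr_ge0 x : (0 <= mixture_lr x)%R.
Proof. by apply: sumr_ge0 => i _; rewrite mulr_ge0// l0. Qed.

Lemma measurable_mixture_lr : measurable_fun setT mixture_lr.
Proof.
by apply: measurable_sum => i; apply: measurable_funM => //; exact: ml.
Qed.

Lemma ge0_integral_mixture_lr (f : T -> \bar R) :
  measurable_fun setT f -> (forall x, 0 <= f x) ->
  \int[P0]_x (f x * (mixture_lr x)%:E) =
  \sum_i (w i)%:E * \int[P i]_x f x.
Proof.
move=> mf f0.
have mg i : measurable_fun setT (fun x => f x * (l i x)%:E).
  by apply: emeasurable_funM => //; apply/measurable_EFinP; exact: ml.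
have g0 i x : 0 <= f x * (l i x)%:E.
  by rewrite mule_ge0// lee_fin l0.
transitivity (\int[P0]_x (\sum_i (w i)%:E * (f x * (l i x)%:E))).
  apply: eq_integral => x _; rewrite /mixture_lr -sumEFin ge0_sume_distrr.
    by apply: eq_bigr => i _; rewrite EFinM muleCA.
  by move=> i _; rewrite lee_fin mulr_ge0// l0.
rewrite ge0_integral_sum; [|exact: measurableT|by move=> i; exact: emeasurable_funM
  |by move=> i x _; rewrite mule_ge0// lee_fin].
apply: eq_bigr => i _; rewrite ge0_integralZl; [|exact: measurableT|exact: mg
  |by move=> x _; exact: g0|by rewrite lee_fin].
by rewrite (Pl _ mf f0).
Qed.

Lemma integral_mixture_lr : \int[P0]_x (mixture_lr x)%:E = 1.
Proof.
have mc : measurable_fun [set: T] (cst 1 : T -> \bar R).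
  exact: measurable_cst.
have H := ge0_integral_mixture_lr mc (fun=> lee01).
transitivity (\int[P0]_x (cst 1 x * (mixture_lr x)%:E)).
  by apply: eq_integral => x _; rewrite /= mul1e.
rewrite H; transitivity ((\sum_i w i)%R%:E); last by rewrite w1.
rewrite -sumEFin; apply: eq_bigr => i _.
rewrite -[RHS]mule1; congr (_ * _).
exact: (integral_cst_prob (P i) 1%R).
Qed.

Lemma integral_mixture_lr_sqr : \int[P0]_x (mixture_lr x ^+ 2)%:E = moment2%:E.
Proof.
have mL : measurable_fun setT (fun x => (mixture_lr x)%:E).
  by apply/measurable_EFinP; exact: measurable_mixture_lr.
have L0 x : 0 <= (mixture_lr x)%:E by rewrite lee_fin mixture_lr_ge0.
have := ge0_integral_mixture_lr mL L0.
under eq_integral do rewrite -EFinM -expr2.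
move=> ->; rewrite /moment2 -sumEFin; apply: eq_bigr => i _.
transitivity ((w i)%:E * \sum_k (w k)%:E *
    (M i k)%:E); last first.
  rewrite ge0_sume_distrr; last first.
    by move=> k _; rewrite mule_ge0// lee_fin.
  by rewrite -sumEFin; apply: eq_bigr => k _; rewrite !EFinM muleA.
congr (_ * _).
have mk k : measurable_fun setT (fun x => (l k x)%:E).
  by apply/measurable_EFinP; exact: ml.
have k0 k x : 0 <= (l k x)%:E by rewrite lee_fin l0.
transitivity (\int[P i]_x
    (\sum_k (w k)%:E * (l k x)%:E)).
  by apply: eq_integral => x _; rewrite /mixture_lr -sumEFin.
rewrite ge0_integral_sum; [|exact: measurableT|by move=> k; exact: emeasurable_funM
  |by move=> k x _; rewrite mule_ge0// lee_fin].
apply: eq_bigr => k _; rewrite ge0_integralZl; [|exact: measurableT|exact: mk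
  |by move=> x _; exact: k0|by rewrite lee_fin].
by rewrite PM.
Qed.

(* With [L] the mixture likelihood ratio,
   [2 a 1_B + 2 L <= 2 a 1_B L + L^2 + a^2 + 1] pointwise; then integrate. *)
Lemma mixture_test_bound (B : set (T)) (a : R) :
  measurable B -> (0 < a)%R -> (moment2 <= 1 + a ^+ 2)%R ->
  (fine (P0 B) <= \sum_i w i * fine (P i B) + a)%R.
Proof.
move=> mB a0 chi.
pose L := mixture_lr.
have mL : measurable_fun setT L by exact: measurable_mixture_lr.
have L0 x : (0 <= L x)%R by exact: mixture_lr_ge0.
have mI : measurable_fun setT (\1_B : T -> R) by exact: measurable_indic.
have a20 : (0 <= 2 * a)%R by rewrite mulr_ge0// ltW.
have mE (f : T -> R) : measurable_fun setT f ->
    measurable_fun setT (fun x => (f x)%:E).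
  by move=> mf; apply/measurable_EFinP.
have IB (Q : probability T R) : \int[Q]_x (\1_B x)%:E = Q B.
  by rewrite integral_indic ?setIT.
have I0 x : 0 <= (\1_B x : R)%:E by rewrite lee_fin.
have L0E x : 0 <= (L x)%:E by rewrite lee_fin.
have IBL : \int[P0]_x ((\1_B x)%:E * (L x)%:E) =
    (\sum_i w i * fine (P i B))%:E.
  rewrite (ge0_integral_mixture_lr (mE _ mI) I0).
  rewrite -sumEFin; apply: eq_bigr => i _; rewrite EFinM fineK ?fin_num_measure//.
  by rewrite IB.
have mZI : measurable_fun setT (fun x => (2 * a)%:E * (\1_B x)%:E).
  by apply: emeasurable_funM; [exact: measurable_cst|exact: mE].
have ZI0 x : 0 <= (2 * a)%:E * (\1_B x)%:E by apply: mule_ge0.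
have mZL : measurable_fun setT (fun x => 2%:E * (L x)%:E).
  by apply: emeasurable_funM; [exact: measurable_cst|exact: mE].
have ZL0 x : 0 <= 2%:E * (L x)%:E by apply: mule_ge0.
have lhs : \int[P0]_x ((2 * a)%:E * (\1_B x)%:E + 2%:E * (L x)%:E) =
    (2 * a * fine (P0 B) + 2)%:E.
  rewrite ge0_integralD; [|exact: measurableT|by move=> x _; exact: ZI0|exact: mZI
    |by move=> x _; exact: ZL0|exact: mZL].
  rewrite ge0_integralZl; [|exact: measurableT|exact: mE|by move=> x _; exact: I0
    |by rewrite lee_fin].
  rewrite ge0_integralZl; [|exact: measurableT|exact: mE|by move=> x _; exact: L0E
    |by rewrite lee_fin].
  have F : P0 B \is a fin_num by exact: fin_num_measure.
  by rewrite integral_mixture_lr mule1 IB -{1}(fineK F) -EFinM -EFinD.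
have mBL : measurable_fun setT (fun x => (\1_B x)%:E * (L x)%:E).
  by apply: emeasurable_funM; exact: mE.
have BL0 x : 0 <= (\1_B x)%:E * (L x)%:E by apply: mule_ge0.
have mZBL : measurable_fun setT (fun x => (2 * a)%:E * ((\1_B x)%:E * (L x)%:E)).
  by apply: emeasurable_funM; [exact: measurable_cst|exact: mBL].
have ZBL0 x : 0 <= (2 * a)%:E * ((\1_B x)%:E * (L x)%:E) by apply: mule_ge0.
have mL2 : measurable_fun setT (fun x => (L x ^+ 2)%:E).
  by apply: mE; exact: measurable_funX.
have L20 x : 0 <= (L x ^+ 2)%:E by rewrite lee_fin sqr_ge0.
have mS : measurable_fun setT
    (fun x => (2 * a)%:E * ((\1_B x)%:E * (L x)%:E) + (L x ^+ 2)%:E).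
  exact: emeasurable_funD.
have c0 : 0 <= (a ^+ 2 + 1)%:E by rewrite lee_fin addr_ge0// sqr_ge0.
have rhs : \int[P0]_x ((2 * a)%:E * ((\1_B x)%:E * (L x)%:E) + (L x ^+ 2)%:E +
     (a ^+ 2 + 1)%:E) =
    (2 * a * (\sum_i w i * fine (P i B)) + moment2 +
     (a ^+ 2 + 1))%:E.
  rewrite ge0_integralD; [|exact: measurableT|by move=> x _; apply: adde_ge0|exact: mS
    |by move=> x _; exact: c0|exact: measurable_cst].
  rewrite integral_cst_prob ge0_integralD; [|exact: measurableT|by move=> x _; exact: ZBL0
    |exact: mZBL|by move=> x _; exact: L20|exact: mL2].
  rewrite ge0_integralZl; [|exact: measurableT|exact: mBL|by move=> x _; exact: BL0
    |by rewrite lee_fin].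
  by rewrite IBL integral_mixture_lr_sqr -EFinM -!EFinD.
have : \int[P0]_x ((2 * a)%:E * (\1_B x)%:E + 2%:E * (L x)%:E) <=
  \int[P0]_x ((2 * a)%:E * ((\1_B x)%:E * (L x)%:E) + (L x ^+ 2)%:E + (a ^+ 2 + 1)%:E).
  apply: ge0_le_integralT.
  - exact: emeasurable_funD.
  - by apply: emeasurable_funD => //; exact: measurable_cst.
  - by move=> x; apply: adde_ge0.
  (* The difference of the two sides is [(a - (1 - L))^2] on [B] and [(1 - L)^2 + a^2] off it. *)
  - move=> x; rewrite -!EFinM -!EFinD lee_fin indicE.
    have := sqr_ge0 (a - (1 - L x))%R; have := sqr_ge0 (1 - L x)%R.
    have := sqr_ge0 a.
    by case: (_ \in _); rewrite ?mulr1 ?mul1r ?mulr0 ?mul0r ?mulr0; nra.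
rewrite lhs rhs lee_fin => h.
have h2 : (2 * a * fine (P0 B) <=
    2 * a * (\sum_i w i * fine (P i B) + a))%R.
  by rewrite mulrDr; nra.
by move: h2; rewrite ler_pM2l// mulr_gt0.
Qed.

End mixtures.

(** * Finite mixtures of Gaussian shifts *)

Section gaussian_mixtures.
Context (R : realType) (d : nat) (sigma : d.-tuple (measurableTypeR R)).
Notation RR := (measurableTypeR R).
Hypothesis sigma0 : forall j : 'I_d, 0 < tnth sigma j.
Local Open Scope ereal_scope.

Local Notation sg j := (tnth sigma j : R).
Local Notation P0 := (gaussian (vec0 R d) sigma).
Local Notation vec u := ([tuple (u j : RR) | j < d]).

Definition gaussian_lr (u : 'I_d -> R) (x : d.-tuple RR) : R :=
  \prod_(j < d) gauss_lr (sg j) (u j) (tnth x j).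

Lemma gaussian_lr_ge0 u x : (0 <= gaussian_lr u x)%R.
Proof. by apply: prodr_ge0 => j _; exact: expR_ge0. Qed.

Lemma measurable_gaussian_lr u : measurable_fun setT (gaussian_lr u).
Proof.
apply: (@measurable_prod_tnth _ RR R d (fun j => gauss_lr (sg j) (u j) : RR -> R)) => j.
exact: measurable_gauss_lr.
Qed.

Lemma ge0_integral_gaussian_lr u (f : d.-tuple RR -> \bar R) :
  measurable_fun setT f -> (forall x, 0 <= f x) ->
  \int[gaussian (vec u) sigma]_x f x = \int[P0]_x (f x * (gaussian_lr u x)%:E).
Proof.
move=> mf f0.
have PQ j (g : RR -> \bar R) : measurable_fun setT g -> (forall x, 0 <= g x) ->
    \int[normal_prob (tnth (vec u) j) (sg j)]_x g x =
    \int[normal_prob (tnth (vec0 R d) j) (sg j)]_x (g x * (gauss_lr (sg j) (u j) x)%:E).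
  move=> mg g0; rewrite !tnth_mktuple.
  exact: (ge0_integral_normal_shift (u j) (sigma0 j) mg g0).
exact: (@ge0_integral_prod_prob_density _ RR R d
  (fun j => normal_prob (tnth (vec u) j) (sg j))
  (fun j => normal_prob (tnth (vec0 R d) j) (sg j))
  (fun j => gauss_lr (sg j) (u j) : RR -> R) f
  (fun j => measurable_gauss_lr (sg j) (u j)) (fun j x => expR_ge0 _) PQ mf f0).
Qed.

(** Up to a constant the product of two likelihood ratios is again a likelihood ratio, which
    integrates to 1; the constant is therefore the cross moment of the two shifts. *)
Lemma gaussian_lrM u v x : (gaussian_lr u x * gaussian_lr v x =
  expR (\sum_(j < d) u j * v j / sg j ^+ 2) * gaussian_lr (fun j => u j + v j) x)%R.
Proof.
rewrite expR_sum /gaussian_lr -!big_split/=; apply: eq_bigr => j _.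
rewrite /gauss_lr -!expRD; congr expR; field.
exact: (lt0r_neq0 (sigma0 j)).
Qed.

Lemma integral_gaussian_lr u v :
  \int[gaussian (vec u) sigma]_x (gaussian_lr v x)%:E =
  (expR (\sum_(j < d) u j * v j / sg j ^+ 2))%:E.
Proof.
have m1 w : measurable_fun setT (fun x => (gaussian_lr w x)%:E).
  by apply/measurable_EFinP; exact: measurable_gaussian_lr.
have p1 w x : 0 <= (gaussian_lr w x)%:E by rewrite lee_fin gaussian_lr_ge0.
rewrite (ge0_integral_gaussian_lr u (m1 v) (p1 v)).
pose c := expR (\sum_(j < d) u j * v j / sg j ^+ 2).
transitivity (\int[P0]_x (c%:E * (gaussian_lr (fun j => u j + v j)%R x)%:E)).
  by apply: eq_integral => x _; rewrite -!EFinM mulrC gaussian_lrM.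
rewrite ge0_integralZl; [|exact: measurableT|exact: m1|by move=> x _; exact: p1
  |by rewrite lee_fin expR_ge0].
have mc : measurable_fun [set: d.-tuple RR] (cst 1 : d.-tuple RR -> \bar R).
  exact: measurable_cst.
pose uv j := (u j + v j)%R.
have H := @ge0_integral_gaussian_lr uv (cst 1) mc (fun=> lee01).
have E : \int[P0]_x (gaussian_lr uv x)%:E = 1.
  transitivity (\int[P0]_x (cst 1 x * (gaussian_lr uv x)%:E)).
    by apply: eq_integral => x _; rewrite /= mul1e.
  by rewrite -H; exact: (integral_cst_prob (gaussian (vec uv) sigma) 1%R).
by rewrite E mule1.
Qed.

Definition gaussian_moment2 (I : finType) (w : I -> R) (th : I -> 'I_d -> R) : R :=
  (\sum_i \sum_k w i * w k * expR (\sum_(j < d) th i j * th k j / sg j ^+ 2))%R.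

(** With [B] the acceptance region, the worst type II error is at least the average of [P_i B] under
    [w], and [mixture_test_bound] compares this average with [P0 B]. *)
Lemma risk_ge_mixture (I : finType) (w : I -> R) (th : I -> 'I_d -> R)
    (psi : {mfun d.-tuple RR >-> bool}) (eps a t : R) (s : nat) :
  (forall i, 0 <= w i)%R -> (\sum_i w i = 1)%R ->
  (0 < a)%R -> (gaussian_moment2 w th <= 1 + a ^+ 2)%R ->
  (forall i, w i != 0%R -> alternatives eps s t (vec (th i))) ->
  (1 - a)%:E <= risk psi eps s t sigma.
Proof.
have aux (x y z b : R) : (y <= z -> x <= y + b -> 1 - b <= 1 - x + z)%R by lra.
move=> w0 w1 a0 chi alt.
have mtb := @mixture_test_bound _ _ R I w P0 (fun i => gaussian (vec (th i)) sigma)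
  (fun i => gaussian_lr (th i)) _ w0 w1 (fun i => measurable_gaussian_lr (th i))
  (fun i => gaussian_lr_ge0 (th i)) (fun i => @ge0_integral_gaussian_lr (th i))
  (fun i k => expR_ge0 _) (fun i k => integral_gaussian_lr (th i) (th k)).
pose B := [set x | psi x = false].
have mB : measurable B.
  have : measurable (psi @^-1` [set false]) by exact: measurable_funPTI.
  by [].
rewrite /risk -/B.
have -> : [set x | psi x = true] = ~` B.
  by apply/seteqP; split => x /=; rewrite /B/=; case: (psi x).
set S := ereal_sup _.
have SP i : w i != 0%R -> gaussian (vec (th i)) sigma B <= S.
  by move=> wi; apply: ereal_sup_ubound; exists (vec (th i)) => //; exact: alt.
have S1 : S <= 1 by apply: ge_ereal_sup => _ [u _ <-]; exact: probability_le1.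
have [i wi] : exists i, w i != 0%R.
  have [/existsP//|] := boolP [exists i, w i != 0%R].
  rewrite negb_exists => /forallP h.
  have := w1; rewrite big1; first by move/eqP; rewrite eq_sym oner_eq0.
  by move=> i _; have := h i; rewrite negbK => /eqP.
have S0 : 0 <= S by apply: le_trans (SP i wi).
have Sfin : S \is a fin_num by rewrite ge0_fin_numE// (le_lt_trans S1)// ltry.
have Sw : (\sum_i w i * fine (gaussian (vec (th i)) sigma B) <= fine S)%R.
  rewrite -[leRHS]mul1r -w1 mulr_suml; apply: ler_sum => k _.
  have [->|wk] := eqVneq (w k) 0%R; first by rewrite !mul0r.
  rewrite ler_wpM2l// -lee_fin !fineK//; first exact: SP.
  exact: fin_num_measure.
have := mtb B a mB a0 chi.
rewrite probability_setC// -(fineK Sfin) -[X in _ <= 1 - X + _]fineK ?fin_num_measure//.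
rewrite -EFinB -EFinD lee_fin.
exact: aux Sw.
Qed.

End gaussian_mixtures.

(** * Sparse priors *)

Section sparse_priors.
Context (R : realType) (d : nat) (t : R) (sigma : d.-tuple (measurableTypeR R)).
Hypothesis t0 : 0 < t.
Hypothesis sigma0 : forall j : 'I_d, 0 < tnth sigma j.

Local Notation sg j := (tnth sigma j : R).
Implicit Types (A : seq 'I_d) (n : nat) (m chi : R).

Definition support_size (u : 'I_d -> R) : nat := #|[set j | u j != 0]%SET|.

(* There is a finite prior [w] on vectors [th i] supported in [A]; the second
   moment is that of its likelihood ratio against the null. *)
Definition has_prior A n m chi : Prop :=
  exists (I : finType) (w : I -> R) (th : I -> 'I_d -> R),
  [/\ forall i, 0 <= w i, \sum_i w i = 1,
      forall i, w i != 0 -> [/\ forall j, j \notin A -> th i j = 0,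
        (support_size (th i) <= n)%N & m <= \sum_(j < d) `|th i j| `^ t]
    & gaussian_moment2 sigma w th <= chi].

Lemma has_priorW A n n' m m' chi chi' : (n <= n')%N -> m' <= m -> chi <= chi' ->
  has_prior A n m chi -> has_prior A n' m' chi'.
Proof.
move=> nn mm cc [I [w [th [w0 w1 wth wc]]]]; exists I, w, th; split => //.
- move=> i /wth[h1 h2 h3]; split => //; first exact: leq_trans nn.
  exact: le_trans h3.
- exact: le_trans cc.
Qed.

Lemma has_prior0 A : has_prior A 0 0 1.
Proof.
exists unit, (fun=> 1), (fun _ _ => 0); split => //.
- by rewrite big_const card_unit/= addr0.
- move=> _ _; split => //.
    rewrite /support_size (_ : finset _ = finset.set0) ?cards0//.
    by apply/setP => j; rewrite !inE eqxx.
  by apply: sumr_ge0 => j _; exact: powR_ge0.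
- rewrite /gaussian_moment2 !big_const card_unit/= !addr0 big1 ?expR0 ?mulr1//.
  by move=> j _; rewrite mul0r mul0r.
Qed.

Lemma gaussian_moment2_ge0 (I : finType) (w : I -> R) (th : I -> 'I_d -> R) :
  (forall i, 0 <= w i) -> 0 <= gaussian_moment2 sigma w th.
Proof.
move=> w0; apply: sumr_ge0 => i _; apply: sumr_ge0 => k _.
by rewrite mulr_ge0 ?expR_ge0// mulr_ge0.
Qed.

(** The sum of independent draws from the two priors. On disjoint supports the cross inner products
    vanish, so the exponents add and the second moments multiply. *)
Lemma has_prior_cat A A' n n' m m' chi chi' :
  (forall j, j \in A -> j \notin A') ->
  has_prior A n m chi -> has_prior A' n' m' chi' ->
  has_prior (A ++ A') (n + n') (m + m') (chi * chi').
Proof.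
move=> AA [I [w [th [w0 w1 wth wc]]]] [I' [w' [th' [w0' w1' wth' wc']]]].
pose W (i : I * I') := w i.1 * w' i.2.
pose TH (i : I * I') j := th i.1 j + th' i.2 j.
have W_neq0 i : W i != 0 -> w i.1 != 0 /\ w' i.2 != 0.
  by rewrite mulf_eq0 negb_or => /andP[].
have dis i i' j : w i != 0 -> w' i' != 0 -> th i j = 0 \/ th' i' j = 0.
  move=> /wth[h _ _] /wth'[h' _ _].
  have [jA|jA] := boolP (j \in A); last by left; exact: h.
  by right; apply: h'; exact: AA.
exists (I * I')%type, W, TH; split.
- by move=> i; rewrite mulr_ge0.
- rewrite -(pair_bigA _ (fun i i' => w i * w' i'))/=.
  by under eq_bigr do rewrite -mulr_sumr w1' mulr1.
- move=> [i i'] /W_neq0[/= wi wi']; have [h1 h2 h3] := wth i wi.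
  have [h1' h2' h3'] := wth' i' wi'; split.
  + move=> j; rewrite mem_cat negb_or => /andP[jA jA'].
    by rewrite /TH/= h1// h1'// addr0.
  + apply: leq_trans (leq_add h2 h2'); rewrite /support_size.
    apply: leq_trans (leq_card_setU _ _); apply: subset_leq_card.
    apply/fintype.subsetP => j; rewrite !inE /TH/=; apply: contraR.
    by rewrite negb_or !negbK => /andP[/eqP-> /eqP->]; rewrite addr0.
  + apply: (le_trans (lerD h3 h3')); rewrite -big_split/=; apply: ler_sum => j _.
    rewrite /TH/=; have [->|->] := dis i i' j wi wi'.
      by rewrite normr0 powR0 ?gt_eqF// !add0r.
    by rewrite normr0 powR0 ?gt_eqF// !addr0.
- apply: le_trans (ler_pM (gaussian_moment2_ge0 _ w0) (gaussian_moment2_ge0 _ w0') wc wc').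
  rewrite le_eqVlt; apply/orP; left; apply/eqP.
  rewrite /gaussian_moment2 mulr_suml.
  rewrite -(pair_bigA _ (fun i i' => \sum_k W (i, i') * W k *
     expR (\sum_(j < d) TH (i, i') j * TH k j / sg j ^+ 2)))/=.
  apply: eq_bigr => i _; rewrite mulr_sumr; apply: eq_bigr => i' _.
  rewrite mulr_suml.
  rewrite -(pair_bigA _ (fun k k' => W (i, i') * W (k, k') *
     expR (\sum_(j < d) TH (i, i') j * TH (k, k') j / sg j ^+ 2)))/=.
  apply: eq_bigr => k _; rewrite mulr_sumr; apply: eq_bigr => k' _.
  rewrite /W/=.
  have [->|wi] := eqVneq (w i) 0; first by rewrite !mul0r.
  have [->|wi'] := eqVneq (w' i') 0; first by rewrite mulr0 !mul0r mulr0.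
  have [->|wk] := eqVneq (w k) 0; first by rewrite mul0r !mulr0 !mul0r.
  have [->|wk'] := eqVneq (w' k') 0; first by rewrite !mulr0 !mul0r mulr0.
  have -> : \sum_(j < d) TH (i, i') j * TH (k, k') j / sg j ^+ 2 =
      \sum_(j < d) th i j * th k j / sg j ^+ 2 +
      \sum_(j < d) th' i' j * th' k' j / sg j ^+ 2.
    rewrite -big_split/=; apply: eq_bigr => j _; rewrite -mulrDl /TH/=.
    congr (_ / _); have c1 : th i j * th' k' j = 0.
      by have [->|->] := dis i k' j wi wk'; rewrite ?mul0r ?mulr0.
    have c2 : th' i' j * th k j = 0.
      by have [->|->] := dis k i' j wk wi'; rewrite ?mul0r ?mulr0.
    by rewrite mulrDl !mulrDr c1 c2 addr0 add0r.
  by rewrite expRD; ring.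
Qed.

(** Draw [j] with probability [p j] and an independent random sign, and put [+/- k G j] at [j]. Two
    draws interact only if they pick the same coordinate, so the second moment is
    [1 + sum p_j^2 (cosh x_j - 1)] with [x_j = k^2 G_j^2 / sigma_j^2], and [expR_sym_le] applies
    with [a = k^2]. *)
Lemma has_prior_group A (p G : 'I_d -> R) m (k : R) :
  uniq A -> (forall j, 0 <= p j) -> \sum_(j <- A) p j = 1 ->
  0 < k <= 1 -> (forall j, 0 < G j) -> (forall j, j \in A -> m <= (k * G j) `^ t) ->
  has_prior A 1 m
    (1 + \sum_(j <- A) p j ^+ 2 * (2 * k ^+ 4 * expR (G j ^+ 2 / sg j ^+ 2))).
Proof.
move=> uA p0 p1 /andP[k0 k1] G0 mG.
pose q (j : 'I_d) : R := if j \in A then p j else 0.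
have q0 j : 0 <= q j by rewrite /q; case: ifP.
have sumA (F : 'I_d -> R) : \sum_(j <- A) F j = \sum_(j < d) if j \in A then F j else 0.
  by rewrite -big_mkcond/= big_uniq.
have sumq : \sum_j q j = 1 by rewrite -p1 sumA.
pose sgn (b : bool) : R := if b then 1 else -1.
pose w (i : 'I_d * bool) := q i.1 / 2.
pose th (i : 'I_d * bool) j := if j == i.1 then sgn i.2 * (k * G i.1) else 0.
have sgn_norm b : `|sgn b| = 1 by case: b; rewrite /sgn ?normrN normr1.
exists ('I_d * bool)%type, w, th; split.
- by move=> i; rewrite divr_ge0.
- rewrite -(pair_bigA _ (fun j b => q j / 2))/=.
  rewrite (eq_bigr q); last by move=> j _; rewrite big_bool/= -splitr.
  by rewrite -p1 sumA.
- move=> [j b] wj; have jA : j \in A.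
    by apply: contraR wj => /negbTE jA; rewrite /w /q/= jA mul0r.
  split.
  + move=> i iA; rewrite /th/=; case: eqP => // ij.
    by move: iA; rewrite ij jA.
  + rewrite /support_size -(cards1 j); apply: subset_leq_card.
    by apply/fintype.subsetP => i; rewrite !inE /th/=; case: (i == j) => //; rewrite eqxx.
  + rewrite (bigD1 j)//= big1 => [|i ij]; last first.
      by rewrite /th/= (negbTE ij) normr0 powR0 ?gt_eqF.
    rewrite addr0 /th/= eqxx normrM sgn_norm mul1r gtr0_norm ?mulr_gt0//.
    exact: mG.
- rewrite /gaussian_moment2.
  pose x j := k ^+ 2 * (G j ^+ 2 / sg j ^+ 2).
  have K j b j' b' : \sum_(i < d) th (j, b) i * th (j', b') i / sg i ^+ 2 =
      if j == j' then sgn b * sgn b' * x j else 0.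
    rewrite (bigD1 j)//= big1 => [|i ij]; last by rewrite /th/= (negbTE ij) !mul0r.
    rewrite addr0 /th/= eqxx; case: (eqVneq j j') => [->|jj'].
      by rewrite /x; field; exact: (lt0r_neq0 (sigma0 _)).
    by rewrite mulr0 mul0r.
  pose ch j := (expR (x j) + expR (- x j)) / 2.
  rewrite -(pair_bigA _ (fun j b => \sum_i w (j, b) * w i *
      expR (\sum_(l < d) th (j, b) l * th i l / sg l ^+ 2)))/=.
  have E j : \sum_b \sum_i w (j, b) * w i *
      expR (\sum_(l < d) th (j, b) l * th i l / sg l ^+ 2) =
      \sum_j' q j * q j' * (if j == j' then ch j else 1).
    transitivity (\sum_b \sum_j' \sum_b' w (j, b) * w (j', b') *
        expR (if j == j' then sgn b * sgn b' * x j else 0)).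
      apply: eq_bigr => b _.
      rewrite -(pair_bigA _ (fun j' b' => w (j, b) * w (j', b') *
        expR (\sum_(l < d) th (j, b) l * th (j', b') l / sg l ^+ 2)))/=.
      by apply: eq_bigr => j' _; apply: eq_bigr => b' _; rewrite K.
    rewrite exchange_big/=; apply: eq_bigr => j' _.
    rewrite !big_bool/= /w/= /sgn; case: (j == j').
      rewrite !mulr1 !mul1r mulrN1 opprK !mul1r mulN1r /ch; by field.
    by rewrite !expR0; field.
  rewrite (eq_bigr _ (fun j _ => E j)).
  apply: (@le_trans _ _ (\sum_j (q j + q j ^+ 2 * (2 * k ^+ 4 * expR (G j ^+ 2 / sg j ^+ 2))))).
    apply: ler_sum => j _.
    have chb : ch j - 1 <= 2 * k ^+ 4 * expR (G j ^+ 2 / sg j ^+ 2).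
      rewrite lerBlDl (_ : k ^+ 4 = (k ^+ 2) ^+ 2); last by rewrite -exprM.
      apply: expR_sym_le; last by rewrite divr_ge0 ?sqr_ge0.
      by rewrite sqr_ge0 exprn_ile1// ltW.
    have -> : \sum_j' q j * q j' * (if j == j' then ch j else 1) =
        q j + q j ^+ 2 * (ch j - 1).
      rewrite (eq_bigr (fun j' => q j * q j' +
          (if j' == j then q j ^+ 2 * (ch j - 1) else 0))); last first.
        move=> j' _; rewrite eq_sym; case: eqP => [->|_]; last by rewrite mulr1 addr0.
        by ring.
      by rewrite big_split/= -mulr_sumr sumq mulr1 -big_mkcond/= (big_pred1 j).
    by rewrite lerD2l ler_wpM2l ?sqr_ge0.
  rewrite big_split/= sumq lerD2l sumA; apply: ler_sum => j _.
  by rewrite /q; case: ifP => //; rewrite expr0n/= mul0r.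
Qed.

End sparse_priors.

(** * Cutting the coordinates into groups *)

Section greedy_grouping.
Context (R : realType) (d : nat) (t : R) (sigma : d.-tuple (measurableTypeR R)).
Hypothesis t0 : 0 < t.
Hypothesis sigma0 : forall j : 'I_d, 0 < tnth sigma j.
Local Notation sg j := (tnth sigma j : R).
Variables (p G : 'I_d -> R) (k : R).
Hypothesis p0 : forall j, 0 <= p j.
Hypothesis p1 : forall j, p j <= 1.
Hypothesis G0 : forall j, 0 < G j.
Hypothesis k01 : 0 < k <= 1.

(** The share of a coordinate in the logarithm of the second moment. The constant is [8 = 2 * 4]:
    the 2 of [has_prior_group], and 4 for normalizing a group of mass at least 1/2. *)
Definition group_cost (j : 'I_d) : R :=
  8 * k ^+ 4 * (p j ^+ 2 * expR (G j ^+ 2 / sg j ^+ 2)).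

Lemma group_cost_ge0 j : 0 <= group_cost j.
Proof.
case/andP: k01 => k0 _.
by rewrite mulr_ge0 ?mulr_ge0 ?exprn_ge0 ?sqr_ge0 ?expR_ge0// ltW.
Qed.

(** [1 + x <= exp x] puts the second moment in a form in which the product over groups becomes a sum
    of costs. *)
Lemma has_prior_normalized (A : seq 'I_d) m : uniq A ->
  2^-1 <= \sum_(j <- A) p j -> (forall j, j \in A -> m <= G j `^ t) ->
  has_prior t sigma A 1 (k `^ t * m) (expR (\sum_(j <- A) group_cost j)).
Proof.
move=> uA; set S := \sum_(j <- A) p j => S2 mG.
have S0 : 0 < S by apply: lt_le_trans S2; rewrite invr_gt0.
case/andP: (k01) => k0 k1.
have := @has_prior_group R d t sigma t0 sigma0 A (fun j => p j / S) G (k `^ t * m) k uA.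
move=> /(_ (fun j => divr_ge0 (p0 j) (ltW S0))) h.
apply: has_priorW (h _ k01 G0 _) => //.
- apply: le_trans (expR_ge1Dx _); rewrite lerD2l; apply: ler_sum => j _.
  rewrite /group_cost.
  have S2' : S^-1 <= 2 by rewrite -[leRHS]invrK lef_pV2 ?posrE ?invr_gt0.
  have S4 : (S^-1) ^+ 2 <= 4.
    have -> : 4 = 2 ^+ 2 :> R by rewrite -natrX.
    by rewrite lerXn2r ?nnegrE// invr_ge0 ltW.
  have e0 : 0 <= p j ^+ 2 * (2 * k ^+ 4 * expR (G j ^+ 2 / sg j ^+ 2)).
    by rewrite mulr_ge0 ?sqr_ge0// mulr_ge0 ?expR_ge0// mulr_ge0// exprn_ge0// ltW.
  have := ler_wpM2l e0 S4; rewrite exprMn.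
  set E := expR _; set u := S^-1 ^+ 2; set v := p j ^+ 2; set z := k ^+ 4.
  lra.
- by rewrite -mulr_suml divff// gt_eqF.
- move=> j jA; rewrite powRM ?(ltW k0) ?(ltW (G0 j))//.
  by rewrite ler_wpM2l ?powR_ge0//; exact: mG.
Qed.

(* [B] is the group under construction, closed as soon as its mass reaches 1/2.
   Since [G] decreases along the list, the amplitude reached at the end of a group
   dominates the whole next group, so only the first group, accounted for by [g],
   is lost. *)
Lemma greedy_grouping (l : seq 'I_d) : forall (B : seq 'I_d) (g : R),
  uniq (B ++ l) -> pairwise (fun x y => G y <= G x) l ->
  (forall x y, x \in B -> y \in l -> G y <= G x) ->
  (forall x, x \in B ++ l -> G x `^ t <= g) -> 0 <= g ->
  \sum_(j <- B) p j < 2^-1 ->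
  exists (n : nat) (m : R),
  [/\ has_prior t sigma (B ++ l) n (k `^ t * m) (expR (\sum_(j <- B ++ l) group_cost j)),
      n%:R <= 2 * \sum_(j <- B ++ l) p j, 0 <= m,
      \sum_(j <- B ++ l) p j * G j `^ t <= 2 * g + 2 * m
    & forall c : R, (forall x, x \in B ++ l -> c <= G x `^ t) ->
      2^-1 <= \sum_(j <- B ++ l) p j -> c <= m].
Proof.
elim: l => [|j l IH] B g uB pw BG Gg g0 SB.
  (* A last group of mass below 1/2 receives no prior; its part of the sum is at most [g / 2]. *)
  exists 0%N, 0; rewrite cats0 in uB Gg *; split => //.
  - rewrite mulr0; apply: has_priorW (@has_prior0 R d t sigma B) => //.
    by rewrite -[leLHS]expR0 ler_expR; apply: sumr_ge0 => j _; exact: group_cost_ge0.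
  - by rewrite mulr_ge0// sumr_ge0.
  - rewrite mulr0 addr0.
    apply: (@le_trans _ _ (\sum_(j <- B) p j * g)).
      rewrite big_seq [leRHS]big_seq; apply: ler_sum => j jB.
      by rewrite ler_wpM2l//; exact: Gg.
    rewrite -mulr_suml ler_wpM2r//; apply: ltW; apply: lt_le_trans SB _; lra.
  - by move=> c _; rewrite leNgt SB.
move: pw; rewrite pairwise_cons => /andP[/allP jl pw].
rewrite -cat_rcons in uB Gg *.
have Bj : \sum_(i <- rcons B j) p i = \sum_(i <- B) p i + p j.
  by rewrite -cats1 big_cat/= big_seq1.
have [Sj|Sj] := ltP (\sum_(i <- rcons B j) p i) 2^-1.
  apply: IH => // x y; rewrite mem_rcons in_cons => /orP[/eqP->|xB] yl; first exact: jl.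
  by apply: BG => //; rewrite in_cons yl orbT.
set A := rcons B j in uB Gg Sj Bj *.
have [uA uAl ul] : [/\ uniq A, (forall x, x \in A -> x \notin l) & uniq l].
  move: uB; rewrite cat_uniq => /and3P[? /hasPn h ?]; split => // x xA.
  by apply/negP => /h; rewrite /= xA.
have mA x : x \in A -> G j `^ t <= G x `^ t.
  move=> xA; apply: ler_powRl; [exact: ltW|exact: ltW|].
  move: xA; rewrite mem_rcons in_cons => /orP[/eqP->//|xB].
  by apply: BG => //; exact: mem_head.
have lj x : x \in [::] ++ l -> G x `^ t <= G j `^ t.
  by move=> xl; apply: ler_powRl; [exact: ltW|exact: ltW|exact: jl].
have S0 : \sum_(i <- [::] : seq 'I_d) p i < 2^-1 by rewrite big_nil invr_gt0.
have nB (x y : 'I_d) : x \in [::] -> y \in l -> G y <= G x by [].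
(* [G j ^ t] is the smallest amplitude of the closed group and bounds all later ones. It is both
   what the prior on [A] adds to [m] and the new loss [g] of the rest. *)
have [n [m [hp hn m0 hm hc]]] := IH [::] (G j `^ t) ul pw nB lj (powR_ge0 _ _) S0.
rewrite /= in hp hn hm hc.
exists n.+1, (G j `^ t + m); split.
- rewrite mulrDr big_cat/= expRD -add1n.
  by apply: has_prior_cat => //; exact: has_prior_normalized.
- rewrite big_cat/= -natr1; lra.
- by rewrite addr_ge0// powR_ge0.
- rewrite big_cat/=.
  (* The closed group contributes at most [3/2 g] and the rest at most [2 G j ^ t + 2 m], where
     [2 G j ^ t] is charged to the prior just placed. *)
  have : \sum_(i <- A) p i * G i `^ t <= (2^-1 + 1) * g.
    apply: (@le_trans _ _ (\sum_(i <- A) p i * g)).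
      rewrite big_seq [leRHS]big_seq; apply: ler_sum => i iA.
      by rewrite ler_wpM2l//; apply: Gg; rewrite mem_cat iA.
    rewrite -mulr_suml ler_wpM2r// Bj; apply: lerD => //; exact: ltW.
  by move: hm g0; set x := \sum_(i <- A) _; set y := \sum_(i <- l) _; set z := G j `^ t; lra.
- move=> c hcx _; apply: (@le_trans _ _ (G j `^ t)); last by rewrite lerDl.
  by apply: hcx; rewrite mem_cat mem_rcons mem_head.
Qed.

End greedy_grouping.

(** * The prior attaining the rate *)

Section lower_bound.
Context (R : realType) (t : R) (d s : nat) (sigma : d.-tuple (measurableTypeR R)).
Notation RR := (measurableTypeR R).
Hypothesis t0 : 0 < t.
Hypothesis sorted_sigma :
  forall i j : 'I_d, (i <= j)%N -> tnth sigma j <= tnth sigma i.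
Hypothesis sigma0 : forall j : 'I_d, 0 < tnth sigma j.
Hypothesis s_range : (1 <= s <= d)%N.
Variable k : R.
Hypothesis k01 : 0 < k <= 1.

Local Notation sg j := (tnth sigma j : R).
Local Notation lam := (lambda s t sigma).
Local Notation N := (nu s t sigma `^ t).
Local Notation rh := (rho s t sigma).

Let lam0 : 0 <= lam. Proof. exact: lambda_ge0. Qed.
Let N0 : 0 < N. Proof. exact: nu_powR_gt0. Qed.
Let d0 : (0 < d)%N. Proof. by case/andP: s_range => s1; exact: leq_trans. Qed.
Let j0 : 'I_d := Ordinal d0.
Let sg_le j : sg j <= sg j0. Proof. exact: sorted_sigma. Qed.

Definition weight (j : 'I_d) : R := sg j `^ t * expR (- lam ^+ 2 / sg j ^+ 2) / N.
Definition amplitude (j : 'I_d) : R := Num.max lam (sg j).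

Lemma weight_ge0 j : 0 <= weight j.
Proof. by rewrite /weight divr_ge0 ?(ltW N0)// mulr_ge0 ?powR_ge0 ?expR_ge0. Qed.

Lemma amplitude_gt0 j : 0 < amplitude j.
Proof. by rewrite lt_max sigma0 orbT. Qed.

Lemma amplitude_le (i j : 'I_d) : (i <= j)%N -> amplitude j <= amplitude i.
Proof.
move=> ij; rewrite /amplitude ge_max le_max lexx/=.
by rewrite le_max (sorted_sigma ij) orbT.
Qed.

Lemma expR_le1_lam j : expR (- lam ^+ 2 / sg j ^+ 2) <= 1.
Proof.
by rewrite -[leRHS]expR0 ler_expR mulNr oppr_le0 divr_ge0 ?sqr_ge0.
Qed.

Lemma weight_sqr j : weight j ^+ 2 * N ^+ 2 =
  (sg j `^ t) ^+ 2 * expR (- lam ^+ 2 / sg j ^+ 2) * expR (- lam ^+ 2 / sg j ^+ 2).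
Proof.
rewrite /weight -exprMn divfK ?gt_eqF// exprMn -[RHS]mulrA.
by congr (_ * _); exact: expr2.
Qed.

(** [weight j ^+ 2 * N ^+ 2] is at most the [j]-th summand of [N ^+ 2]. This keeps the last
    coordinate of a group from overshooting its mass by more than 1. *)
Lemma weight_le1 j : weight j <= 1.
Proof.
rewrite -(@ler_pXn2r _ 2) ?nnegrE ?weight_ge0// expr1n.
have N20 : 0 < N ^+ 2 by rewrite exprn_gt0.
rewrite -(ler_pM2r N20) mul1r weight_sqr.
have e0 i : 0 <= (sg i `^ t) ^+ 2 * expR (- lam ^+ 2 / sg i ^+ 2).
  by rewrite mulr_ge0 ?sqr_ge0 ?expR_ge0.
apply: (@le_trans _ _ ((sg j `^ t) ^+ 2 * expR (- lam ^+ 2 / sg j ^+ 2))).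
  by rewrite ler_piMr// expR_le1_lam.
by rewrite nu_powR_sqr// (bigD1 j)//= lerDl sumr_ge0.
Qed.

Lemma sum_weight_le : \sum_(j < d) weight j <= s%:R / 2.
Proof. by rewrite -mulr_suml ler_pdivrMr//; exact: sum_weights_le. Qed.

Lemma sum_weight_eq : 0 < lam -> \sum_(j < d) weight j = s%:R / 2.
Proof. by move=> l0; rewrite -mulr_suml sum_weights_eq// mulfK// gt_eqF. Qed.

Lemma sum_weight_sigma : \sum_(j < d) weight j * sg j `^ t = N.
Proof.
rewrite (eq_bigr (fun j => (sg j `^ t) ^+ 2 * expR (- lam ^+ 2 / sg j ^+ 2) / N)).
  by rewrite -mulr_suml -nu_powR_sqr// expr2 mulfK// gt_eqF.
by move=> j _; rewrite /weight; ring.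
Qed.

(** The two terms of [rho] come from the two lower bounds on the amplitude: [sg j] yields [N]
    exactly, and [lam] yields [lam ^ t] times the mass, which is [s / 2] when [lam > 0]. *)
Lemma sum_weight_amplitude : rh <= 4 * \sum_(j < d) weight j * amplitude j `^ t.
Proof.
have h1 : N <= \sum_(j < d) weight j * amplitude j `^ t.
  rewrite -sum_weight_sigma; apply: ler_sum => j _; rewrite ler_wpM2l ?weight_ge0//.
  by apply: ler_powRl; [exact: ltW|exact: ltW|rewrite le_max lexx orbT].
have h2 : lam `^ t * \sum_(j < d) weight j <= \sum_(j < d) weight j * amplitude j `^ t.
  rewrite mulr_sumr; apply: ler_sum => j _; rewrite mulrC ler_wpM2l ?weight_ge0//.
  by apply: ler_powRl; [exact: ltW|exact: lam0|rewrite le_max lexx].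
have h3 : lam `^ t * s%:R <= 2 * (lam `^ t * \sum_(j < d) weight j).
  have [l0|l0] := ltP 0 lam.
    rewrite sum_weight_eq//; lra.
  have -> : lam = 0 by apply/eqP; rewrite eq_le l0 lam0.
  by rewrite powR0 ?gt_eqF// !mul0r mulr0.
rewrite /rho.
move: h1 h2 h3; set x := \sum_(j < d) _ * _; set y := _ * \sum_(j < d) _.
by have := ltW N0; lra.
Qed.

Lemma amplitude_ratio j : amplitude j ^+ 2 / sg j ^+ 2 <= 1 + lam ^+ 2 / sg j ^+ 2.
Proof.
have s20 : 0 < sg j ^+ 2 by rewrite exprn_gt0.
have q0 : 0 <= lam ^+ 2 / sg j ^+ 2 by rewrite divr_ge0 ?sqr_ge0.
rewrite /amplitude; case: (leP lam (sg j)) => _.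
  by rewrite divff ?gt_eqF// lerDl.
by rewrite lerDr.
Qed.

(** The weights are made for this: [amplitude^2 / sg^2 <= 1 + lam^2 / sg^2], so the amplitude
    cancels one of the two exponentials in [weight^2] and what remains sums to at most [e]. *)
Lemma sum_group_cost :
  \sum_(j < d) group_cost sigma weight amplitude k j <= 8 * expR 1 * k ^+ 4.
Proof.
case/andP: k01 => k0 _.
rewrite /group_cost -mulr_sumr [leRHS]mulrAC ler_wpM2l ?mulr_ge0 ?exprn_ge0 ?(ltW k0)//.
have N20 : 0 < N ^+ 2 by rewrite exprn_gt0.
rewrite -(ler_pM2r N20) mulr_suml [X in _ * X]nu_powR_sqr// mulr_sumr.
apply: ler_sum => j _; rewrite mulrAC weight_sqr -[leLHS]mulrA [leRHS]mulrC.
rewrite ler_wpM2l ?mulr_ge0 ?powR_ge0 ?expR_ge0// -expRD ler_expR.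
by have := amplitude_ratio j; rewrite mulNr; lra.
Qed.

(* If the loss [g] of the greedy grouping is what matters, then either all
   amplitudes equal [lam] and the first group alone makes up for it, or the single
   coordinate with the largest [sigma] is a good enough prior. *)
Lemma has_prior_lower : exists A : seq 'I_d,
  has_prior t sigma A s (k `^ t * (rh / 16)) (expR (8 * expR 1 * k ^+ 4)).
Proof.
have s1 : (1 <= s)%N by case/andP: s_range.
case/andP: (k01) => k0 k1.
have k40 : 0 <= k ^+ 4 by rewrite exprn_ge0// ltW.
have cost_le : expR (\sum_(j < d) group_cost sigma weight amplitude k j)
    <= expR (8 * expR 1 * k ^+ 4) by rewrite ler_expR; exact: sum_group_cost.
have enumE (F : 'I_d -> R) : \sum_(j <- enum 'I_d) F j = \sum_(j < d) F j.
  by rewrite big_enum.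
have pw : pairwise (fun x y => amplitude y <= amplitude x) (enum 'I_d).
  have : pairwise ltn (map val (enum 'I_d)).
    by rewrite val_enum_ord -(sorted_pairwise ltn_trans) iota_ltn_sorted.
  rewrite pairwise_map; apply: sub_pairwise => x y /ltnW; exact: amplitude_le.
pose g := amplitude j0 `^ t.
have gm x : amplitude x `^ t <= g.
  by apply: ler_powRl; [exact: ltW|exact: ltW (amplitude_gt0 _)|exact: amplitude_le].
have g0 : 0 <= g by exact: powR_ge0.
have S0 : \sum_(j <- [::] : seq 'I_d) weight j < 2^-1 by rewrite big_nil invr_gt0.
have nB (x y : 'I_d) : x \in [::] -> y \in enum 'I_d -> amplitude y <= amplitude x by [].
have [n [m [hp hn m0 hm hc]]] := greedy_grouping t0 sigma0 weight_ge0 weight_le1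
  amplitude_gt0 k01 (enum_uniq 'I_d : uniq ([::] ++ enum 'I_d)) pw nB (fun x _ => gm x) g0 S0.
rewrite /= !enumE in hp hn hm hc.
have rho_le := sum_weight_amplitude.
have final : rh <= 16 * m ->
    exists A : seq 'I_d,
    has_prior t sigma A s (k `^ t * (rh / 16)) (expR (8 * expR 1 * k ^+ 4)).
  move=> rm; exists (enum 'I_d); apply: has_priorW cost_le hp.
  - rewrite -(ler_nat R); apply: le_trans hn _.
    by have := sum_weight_le; lra.
  - by rewrite ler_wpM2l ?powR_ge0// ler_pdivrMr// mulrC.
(* The grouping gives [rho <= 4 (2 g + 2 m)]. Hence either [m >= rho / 16], or [g >= rho / 16]. *)
have [rm|rm] := leP rh (16 * m); first exact: final.
have [ls|ls] := leP lam (sg j0); last first.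
  apply: final.
  have l0 : 0 < lam by apply: lt_trans ls.
  have gE x : amplitude x = lam.
    by rewrite /amplitude max_l// ltW// (le_lt_trans (sg_le x)).
  (* The total mass is [s / 2 >= 1/2], so at least one group was closed, with amplitude [lam]; then
     [rho <= 8 g + 8 m <= 16 m]. *)
  have : g <= m.
    apply: hc => [x _|]; first by rewrite /g !gE.
    by rewrite sum_weight_eq// -[leLHS]mul1r ler_pM2r// ler1n.
  by move: rho_le hm; set x := \sum_(j < d) _; lra.
exists [:: j0].
have rg : rh / 16 <= g.
  by move: rho_le hm; set x := \sum_(j < d) _; lra.
have := @has_prior_group R d t sigma t0 sigma0 [:: j0] (fun=> 1) amplitude
  (k `^ t * (rh / 16)) k isT (fun=> ler01).
rewrite big_seq1 => /(_ erefl k01 amplitude_gt0).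
have h : forall j, j \in [:: j0] -> k `^ t * (rh / 16) <= (k * amplitude j) `^ t.
  move=> j; rewrite inE => /eqP->.
  rewrite powRM ?(ltW k0) ?(ltW (amplitude_gt0 _))//.
  by rewrite ler_wpM2l ?powR_ge0.
move=> /(_ h); apply: has_priorW => //.
rewrite big_seq1 expr1n mul1r.
apply: le_trans (expR_ge1Dx _); rewrite lerD2l.
have -> : amplitude j0 ^+ 2 / sg j0 ^+ 2 = 1.
  by rewrite /amplitude max_r// divff// gt_eqF// exprn_gt0.
rewrite mulrAC ler_wpM2r// ler_wpM2r ?expR_ge0//.
by rewrite ler_nat.
Qed.

End lower_bound.

(** * From risk bounds to the separation radius *)

Section separation.
Context (R : realType) (t : R) (d s : nat) (sigma : d.-tuple (measurableTypeR R)).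
Notation RR := (measurableTypeR R).
Hypothesis t0 : 0 < t.
Hypothesis sorted_sigma :
  forall i j : 'I_d, (i <= j)%N -> tnth sigma j <= tnth sigma i.
Hypothesis sigma0 : forall j : 'I_d, 0 < tnth sigma j.
Hypothesis s_range : (1 <= s <= d)%N.
Local Notation rh := (rho s t sigma).

Let rho_gt0 : 0 < rh.
Proof. by rewrite /rho ltr_wpDl ?mulr_ge0 ?powR_ge0// nu_powR_gt0. Qed.

Lemma minimax_risk_gt (eta k eps : R) : 0 < eta < 1 -> 0 < k <= 1 ->
  expR (8 * expR 1 * k ^+ 4) <= 1 + ((1 - eta) / 2) ^+ 2 ->
  0 < eps -> eps `^ t < k `^ t / 16 * rh ->
  (eta%:E < minimax_risk eps s t sigma)%E.
Proof.
move=> /andP[eta0 eta1] k01 chi eps0 epsr.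
have [A [I [w [th [w0 w1 wth wc]]]]] := has_prior_lower t0 sorted_sigma sigma0 s_range k01.
(* The risk is then at least [1 - a = (1 + eta) / 2], strictly above [eta]. *)
pose a := (1 - eta) / 2.
have a0 : 0 < a by rewrite divr_gt0// subr_gt0.
apply: (@lt_le_trans _ _ (1 - a)%:E); first by rewrite lte_fin /a; lra.
apply: le_ereal_inf_tmp => _ [psi _ <-].
apply: (risk_ge_mixture sigma0 psi w0 w1 a0 (le_trans wc chi)) => i /wth[_ h2 h3].
split; last first.
  rewrite /norm0; apply: leq_trans h2; rewrite /support_size.
  by apply: subset_leq_card; apply/fintype.subsetP => j; rewrite !inE tnth_mktuple.
rewrite /norm; set X := \sum_(j < d) _.
have XE : X = \sum_(j < d) `|th i j| `^ t.
  by apply: eq_bigr => j _; rewrite tnth_mktuple.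
have X0 : 0 <= X by apply: sumr_ge0 => j _; exact: powR_ge0.
have eX : eps `^ t <= X.
  rewrite XE; apply: le_trans h3; apply: le_trans (ltW epsr) _.
  by rewrite mulrAC mulrA.
have -> : eps = (eps `^ t) `^ t^-1.
  by rewrite -powRrM mulfV ?gt_eqF// powRr1// ltW.
apply: ler_powRl => //; first by rewrite invr_ge0 ltW.
exact: powR_ge0.
Qed.

Lemma separation_radius_ge (eta k : R) : 0 < eta < 1 -> 0 < k <= 1 ->
  expR (8 * expR 1 * k ^+ 4) <= 1 + ((1 - eta) / 2) ^+ 2 ->
  ((k `^ t / 16 * rh)%:E <= poweR (separation_radius eta s t sigma) t)%E.
Proof.
move=> eta01 k01 chi.
have c0 : 0 <= k `^ t / 16 * rh.
  by rewrite mulr_ge0 ?(ltW rho_gt0)// divr_ge0 ?powR_ge0.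
pose e := (k `^ t / 16 * rh) `^ t^-1.
have eE : e `^ t = k `^ t / 16 * rh.
  by rewrite -powRrM mulVf ?gt_eqF// powRr1.
have e0 : 0 <= e by exact: powR_ge0.
rewrite -eE -poweR_EFin.
have sep : (e%:E <= separation_radius eta s t sigma)%E.
  apply: le_ereal_inf_tmp => _ [eps [eps0 reps] <-]; rewrite lee_fin leNgt.
  apply/negP => epse.
  have : eps `^ t < k `^ t / 16 * rh.
    by rewrite -eE; apply: gt0_ltr_powR; rewrite ?nnegrE// ltW.
  by move=> /(minimax_risk_gt eta01 k01 chi eps0); rewrite ltNge reps.
apply: gt0_ler_poweR => //; first exact: ltW.
- by rewrite in_itv/= lee_fin e0 leey.
- by rewrite in_itv/= leey andbT; apply: le_trans sep; rewrite lee_fin.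
Qed.

Lemma separation_radius_le (eta C C' : R) : 0 < C' ->
  (gaussian (vec0 R d) sigma [set x | psi_test C s t sigma x = true] <= (eta / 2)%:E)%E ->
  (forall theta : d.-tuple RR, (norm0 theta <= s)%N -> C' * rh <= norm t theta `^ t ->
    (gaussian theta sigma [set x | psi_test C s t sigma x = false] <= (eta / 2)%:E)%E) ->
  (poweR (separation_radius eta s t sigma) t <= (C' * rh)%:E)%E.
Proof.
move=> C0 h0 h1.
have c0 : 0 < C' * rh by rewrite mulr_gt0.
pose e := (C' * rh) `^ t^-1.
have eE : e `^ t = C' * rh.
  by rewrite -powRrM mulVf ?gt_eqF// powRr1// ltW.
have e0 : 0 < e by exact: powR_gt0.
have sep : (separation_radius eta s t sigma <= e%:E)%E.
  apply: ereal_inf_lbound; exists e => //; split => //.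
  apply: (@le_trans _ _ (risk (psi_test C s t sigma : {mfun _ >-> _}) e s t sigma)).
    by apply: ereal_inf_lbound; exists (psi_test C s t sigma).
  rewrite /risk (_ : eta%:E = (eta / 2)%:E + (eta / 2)%:E)%E; last first.
    by rewrite -EFinD -splitr.
  apply: leeD; first exact: h0.
  apply: ge_ereal_sup => _ [u [u1 u2] <-]; apply: h1 => //.
  by rewrite -eE; apply: ler_powRl => //; exact: ltW.
have sep0 : (0 <= separation_radius eta s t sigma)%E.
  by apply: le_ereal_inf_tmp => _ [eps [eps0 _] <-]; rewrite lee_fin ltW.
rewrite -eE -poweR_EFin; apply: gt0_ler_poweR => //; first exact: ltW.
- by rewrite in_itv/= sep0 leey.
- by rewrite in_itv/= lee_fin (ltW e0) leey.
Qed.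

End separation.

(** * Choice of the constants in terms of [eta] and [t] *)

Theorem theorem1 (R : realType) (eta t : R)
    (heta : 0 < eta < 1) (ht : 2 <= t) :
  exists c C C' : R, [/\ 0 < c, 0 < C & 0 < C'] /\
  forall (d : nat) (sigma : d.-tuple (measurableTypeR R)) (s : nat),
    (1 <= d)%N ->
    (forall i j : 'I_d, (i <= j)%N -> tnth sigma j <= tnth sigma i) ->
    (forall j : 'I_d, 0 < tnth sigma j) ->
    (1 <= s <= d)%N ->
    [/\ ((c * (lambda s t sigma `^ t * s%:R + nu s t sigma `^ t))%:E
           <= poweR (separation_radius eta s t sigma) t)%E,
        (gaussian (vec0 R d) sigma [set x | psi_test C s t sigma x = true]
           <= (eta / 2)%:E)%E,
        (forall theta : d.-tuple (measurableTypeR R),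
           (norm0 theta <= s)%N ->
           C' * (lambda s t sigma `^ t * s%:R + nu s t sigma `^ t)
             <= norm t theta `^ t ->
           (gaussian theta sigma [set x | psi_test C s t sigma x = false]
              <= (eta / 2)%:E)%E)
      & (poweR (separation_radius eta s t sigma) t
           <= (C' * (lambda s t sigma `^ t * s%:R + nu s t sigma `^ t))%:E)%E].
Proof.
have t0 : 0 < t by exact: lt_le_trans ht.
have [eta0 eta1] := andP heta.
have eta16 : 0 < eta / 16 by rewrite divr_gt0.
have t20 : 0 < 2 * t by rewrite mulr_gt0.
have [M M0 HM] := @normal_central_moment R (2 * t) t20.
have [K1 K10 HK1] := truncated_variance0 ht.
have [K2 K20 HK2] := tail_mean_le ht.
have [Kd Kd0 HKd] := powR_variance ht eta16.
have [Ks Ks0 HKs] := truncated_variance ht eta16.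
pose L := (4 * t) `^ t; pose B := 1 + (2 `^ t + K2); pose e1 : R := expR 1.
have L0 : 0 <= L by exact: powR_ge0.
have B0 : 0 <= B by rewrite addr_ge0// addr_ge0// powR_ge0.
have e10 : 0 < e1 by exact: expR_gt0.
(* The summand 1 gives [C <= C^2], so a bound linear in [C] suffices for the quadratic requirement
   of the null hypothesis; likewise for [C'], which adds up the requirements of both parts of the
   alternative. *)
pose C := 1 + 4 * (M + K1) / eta.
have C1 : 1 <= C by rewrite lerDl divr_ge0 ?(ltW eta0)// mulr_ge0// addr_ge0.
have C0 : 0 < C by apply: lt_le_trans C1.
pose Q1 := Kd * e1; pose Q2 := K1 + (Ks + 2 * B ^+ 2) * L ^+ 2.
have Q10 : 0 <= Q1 by rewrite mulr_ge0// ltW.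
have Q20 : 0 <= Q2.
  by rewrite addr_ge0// mulr_ge0 ?sqr_ge0// addr_ge0// mulr_ge0// sqr_ge0.
pose C' := 1 + 4 * (C * e1) + 4 * (C + B * L) + 64 * (Q1 + Q2) / eta.
have x1 : 0 <= 4 * (C * e1) by rewrite mulr_ge0// mulr_ge0// ltW.
have x2 : 0 <= 4 * (C + B * L) by rewrite mulr_ge0// addr_ge0 ?mulr_ge0// ltW.
have x3 : 0 <= 64 * (Q1 + Q2) / eta.
  by rewrite divr_ge0 ?(ltW eta0)// mulr_ge0// addr_ge0.
have C'1 : 1 <= C' by rewrite /C'; move: x1 x2 x3; lra.
have C'0 : 0 < C' by apply: lt_le_trans C'1.
have Ceta : 4 * (M + K1) <= C ^+ 2 * eta.
  rewrite -ler_pdivrMr//; apply: (@le_trans _ _ C); first by rewrite lerDr.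
  by rewrite expr2 ler_peMl// ltW.
have C'eta : 64 * (Q1 + Q2) <= C' ^+ 2 * eta.
  rewrite -ler_pdivrMr//; apply: (@le_trans _ _ C').
    by rewrite /C'; move: x1 x2; lra.
  by rewrite expr2 ler_peMl// ltW.
pose a2 := ((1 - eta) / 2) ^+ 2.
have a20 : 0 < a2 by rewrite exprn_gt0// divr_gt0// subr_gt0.
(* As [k <= 1], [k^4 <= k], so the second moment [exp (8 e k^4)] is at most [1 + a2]. *)
pose k := Num.min 1 (ln (1 + a2) / (8 * e1)).
have k01 : 0 < k <= 1.
  rewrite lt_min ltr01/= ge_min lexx andbT divr_gt0 ?mulr_gt0//.
  by rewrite ln_gt0// ltrDl.
have chi : expR (8 * expR 1 * k ^+ 4) <= 1 + ((1 - eta) / 2) ^+ 2.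
  have [k0 k1] := andP k01.
  have k4 : k ^+ 4 <= k.
    by rewrite -[leRHS]expr1; apply: ler_wiXn2l => //; exact: ltW.
  have kl : k <= ln (1 + a2) / (8 * e1) by rewrite ge_min lexx orbT.
  rewrite -[leRHS]lnK; last by rewrite posrE addr_gt0.
  rewrite ler_expR mulrC -ler_pdivlMr ?mulr_gt0//.
  exact: le_trans k4 kl.
exists (k `^ t / 16), C, C'; split.
  by split => //; rewrite divr_gt0// powR_gt0//; case/andP: k01.
move=> d sigma s d1 sorted_sigma sigma0 s_range.
have HM' (sg : R) : 0 < sg ->
    (\int[normal_prob 0 sg]_x ((`|x : measurableTypeR R| `^ t) ^+ 2)%:E
      <= (M * (sg `^ t) ^+ 2)%:E)%E.
  move=> sg0; rewrite -powR_double; apply: le_trans (HM 0 sg sg0).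
  rewrite le_eqVlt; apply/orP; left; apply/eqP; apply: eq_integral => x _.
  by rewrite subr0 powR_double.
have null : (gaussian (vec0 R d) sigma [set x | psi_test C s t sigma x = true]
    <= (eta / 2)%:E)%E.
  apply: (null_bound ht sigma0 s_range M0 K10 C0 HM' HK1).
    by apply: le_trans Ceta; rewrite ler_pM2l// lerDl.
  by apply: le_trans Ceta; rewrite ler_pM2l// lerDr.
have alt (theta : d.-tuple (measurableTypeR R)) : (norm0 theta <= s)%N ->
    C' * rho s t sigma <= norm t theta `^ t ->
    (gaussian theta sigma [set x | psi_test C s t sigma x = false] <= (eta / 2)%:E)%E.
  move=> th0; apply: (alternative_bound ht sorted_sigma sigma0 s_range K10 K20 Kd0 Ks0
    C0 C'0 eta0 HK1 HK2 HKd HKs th0).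
  - by rewrite /C'; move: x2 x3; rewrite -/e1; lra.
  - by rewrite /C'; move: x1 x3; rewrite -/L -/B; lra.
  - by apply: le_trans C'eta; rewrite ler_pM2l// lerDl.
  - by apply: le_trans C'eta; rewrite ler_pM2l// lerDr.
split => //.
- exact: separation_radius_ge.
- exact: separation_radius_le alt.
Qed.
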